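(* For any $s<\frac{1}{250}$, there exists a nontrivial stationary weak solution $B\in L^2(\mathbb T^3)$ of the stationary Electron MHD equations $$\nabla\times B+(B\cdot\nabla)B+\nabla p=0,\qquad \nabla\cdot B=0\qquad\text{on }\mathbb T^3,$$ such that $B\in H^s(\mathbb T^3)$.
   Context: $\mathbb T^3$ is the three-dimensional torus, $B:\mathbb T^3\to\mathbb R^3$ is the unknown vector field, $p$ is a scalar function (the pressure), and $H^s(\mathbb T^3)$ is the $L^2$-based Sobolev space of order $s$. The Electron MHD equations (with resistivity constant set to $1$) are $\partial_t B+\nabla\times((\nabla\times B)\times B)=\Delta B$, $\nabla\cdot B=0$. Given $T>0$ and a weakly divergence-free $B_0\in L^2(\mathbb T^3)$, a weak solution with initial data $B_0$ is a field $B\in L^2([0,T]\times\mathbb T^3)$ that is weakly divergence free for a.e. $t\in[0,T]$ and satisfies $$\int_0^T\!\!\int_{\mathbb T^3}B\cdot\big(\partial_t\phi+\Delta\phi+(B\cdot\nabla)(\nabla\times\phi)\big)\,dx\,dt=-\int_{\mathbb T^3}B_0(x)\cdot\phi(x,0)\,dx$$ for all divergence-free test functions $\phi\in C_c^\infty([0,T)\times\mathbb T^3)$. A stationary weak solution is a weak solution that is independent of the time variable. The stationary system in the claim is obtained from the Electron MHD equations by setting $\partial_tB\equiv0$ and taking the inverse of the curl. For time-independent $B$ the weak formulation amounts to $\int_{\mathbb T^3}B\cdot\big(\Delta\phi+(B\cdot\nabla)(\nabla\times\phi)\big)\,dx=0$ for all smooth divergence-free $\phi$ on $\mathbb T^3$.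 *)

(* Defs.v *)
From HB Require Import structures.
From mathcomp Require Import all_boot all_order all_algebra.
From mathcomp Require Import all_classical all_reals all_analysis.
Set Implicit Arguments.
Unset Strict Implicit.
Unset Printing Implicit Defensive.
Import Order.TTheory GRing.Theory Num.Theory.
Import numFieldNormedType.Exports.
Local Open Scope classical_set_scope.
Local Open Scope ring_scope.

(* The library has this as an instance that inference does not find for iterated
   products; it is restated so that volume gets a sigma-finite structure. *)
Lemma product_sigma_finite d1 d2 (T1 : measurableType d1)
    (T2 : measurableType d2) (R : realType)
    (m1 : {sigma_finite_measure set T1 -> \bar R})
    (m2 : {sigma_finite_measure set T2 -> \bar R}) :
  sigma_finite [set: T1 * T2] (m1 \x m2)%E.
Proof.
by have [] := lebesgue_integral_fubini.measure_function_Measure_isSigmaFinite__to__measure_function_isSigmaFinite m1 m2.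
Qed.

Notation lebesgue R := (@lebesgue_measure R) (only parsing).
Definition area {R : realType} := (lebesgue R \x lebesgue R)%E.
HB.instance Definition _ (R : realType) := Measure.on (@area R).
HB.instance Definition _ (R : realType) := @Measure_isSigmaFinite.Build _ _ _
  (@area R) (@product_sigma_finite _ _ _ _ R (lebesgue R) (lebesgue R)).

Definition volume {R : realType} := (@area R \x lebesgue R)%E.
HB.instance Definition _ (R : realType) := Measure.on (@volume R).
HB.instance Definition _ (R : realType) := @Measure_isSigmaFinite.Build _ _ _
  (@volume R) (@product_sigma_finite _ _ _ _ R (@area R) (lebesgue R)).

(* The torus is (R/Z)^3: functions on it are functions on R^3 with period 1 in
   each coordinate, integrated over the unit cube.  The stationary system is
   invariant under B |-> B(lambda x), so the side length is immaterial. *)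
Notation space3 R := ((R * R) * R)%type (only parsing).
Notation vfield R := ('I_3 -> space3 R -> R) (only parsing).

Section Torus.
Context {R : realType}.
Implicit Types (f : space3 R -> R) (F G : vfield R) (x : space3 R).

Definition unit_vector (i : 'I_3) : space3 R :=
  ((i == 0)%:R, (i == 1)%:R, (i == 2)%:R).

Definition torus_periodic f := forall i x, f (x + unit_vector i) = f x.

Definition cube : set (space3 R) := (`[0, 1] `*` `[0, 1]) `*` `[0, 1].

Definition partial (i : 'I_3) f : space3 R -> R := 'D_(unit_vector i) f.

Definition divergence F x : R := \sum_i partial i (F i) x.

Definition laplacian f x : R := \sum_i partial i (partial i f) x.

(* Indices are taken modulo 3 by the ring structure of 'I_3. *)
Definition curl F : vfield R := fun i x =>
  partial (i + 1) (F (i + 2)) x - partial (i + 2) (F (i + 1)) x.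

Definition advect F G : vfield R := fun i x =>
  \sum_j F j x * partial j (G i) x.

Definition dot F G x : R := \sum_i F i x * G i x.

(* C^oo: iterated directional derivatives of every order, along arbitrary
   directions, exist and are continuous. *)
Definition smooth (V : normedModType R) (g : V -> R) : Prop :=
  forall (l : seq V), let Dl := foldr (fun v h => 'D_v h) g l in
    continuous Dl /\ forall a v : V, derivable Dl a v.

Definition torus_L2 f : Prop :=
  torus_periodic f /\ (f \_ cube) \in Lfun volume 2%:E.

Definition weakly_div_free F : Prop :=
  forall psi : space3 R -> R, smooth psi -> torus_periodic psi ->
    \int[volume]_(x in cube) dot F (fun i => partial i psi) x = 0.

(* C_c^oo([0,T) x T^3): smooth up to t = 0, expressed as the restriction to
   t >= 0 of fields that are smooth for all t. *)
Definition test_field (T : R) (phi : R -> vfield R) : Prop :=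
  [/\ forall i, smooth (fun z : R * space3 R => phi z.1 i z.2),
      forall t i, torus_periodic (phi t i),
      (exists2 T', T' < T & forall t i x, T' <= t -> phi t i x = 0)
    & forall t x, 0 <= t -> divergence (phi t) x = 0].

Definition time_derivative (phi : R -> vfield R) (t : R) : vfield R :=
  fun i x => derive1 (fun tau => phi tau i x) t.

Definition weak_solution (T : R) (B0 : vfield R) (B : R -> vfield R) : Prop :=
  [/\ (forall i, torus_L2 (B0 i)) /\ weakly_div_free B0,
      (forall t i, torus_periodic (B t i)) /\
      (forall i, ((fun z => B z.1 i z.2) \_ (`[0, T] `*` cube))
         \in Lfun (lebesgue R \x volume)%E 2%:E),
      {ae (lebesgue R), forall t, t \in `[0, T] -> weakly_div_free (B t)}
    & forall phi, test_field T phi ->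
        \int[lebesgue R]_(t in `[0, T]) \int[volume]_(x in cube)
          dot (B t) (fun i y => time_derivative phi t i y
                              + laplacian (phi t i) y
                              + advect (B t) (curl (phi t)) i y) x
        = - \int[volume]_(x in cube) dot B0 (phi 0) x].

Definition stationary_weak_solution (B : vfield R) : Prop :=
  forall T, 0 < T -> weak_solution T B (fun=> B).

(* Constant fields solve the stationary system, so they are the trivial
   solutions. *)
Definition nontrivial (B : vfield R) : Prop :=
  ~ exists c : 'I_3 -> R, {ae volume, forall x, forall i, B i x = c i}.

Definition phase (k : int * int * int) x : R :=
  2 * pi * (k.1.1%:~R * x.1.1 + k.1.2%:~R * x.1.2 + k.2%:~R * x.2).

(* |\hat f(k)|^2, from the real and imaginary parts of
   \hat f(k) = \int f(x) exp(- 2 i pi k.x) dx. *)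
Definition fourier_sqr f (k : int * int * int) : R :=
  (\int[volume]_(x in cube) (f x * cos (phase k x))) ^+ 2 +
  (\int[volume]_(x in cube) (f x * sin (phase k x))) ^+ 2.

Definition sobolev_weight (s : R) (k : int * int * int) : R :=
  (1 + k.1.1%:~R ^+ 2 + k.1.2%:~R ^+ 2 + k.2%:~R ^+ 2) `^ s.

(* H^s for functions already known to be in L^2. *)
Definition sobolev (s : R) f : Prop :=
  (\esum_(k in [set: int * int * int])
     (sobolev_weight s k * fourier_sqr f k)%:E < +oo)%E.

End Torus.

(* Main.v *)
(* Convex integration.  A relaxed solution is a pair (B, S) with div B = 0 and
   curl B + div (B (x) B - S) a gradient; one wants S -> 0 in L^1.  At each stage
   the torus is cut into cells of side 1/N, on which S is frozen.  In a cell, -S plus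
   a multiple of the identity is a nonnegative combination of the six tensors
   xi (x) xi with xi = e_(i+1) +- e_(i+2), and each of them is produced by a rapidly
   oscillating wave xi g(x_i), where g has mean 0 and mean square 1.  As xi is
   orthogonal to the direction e_i of oscillation, the error caused by g^2 - 1 is a
   double derivative, which the curl in the test function annihilates, and so is
   the linear error up to an exact symmetric gradient.  The remaining
   quadratic interactions are small in L^1 because g is intermittent: it is
   supported on a set of small measure, so it is small in L^1 although not in
   L^2; waves with the same i and opposite signs have disjoint supports.
   With frequencies growing as L -> L^6 the increments are summable in a
   small Sobolev space, and (B_n) converges in L^2.  The construction starts from
   B = 0 with a constant S; the stages preserve the means of B and of
   B_0 B_1 - S_01, which prevents the limit from being constant. *)

(* Each wave is the curl of an explicit potential [F eta], and its share of the stress consists of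
   explicit first and second derivatives of scalar potentials, so every weak identity comes from
   integration by parts. The amplitudes are square roots that may vanish and that jump from cell to
   cell; they are harmless because cutoffs vanish near the cell faces. The price is the part of S
   lost in these layers.

   One parameter K sets all scales. If Lam is the frequency of the previous stage, cells have side
   1/(K Lam), cutoff layers have relative width 1/K, and g has K^2 periods per cell and height about
   K on a fraction of order K^-2 of its period. Hence g is O(1/K) in L^1. If A bounds the old field,
   the new one is O(A K), the new frequency is O(K^5 Lam) and the new stress is O(A^2/K) in L^1,
   whatever the old stress was; the L^1 norm of the old stress controls the energy of the increment
   instead. Waves with different i are multiplied by Fubini, as functions of different coordinates.
   The exponent 1/250 is what interpolation between the L^2 smallness and the C^1 growth of the
   increments leaves. *)
Require Import Defs.
From HB Require Import structures.
From mathcomp Require Import all_boot all_order all_algebra.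
From mathcomp Require Import all_classical all_reals all_analysis.
From mathcomp Require Import measurable_realfun ring lra.
Set Implicit Arguments.
Unset Strict Implicit.
Unset Printing Implicit Defensive.
Import Order.TTheory GRing.Theory Num.Theory.
Import numFieldNormedType.Exports.
Local Open Scope classical_set_scope.
Local Open Scope ring_scope.

(** * Measurability and iterated integrals on the cube *)

Section Caratheodory.
Context d (T : measurableType d) (R : realType).

Lemma floor_grid_cvg (y : R) :
  (fun n : nat => (Num.floor (y * n.+1%:R))%:~R / n.+1%:R : R) @ \oo --> y.
Proof.
apply/cvgrPdist_le => e e0.
near=> n.
have n0 : (0 : R) < n.+1%:R by rewrite ltr0n.
rewrite -[X in X - _](mulfK (lt0r_neq0 n0)) -mulrBl normrM (gtr0_norm (x:=n.+1%:R^-1)) ?invr_gt0//.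
rewrite ler_pdivrMr//.
have h1 := ge_floor (y * n.+1%:R).
have h2 := floorD1_gt (y * n.+1%:R); rewrite intrD in h2.
rewrite ger0_norm ?subr_ge0//; apply: (@le_trans _ _ 1); first by lra.
rewrite -ler_pdivrMl//.
apply: le_trans (ltW (_ : e^-1 * 1 < n.+1%:R)) _ => //.
  rewrite mulr1; apply: lt_le_trans (_ : n%:R <= _); last by rewrite ler_nat.
  by near: n; exact: nbhs_infty_gtr.
Unshelve. all: by end_near. Qed.

(** The second variable is rounded down to the grid of step 1/(n+1): on each strip the function
    depends measurably on the first variable alone, and continuity in the second makes these
    approximations converge. Used twice, it gives measurability of continuous functions for the
    iterated product structure that carries [volume]. *)
Lemma measurable_caratheodory (f : T * R -> R) :
  (forall y, measurable_fun setT (fun x => f (x, y))) ->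
  (forall x, continuous (fun y => f (x, y))) -> measurable_fun setT f.
Proof.
move=> mf cf.
pose fl (n : nat) (y : R) : int := Num.floor (y * n.+1%:R).
pose F n (z : T * R) := f (z.1, (fl n z.2)%:~R / n.+1%:R).
apply: (@measurable_realfun.measurable_fun_cvg _ _ _ setT F); last first.
  move=> [x y] _; apply: (@continuous_cvg _ _ _ _ _ _ (fun y => f (x, y))).
    exact: cf.
  exact: floor_grid_cvg.
move=> n _ B mB; rewrite setTI.
have -> : F n @^-1` B = \bigcup_(k : int)
    ([set z : T * R | f (z.1, k%:~R / n.+1%:R) \in B] `&`
     [set z : T * R | fl n z.2 = k]).
  apply/seteqP; split => [[x y] Bz|[x y] [k _ [/set_mem Bz /= kE]]]; last by rewrite /F /= kE.
  by exists (fl n y) => //; split => //=; rewrite inE.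
apply: countable_bigcupT_measurable => [|k]; first exact: countableP.
apply: measurableI.
  have := mf (k%:~R / n.+1%:R) measurableT _ mB; rewrite setTI => mx.
  have := @measurable_fst _ _ T R measurableT _ mx; rewrite setTI.
  by congr measurable; apply/seteqP; split => [[x y]|[x y]] /=; rewrite inE.
have mk : measurable [set y : R | fl n y = k].
  have -> : [set y : R | fl n y = k] = [set` `[k%:~R / n.+1%:R, (k + 1)%:~R / n.+1%:R[].
    have n0 : (0 : R) < n.+1%:R by rewrite ltr0n.
    apply/seteqP; split => y /=; rewrite in_itv/= ler_pdivrMr// ltr_pdivlMr//.
      by move=> <-; rewrite ge_floor floorD1_gt.
    by move=> /andP[h1 h2]; apply/eqP; rewrite -[_ == _]/(fl n y == k) /fl floor_eq h1 h2.
  exact: measurable_itv.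
by have := @measurable_snd _ _ T R measurableT _ mk; rewrite setTI.
Qed.

End Caratheodory.

Section Measurable3.
Context (R : realType).

Lemma continuous_pairl (U V : topologicalType) W (f : U * V -> W : topologicalType) y :
  continuous f -> continuous (fun x => f (x, y)).
Proof.
move=> cf x; apply: (@continuous_comp _ _ _ (fun x => (x, y)) f); last exact: cf.
by apply: cvg_pair; [exact: cvg_id|exact: cvg_cst].
Qed.

Lemma continuous_pairr (U V : topologicalType) W (f : U * V -> W : topologicalType) x :
  continuous f -> continuous (fun y => f (x, y)).
Proof.
move=> cf y; apply: (@continuous_comp _ _ _ (fun y => (x, y)) f); last exact: cf.
by apply: cvg_pair; [exact: cvg_cst|exact: cvg_id].
Qed.

Lemma continuous_measurable3 (f : space3 R -> R) :
  continuous f -> measurable_fun setT f.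
Proof.
move=> cf; apply: measurable_caratheodory => [z|p]; last exact: continuous_pairr.
have cfz : continuous (fun p => f (p, z)) by exact: continuous_pairl.
apply: measurable_caratheodory => [y|x]; last exact: (continuous_pairr cfz).
by apply: measurable_realfun.continuous_measurable_fun; exact: (continuous_pairl cfz).
Qed.

End Measurable3.

Section FubiniBounded.
Context d1 d2 (T1 : measurableType d1) (T2 : measurableType d2) (R : realType).
Variables (m1 : {sigma_finite_measure set T1 -> \bar R})
  (m2 : {sigma_finite_measure set T2 -> \bar R}).
Variables (D1 : set T1) (D2 : set T2).
Hypotheses (mD1 : measurable D1) (mD2 : measurable D2).
Hypotheses (fD1 : (m1 D1 < +oo)%E) (fD2 : (m2 D2 < +oo)%E).
Variables (f : T1 * T2 -> R) (M : R).
Hypotheses (mf : measurable_fun setT f).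
Hypothesis bf : forall z, (D1 `*` D2) z -> `|f z| <= M.

Let integrable_prod :
  (m1 \x m2)%E.-integrable setT (EFin \o (f \_ (D1 `*` D2))).
Proof.
have mD : measurable (D1 `*` D2) by exact: measurableX.
rewrite -restrict_EFin -integrable_mkcond//.
apply: measurable_bounded_integrable => //.
- rewrite [X in (X < _)%E](_ : _ = (m1 D1 * m2 D2)%E); last exact: product_measure1E.
  by rewrite lte_mul_pinfty// ge0_fin_numE.
- exact: measurable_funS mf.
- exists M; split; first exact: num_real.
  by move=> x Mx z /bf h; apply: (le_trans h); exact: ltW.
Qed.

(** Boundedness on a rectangle of finite measure gives integrability of the restriction by zero, to
    which Fubini's theorem on the whole product applies; the restriction is then undone slice by
    slice. *)
Lemma Rintegral_fubini12 :
  \int[(m1 \x m2)%E]_(z in D1 `*` D2) f z =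
  \int[m1]_(x in D1) \int[m2]_(y in D2) f (x, y).
Proof.
rewrite Rintegral_mkcond {1}/Rintegral -(integral12_prod_meas1 integrable_prod).
rewrite [RHS]/Rintegral [in RHS]integral_mkcond; congr fine.
apply: eq_integral => x _; rewrite /fubini_F /= patchE; case: ifPn => xD; last first.
  rewrite integral0_eq// => y _; rewrite patchE; case: ifPn => //.
  by rewrite inE => -[/= D1x]; move: xD; rewrite notin_setE.
rewrite /Rintegral [in RHS]integral_mkcond.
have e : ((fun y => ((f \_ (D1 `*` D2)) (x, y))%:E) = (fun y => (f (x, y))%:E) \_ D2).
  apply/funext => y; rewrite !patchE.
  case: ifPn => h1; case: ifPn => h2 //.
    by move: h1 h2; rewrite inE notin_setE => -[].
  by move: h1 h2 xD; rewrite !inE notin_setE => h ? ?; case: h.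
rewrite -e fineK//.
have iD2 : m2.-integrable D2 (EFin \o fun y => f (x, y)).
  apply: measurable_bounded_integrable => //.
    by apply: measurable_funTS; apply: measurableT_comp => //; exact: measurable_pair1.
  exists M; split; first exact: num_real.
  move=> r Mr y D2y; apply: (@le_trans _ _ M); last exact: ltW.
  by apply: bf; split => //; exact: set_mem.
rewrite e -integral_mkcond; exact: integrable_fin_num.
Qed.

Lemma Rintegral_fubini21 :
  \int[(m1 \x m2)%E]_(z in D1 `*` D2) f z =
  \int[m2]_(y in D2) \int[m1]_(x in D1) f (x, y).
Proof.
rewrite Rintegral_mkcond {1}/Rintegral -(integral21_prod_meas1 integrable_prod).
rewrite [RHS]/Rintegral [in RHS]integral_mkcond; congr fine.
apply: eq_integral => y _; rewrite /fubini_G /= patchE; case: ifPn => yD; last first.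
  rewrite integral0_eq// => x _; rewrite patchE; case: ifPn => //.
  by rewrite inE => -[/= _ D1x]; move: yD; rewrite notin_setE.
rewrite /Rintegral [in RHS]integral_mkcond.
have e : ((fun x => ((f \_ (D1 `*` D2)) (x, y))%:E) = (fun x => (f (x, y))%:E) \_ D1).
  apply/funext => x; rewrite !patchE.
  case: ifPn => h1; case: ifPn => h2 //.
    by move: h1 h2; rewrite inE notin_setE => -[].
  by move: h1 h2 yD; rewrite !inE notin_setE => h ? ?; case: h.
rewrite -e fineK//.
have iD1 : m1.-integrable D1 (EFin \o fun x => f (x, y)).
  apply: measurable_bounded_integrable => //.
    by apply: measurable_funTS; apply: measurableT_comp => //; exact: measurable_pair2.
  exists M; split; first exact: num_real.
  move=> r Mr x D1x; apply: (@le_trans _ _ M); last exact: ltW.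
  by apply: bf; split => //; exact: set_mem.
rewrite e -integral_mkcond; exact: integrable_fin_num.
Qed.

End FubiniBounded.

Section CubeIntegral.
Context (R : realType).
Implicit Types f g : space3 R -> R.
Local Notation mu := (@lebesgue_measure R).

Lemma lebesgue_itv01 : mu `[0, 1] = 1%E.
Proof. by rewrite lebesgue_measure_itv/= lte_fin ltr01 sube0. Qed.

Lemma measurable_cube : measurable (@cube R).
Proof. by apply: measurableX => //; exact: measurableX. Qed.

Lemma area_square : area (`[0, 1] `*` `[0, 1] : set (R * R)) = 1%E :> \bar R.
Proof. by rewrite /area product_measure1E//= lebesgue_itv01 mule1. Qed.

Lemma volume_cube : volume (@cube R) = 1%E :> \bar R.
Proof.
rewrite /volume product_measure1E//=; last exact: measurableX.
by rewrite area_square lebesgue_itv01 mule1.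
Qed.

Definition cube_bounded f := measurable_fun setT f /\
  exists M, forall x, cube x -> `|f x| <= M.

Lemma cube_bounded_integrable f : cube_bounded f ->
  volume.-integrable cube (EFin \o f).
Proof.
move=> [mf [M fM]]; apply: measurable_bounded_integrable.
- exact: measurable_cube.
- by rewrite [X in (X < _)%E](volume_cube) ltey.
- exact: measurable_funS mf.
- exists M; split; first exact: num_real.
  by move=> r Mr x /fM h; apply: (le_trans h); exact: ltW.
Qed.

(** Together with [cube_integral_iter1] and [cube_integral_iter2] this puts any chosen coordinate
    innermost, so that a partial derivative can be integrated first along its own direction. *)
Lemma cube_integral_iter3 f : cube_bounded f ->
  \int[volume]_(x in cube) f x =
  \int[area]_(p in `[0, 1] `*` `[0, 1]) \int[mu]_(z in `[0, 1]) f (p, z).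
Proof.
move=> [mf [M fM]]; apply: (@Rintegral_fubini12 _ _ _ _ _ area mu _ _ _ _ _ _ f M) => //.
- exact: measurableX.
- by rewrite [X in (X < _)%E]area_square ltey.
- by rewrite [X in (X < _)%E]lebesgue_itv01 ltey.
Qed.

Let iter_slice f : cube_bounded f ->
  \int[volume]_(x in cube) f x =
  \int[mu]_(z in `[0, 1]) \int[area]_(p in `[0, 1] `*` `[0, 1]) f (p, z).
Proof.
move=> [mf [M fM]]; apply: (@Rintegral_fubini21 _ _ _ _ _ area mu _ _ _ _ _ _ f M) => //.
- exact: measurableX.
- by rewrite [X in (X < _)%E]area_square ltey.
- by rewrite [X in (X < _)%E]lebesgue_itv01 ltey.
Qed.

Lemma cube_integral_iter1 f : cube_bounded f ->
  \int[volume]_(x in cube) f x =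
  \int[mu]_(z in `[0, 1]) \int[mu]_(y in `[0, 1]) \int[mu]_(x in `[0, 1]) f (x, y, z).
Proof.
move=> bf; rewrite iter_slice//; case: bf => mf [M fM].
apply: eq_Rintegral => z /set_mem z01.
apply: (@Rintegral_fubini21 _ _ _ _ _ mu mu _ _ _ _ _ _ (fun p => f (p, z)) M) => //.
- by rewrite [X in (X < _)%E]lebesgue_itv01 ltey.
- by rewrite [X in (X < _)%E]lebesgue_itv01 ltey.
- by apply: measurableT_comp => //; exact: measurable_pair2.
- by move=> p pD; apply: fM; split.
Qed.

Lemma cube_integral_iter2 f : cube_bounded f ->
  \int[volume]_(x in cube) f x =
  \int[mu]_(z in `[0, 1]) \int[mu]_(x in `[0, 1]) \int[mu]_(y in `[0, 1]) f (x, y, z).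
Proof.
move=> bf; rewrite iter_slice//; case: bf => mf [M fM].
apply: eq_Rintegral => z /set_mem z01.
apply: (@Rintegral_fubini12 _ _ _ _ _ mu mu _ _ _ _ _ _ (fun p => f (p, z)) M) => //.
- by rewrite [X in (X < _)%E]lebesgue_itv01 ltey.
- by rewrite [X in (X < _)%E]lebesgue_itv01 ltey.
- by apply: measurableT_comp => //; exact: measurable_pair2.
- by move=> p pD; apply: fM; split.
Qed.

End CubeIntegral.

(** * Calculus on the torus *)

Section Calculus1.
Context (R : realType).
Local Notation mu := (@lebesgue_measure R).

Lemma is_derive_continuous (f : R -> R) (x d : R) : is_derive x 1 f d -> {for x, continuous f}.
Proof. by move=> [df _]; apply/differentiable_continuous/derivable1_diffP. Qed.

Lemma Rintegral_derivative (F f : R -> R) (a b : R) : a <= b ->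
  (forall t : R, is_derive t 1 F (f t)) -> continuous f ->
  \int[mu]_(t in `[a, b]) f t = F b - F a.
Proof.
rewrite le_eqVlt => /predU1P[<-|ab] dF cf.
  by rewrite set_itv1 Rintegral_set1 subrr.
rewrite /Rintegral (@continuous_FTC2 R f F)//.
- exact: continuous_subspaceT.
- split.
  + by move=> x _; exact: (@ex_derive _ _ _ _ _ _ _ (dF x)).
  + by apply: cvg_at_right_filter; exact: is_derive_continuous (dF a).
  + by apply: cvg_at_left_filter; exact: is_derive_continuous (dF b).
- by move=> x _; rewrite derive1E; exact: (@derive_val _ _ _ _ _ _ _ (dF x)).
Qed.

(** Reduction to one real variable along a line, where the mean value theorem and the fundamental
    theorem of calculus live. *)
Lemma is_derive_line (V : normedModType R) (f : V -> R) x v (h : R) d :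
  is_derive (h *: v + x) v f d <-> is_derive h 1 (fun h => f (h *: v + x)) d.
Proof.
have e : (fun k : R => k^-1 *: ((f \o shift (h *: v + x)) (k *: v) - f (h *: v + x))) =
  (fun k => k^-1 *: (((fun h => f (h *: v + x)) \o shift h) (k *: 1) - f (h *: v + x))).
  by apply/funext => k /=; rewrite -[k *: 1]/(k * 1) mulr1 scalerDl addrA.
by split => -[h1 h2]; split; rewrite /derivable /derive ?e// -?e//.
Qed.

Lemma is_derive_line0 (V : normedModType R) (f : V -> R) x v d :
  is_derive x v f d <-> is_derive (0 : R) 1 (fun h => f (h *: v + x)) d.
Proof. by rewrite -is_derive_line scale0r add0r. Qed.

Lemma MVT_le (f df : R -> R) (M a b : R) :
  (forall t : R, is_derive t 1 f (df t)) -> (forall t, `|df t| <= M) ->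
  `|f b - f a| <= M * `|b - a|.
Proof.
move=> fd dM; wlog ab : a b / a <= b => [H|].
  have [/H//|/ltW/H] := leP a b.
  by rewrite distrC (distrC a).
have [|c _ ->] := @MVT_segment R f df a b ab (fun x _ => fd x).
  by apply: continuous_subspaceT => x; exact: is_derive_continuous (fd x).
by rewrite normrM ler_wpM2r.
Qed.

End Calculus1.

Section Coordinates.
Context (R : realType).
Implicit Types (f g : space3 R -> R) (x : space3 R).
Local Notation mu := (@lebesgue_measure R).
Local Notation e_ := (@unit_vector R).

Lemma ord3_ind (P : 'I_3 -> Prop) : P 0 -> P 1 -> P 2 -> forall i, P i.
Proof.
move=> P0 P1 P2 [[|[|[|//]]] i3].
- by rewrite (_ : Ordinal i3 = 0)//; exact/val_inj.
- by rewrite (_ : Ordinal i3 = 1)//; exact/val_inj.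
- by rewrite (_ : Ordinal i3 = 2)//; exact/val_inj.
Qed.

Lemma sum3 (F : 'I_3 -> R) : \sum_i F i = F 0 + F 1 + F 2.
Proof.
rewrite !big_ord_recr big_ord0/= add0r.
by congr (F _ + F _ + F _); exact/val_inj.
Qed.

Lemma prod3 (F : 'I_3 -> R) : \prod_i F i = F 0 * F 1 * F 2.
Proof.
rewrite !big_ord_recr big_ord0/= mul1r.
by congr (F _ * F _ * F _); exact/val_inj.
Qed.

Definition co (j : 'I_3) x : R :=
  if j == 0 then x.1.1 else if j == 1 then x.1.2 else x.2.

Lemma coD j x y : co j (x + y) = co j x + co j y.
Proof. by rewrite /co; case: ifP => //; case: ifP. Qed.

Lemma co_unit i j : co j (e_ i) = (i == j)%:R.
Proof. by elim/ord3_ind: i; elim/ord3_ind: j. Qed.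

Lemma co_line i j (h : R) x : co j (h *: e_ i + x) = co j x + h * (i == j)%:R.
Proof.
rewrite coD addrC -co_unit; congr (_ + _).
by rewrite /co; case: ifP => //; case: ifP.
Qed.

Lemma continuous_co j : continuous (co j).
Proof.
rewrite /co; elim/ord3_ind: j => /= x.
- by apply: (@continuous_comp _ _ _ fst fst x); exact: cvg_fst.
- by apply: (@continuous_comp _ _ _ fst snd x); [exact: cvg_fst|exact: cvg_snd].
- exact: cvg_snd.
Qed.

Lemma line_continuous i x : continuous (fun h : R => h *: e_ i + x).
Proof. by move=> h; apply: cvgD; [apply: cvgZr_tmp|exact: cvg_cst]. Qed.

End Coordinates.

Section CubeBounded.
Context (R : realType).
Implicit Types f g : space3 R -> R.

Lemma compact_cube : compact (@cube R).
Proof.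
apply: compact_setX; last exact: segment_compact.
by apply: compact_setX; exact: segment_compact.
Qed.

Lemma continuous_cube_bounded f : continuous f -> cube_bounded f.
Proof.
move=> cf; split; first exact: continuous_measurable3.
have [|||c _ H] := @compact_EVT_max _ R (fun x => `|f x|) (@cube R).
- by exists (0, 0, 0); split; [split|]; rewrite /= in_itv/= lexx ler01.
- exact: compact_cube.
- by apply: continuous_subspaceT => x; apply: cvg_norm; exact: cf.
by exists `|f c| => x /mem_set /H.
Qed.

Lemma cube_boundedD f g : cube_bounded f -> cube_bounded g ->
  cube_bounded (fun x => f x + g x).
Proof.
move=> [mf [M fM]] [mg [N gN]]; split; first exact: measurable_funD.
by exists (M + N) => x cx; rewrite (le_trans (ler_normD _ _))// lerD// ?fM ?gN.
Qed.

Lemma cube_boundedM f g : cube_bounded f -> cube_bounded g ->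
  cube_bounded (fun x => f x * g x).
Proof.
move=> [mf [M fM]] [mg [N gN]]; split; first exact: measurable_funM.
by exists (M * N) => x cx; rewrite normrM ler_pM// ?fM ?gN.
Qed.

Lemma cube_bounded_cst (c : R) : cube_bounded (fun=> c).
Proof. by split; [exact: measurable_cst|exists `|c|]. Qed.

Lemma cube_boundedN f : cube_bounded f -> cube_bounded (fun x => - f x).
Proof.
move=> [mf [M fM]]; split; first exact: measurableT_comp.
by exists M => x cx; rewrite normrN fM.
Qed.

Lemma cube_boundedB f g : cube_bounded f -> cube_bounded g ->
  cube_bounded (fun x => f x - g x).
Proof. by move=> ? ?; apply: cube_boundedD => //; exact: cube_boundedN. Qed.

Lemma cube_bounded_norm f : cube_bounded f -> cube_bounded (fun x => `|f x|).
Proof.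
move=> [mf [M fM]]; split; first exact: measurableT_comp.
by exists M => x cx; rewrite normr_id fM.
Qed.

Lemma cube_bounded_sum (I : Type) (r : seq I) (F : I -> space3 R -> R) :
  (forall i, cube_bounded (F i)) -> cube_bounded (fun x => \sum_(i <- r) F i x).
Proof.
move=> bF; elim: r => [|i r IH].
  by under eq_fun do rewrite big_nil; exact: cube_bounded_cst.
by under eq_fun do rewrite big_cons; exact: cube_boundedD.
Qed.

Local Notation Int f := (\int[volume]_(x in cube) f x).

Lemma cube_intD f g : cube_bounded f -> cube_bounded g ->
  Int (fun x => f x + g x) = Int f + Int g.
Proof.
move=> bf bg; rewrite RintegralD//; first exact: measurable_cube.
all: exact: cube_bounded_integrable.
Qed.

Lemma cube_intB f g : cube_bounded f -> cube_bounded g ->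
  Int (fun x => f x - g x) = Int f - Int g.
Proof.
move=> bf bg; rewrite RintegralB//; first exact: measurable_cube.
all: exact: cube_bounded_integrable.
Qed.

Lemma cube_intZ f (c : R) : cube_bounded f -> Int (fun x => c * f x) = c * Int f.
Proof.
move=> bf; rewrite RintegralZl//; first exact: measurable_cube.
exact: cube_bounded_integrable.
Qed.

Lemma cube_intN f : cube_bounded f -> Int (fun x => - f x) = - Int f.
Proof.
move=> bf; under eq_Rintegral do rewrite -mulN1r.
by rewrite cube_intZ// mulN1r.
Qed.

Lemma cube_int_cst (c : R) : Int (fun=> c) = c.
Proof.
rewrite Rintegral_cst; last exact: measurable_cube.
by rewrite [X in fine X]volume_cube mulr1.
Qed.

Lemma cube_int_sum (I : Type) (r : seq I) (F : I -> space3 R -> R) :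
  (forall i, cube_bounded (F i)) ->
  Int (fun x => \sum_(i <- r) F i x) = \sum_(i <- r) Int (F i).
Proof.
move=> bF; elim: r => [|i r IH].
  by rewrite big_nil; under eq_Rintegral do rewrite big_nil; rewrite cube_int_cst.
rewrite big_cons -IH -cube_intD//; last exact: cube_bounded_sum.
by apply: eq_Rintegral => x _; rewrite big_cons.
Qed.

Lemma cube_int_le f g : cube_bounded f -> cube_bounded g ->
  (forall x, cube x -> f x <= g x) -> Int f <= Int g.
Proof.
move=> bf bg fg; apply: le_Rintegral => //; first exact: measurable_cube.
all: exact: cube_bounded_integrable.
Qed.

Lemma cube_int_norm f : cube_bounded f -> `|Int f| <= Int (fun x => `|f x|).
Proof.
move=> bf; apply: le_normr_Rintegral; first exact: measurable_cube.
exact: cube_bounded_integrable.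
Qed.

End CubeBounded.

Section Partials.
Context (R : realType).
Implicit Types (f g : space3 R -> R) (x : space3 R).
Local Notation mu := (@lebesgue_measure R).
Local Notation e_ := (@unit_vector R).
Local Notation Int f := (\int[volume]_(x in cube) f x).

Lemma line_int_partial i f g x : continuous g ->
  (forall x, is_derive x (e_ i) f (g x)) -> torus_periodic f ->
  \int[mu]_(t in `[0, 1]) g (t *: e_ i + x) = 0.
Proof.
move=> cg fg pf.
have dF (t : R) : is_derive t 1 (fun t => f (t *: e_ i + x)) (g (t *: e_ i + x)).
  by apply/(@is_derive_line R _ f x (e_ i) t (g (t *: e_ i + x))); exact: fg.
have cG : continuous (fun t : R => g (t *: e_ i + x)).
  move=> t; apply: (@continuous_comp _ _ _ (fun t : R => t *: e_ i + x) g t); last exact: cg.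
  exact: line_continuous.
rewrite (Rintegral_derivative ler01 dF cG).
by rewrite scale0r scale1r [e_ i + x]addrC pf add0r subrr.
Qed.

Lemma line3E (t x y z : R) : (t *: e_ 0 + (x, y, z) = (t + x, y, z)) *
  (t *: e_ 1 + (x, y, z) = (x, t + y, z)) * (t *: e_ 2 + (x, y, z) = (x, y, t + z)).
Proof.
have e (a b c : R) : t *: (a, b, c) + (x, y, z) = (t * a + x, t * b + y, t * c + z) by [].
by rewrite /unit_vector !e /= !mulr0 !mulr1 !add0r.
Qed.

Let Rintegral0 d (T : measurableType d) (m : {measure set T -> \bar R}) D :
  \int[m]_(t in D) (0 : R) = 0.
Proof. by rewrite /Rintegral integral0. Qed.

(** Integrated innermost along its own direction, the derivative leaves the difference of the values
    on opposite faces, which periodicity cancels. *)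
Lemma cube_int_partial i f g : continuous g ->
  (forall x, is_derive x (e_ i) f (g x)) -> torus_periodic f -> Int g = 0.
Proof.
move=> cg fg pf; have bg := continuous_cube_bounded cg.
have H := line_int_partial _ cg fg pf; elim/ord3_ind: i fg pf H => fg pf H.
- rewrite cube_integral_iter1// -[RHS](Rintegral0 mu `[0, 1]%classic).
  apply: eq_Rintegral => z _; rewrite -[RHS](Rintegral0 mu `[0, 1]%classic).
  apply: eq_Rintegral => y _; rewrite -[RHS](H (0, y, z)).
  by apply: eq_Rintegral => t _; rewrite line3E addr0.
- rewrite cube_integral_iter2// -[RHS](Rintegral0 mu `[0, 1]%classic).
  apply: eq_Rintegral => z _; rewrite -[RHS](Rintegral0 mu `[0, 1]%classic).
  apply: eq_Rintegral => x _; rewrite -[RHS](H (x, 0, z)).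
  by apply: eq_Rintegral => t _; rewrite line3E addr0.
- rewrite cube_integral_iter3// -[RHS](Rintegral0 area (`[0, 1] `*` `[0, 1])%classic).
  apply: eq_Rintegral => -[x y] _; rewrite -[RHS](H (x, y, 0)).
  by apply: eq_Rintegral => t _; rewrite line3E addr0.
Qed.

(** The partial derivatives are data rather than [partial i f], so that explicit formulas for them
    propagate through [C1D], [C1M] and the potentials below. *)
Definition C1 f (df : 'I_3 -> space3 R -> R) : Prop := continuous f /\
  forall i, continuous (df i) /\ forall x, is_derive x (e_ i) f (df i x).

Lemma C1_partial f df i : C1 f df -> partial i f = df i.
Proof. by move=> [_ /(_ i)[_ H]]; apply/funext => x; exact: (@derive_val _ _ _ _ _ _ _ (H x)). Qed.

Lemma C1M f df g dg : C1 f df -> C1 g dg ->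
  C1 (fun x => f x * g x) (fun i x => df i x * g x + f x * dg i x).
Proof.
move=> [cf df_] [cg dg_]; split=> [x|i].
  by apply: cvgM; [exact: cf|exact: cg].
have [cdf Df] := df_ i; have [cdg Dg] := dg_ i; split=> x.
  by apply: cvgD; apply: cvgM; [exact: cdf|exact: cg|exact: cf|exact: cdg].
have h := is_deriveM (Df x) (Dg x).
by apply: (is_derive_eq h); rewrite addrC; congr (_ + _); rewrite -[_ *: _]/(_ * _) // mulrC.
Qed.

Lemma C1D f df g dg : C1 f df -> C1 g dg ->
  C1 (fun x => f x + g x) (fun i x => df i x + dg i x).
Proof.
move=> [cf df_] [cg dg_]; split=> [x|i].
  by apply: cvgD; [exact: cf|exact: cg].
have [cdf Df] := df_ i; have [cdg Dg] := dg_ i; split=> x.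
  by apply: cvgD; [exact: cdf|exact: cdg].
exact: (is_deriveD (Df x) (Dg x)).
Qed.

Lemma C1_cst (c : R) : C1 (fun=> c) (fun _ _ => 0).
Proof.
split=> [x|i]; first exact: cvg_cst.
by split=> x; [exact: cvg_cst|exact: is_derive_cst].
Qed.

Lemma C1Z (c : R) f df : C1 f df -> C1 (fun x => c * f x) (fun i x => c * df i x).
Proof.
move=> h; have := C1M (C1_cst c) h; congr C1.
by apply/funext => i; apply/funext => x; rewrite mul0r add0r.
Qed.

Lemma C1_sum (I : Type) (r : seq I) (F : I -> space3 R -> R) dF :
  (forall k, C1 (F k) (dF k)) ->
  C1 (fun x => \sum_(k <- r) F k x) (fun i x => \sum_(k <- r) dF k i x).
Proof.
move=> h; elim: r => [|k r IH].
  have := C1_cst 0; congr C1; first by apply/funext => x; rewrite big_nil.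
  by apply/funext => i; apply/funext => x; rewrite big_nil.
have := C1D (h k) IH; congr C1; first by apply/funext => x; rewrite big_cons.
by apply/funext => i; apply/funext => x; rewrite big_cons.
Qed.

Lemma C1_cube_bounded f df : C1 f df -> cube_bounded f.
Proof. by move=> [h _]; exact: continuous_cube_bounded. Qed.

Lemma C1_cube_bounded_partial f df i : C1 f df -> cube_bounded (df i).
Proof. by move=> [_ /(_ i)[h _]]; exact: continuous_cube_bounded. Qed.

Lemma cube_int_by_parts i f df g dg : C1 f df -> C1 g dg ->
  torus_periodic f -> torus_periodic g ->
  Int (fun x => df i x * g x) = - Int (fun x => f x * dg i x).
Proof.
move=> Cf Cg pf pg; have [_ /(_ i)[c D]] := C1M Cf Cg.
have Z : Int (fun x => df i x * g x + f x * dg i x) = 0.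
  by apply: (cube_int_partial c D) => k x; rewrite pf pg.
move: Z; rewrite cube_intD; first by move/eqP; rewrite addr_eq0 => /eqP.
  exact: cube_boundedM (C1_cube_bounded_partial i Cf) (C1_cube_bounded Cg).
exact: cube_boundedM (C1_cube_bounded Cf) (C1_cube_bounded_partial i Cg).
Qed.

Definition dist3 x y := `|co 0 x - co 0 y| + `|co 1 x - co 1 y| + `|co 2 x - co 2 y|.

(** The two points are joined by three segments parallel to the axes, hence the l^1 distance. *)
Lemma C1_lipschitz f df M : C1 f df -> (forall i x, `|df i x| <= M) ->
  forall x y, `|f x - f y| <= M * dist3 x y.
Proof.
move=> [_ Cf] dM.
have L i (h k : R) x : `|f (h *: e_ i + x) - f (k *: e_ i + x)| <= M * `|h - k|.
  apply: (@MVT_le R (fun h => f (h *: e_ i + x)) (fun h => df i (h *: e_ i + x))) => // t.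
  by apply/(@is_derive_line R _ f x (e_ i) t); have [_] := Cf i; exact.
move=> [[x0 x1] x2] [[y0 y1] y2].
rewrite /dist3 /co /= !mulrDr.
have -> : f (x0, x1, x2) - f (y0, y1, y2) = (f (x0, x1, x2) - f (y0, x1, x2))
   + (f (y0, x1, x2) - f (y0, y1, x2)) + (f (y0, y1, x2) - f (y0, y1, y2)) by ring.
apply: le_trans (ler_normD _ _) _; apply: lerD.
  apply: le_trans (ler_normD _ _) _; apply: lerD.
    by have := L 0 x0 y0 (0, x1, x2); rewrite !line3E !addr0.
  by have := L 1 x1 y1 (y0, 0, x2); rewrite !line3E !addr0.
by have := L 2 x2 y2 (y0, y1, 0); rewrite !line3E !addr0.
Qed.

End Partials.

(** * Symmetry of second derivatives *)

Section Clairaut.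
Context (R : realType) (V : normedModType R).
Implicit Types (g : V -> R) (u v x : V).

(** Mean value theorem in direction [u] for the difference of [g] over the step [h v], then in
    direction [v] for ['D_u g]. *)
Lemma second_difference g u v x (h : R) : 0 <= h ->
  (forall x w, derivable g x w) -> (forall x w, derivable ('D_u g) x w) ->
  exists s t : R, [/\ 0 <= s <= h, 0 <= t <= h &
  g (h *: u + (h *: v + x)) - g (h *: u + x) - g (h *: v + x) + g x =
  h ^+ 2 * 'D_v ('D_u g) (s *: u + (t *: v + x))].
Proof.
move=> h0 dg dug.
pose F (s : R) := g (s *: u + (h *: v + x)) - g (s *: u + x).
pose dF (s : R) := 'D_u g (s *: u + (h *: v + x)) - 'D_u g (s *: u + x).
have DF (s : R) : is_derive s 1 F (dF s).
  apply: is_deriveB.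
    apply/(@is_derive_line R _ g (h *: v + x) u s); exact: derivableP.
  apply/(@is_derive_line R _ g x u s); exact: derivableP.
have [|s sh Fs] := @MVT_segment R F dF 0 h h0 (fun s _ => DF s).
  by apply: continuous_subspaceT => s; exact: is_derive_continuous (DF s).
pose G (t : R) := 'D_u g (t *: v + (s *: u + x)).
pose dG (t : R) := 'D_v ('D_u g) (t *: v + (s *: u + x)).
have DG (t : R) : is_derive t 1 G (dG t).
  apply/(@is_derive_line R _ ('D_u g) (s *: u + x) v t); exact: derivableP.
have [|t th Gt] := @MVT_segment R G dG 0 h h0 (fun s _ => DG s).
  by apply: continuous_subspaceT => t; exact: is_derive_continuous (DG t).
exists s, t; split; [by move: sh; rewrite in_itv|by move: th; rewrite in_itv|].
move: Gt; rewrite /G /dG scale0r add0r subr0.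
rewrite [h *: v + (s *: u + x)]addrCA [t *: v + (s *: u + x)]addrCA => Gt.
move: Fs; rewrite /F /dF !scale0r !add0r subr0 Gt => E.
rewrite expr2 -mulrA [h * (h * _)]mulrC (mulrC h) -E; ring.
Qed.

(** The second difference is symmetric in [u] and [v], so the two mixed derivatives agree at two
    points close to [x]; continuity of both at [x] concludes. *)
Lemma clairaut g u v x :
  (forall x w, derivable g x w) -> (forall x w, derivable ('D_u g) x w) ->
  (forall x w, derivable ('D_v g) x w) ->
  {for x, continuous ('D_v ('D_u g))} -> {for x, continuous ('D_u ('D_v g))} ->
  'D_v ('D_u g) x = 'D_u ('D_v g) x.
Proof.
move=> dg dug dvg cvu cuv; apply/eqP; rewrite -subr_eq0 -normr_le0.
apply/ler_addgt0Pr => e e0; rewrite add0r.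
have e20 : 0 < e / 2 by rewrite divr_gt0.
move: cvu => /cvgrPdist_lt /(_ _ e20) /nbhs_normP[d1 /= d10 H1].
move: cuv => /cvgrPdist_lt /(_ _ e20) /nbhs_normP[d2 /= d20 H2].
pose M := `|u| + `|v| + 1; have M0 : 0 < M by rewrite ltr_pwDr// addr_ge0.
pose d := Num.min d1 d2; have d0 : 0 < d by rewrite lt_min d10.
(* Then [h * M = d / 2], which keeps all intermediate points of the mean value theorem in the ball
   of radius [d] about [x]. *)
pose h := d / 2 / M; have h0 : 0 < h by rewrite !divr_gt0.
have B (s t : R) (w z : V) : 0 <= s <= h -> 0 <= t <= h -> `|w| + `|z| <= M ->
    `|x - (s *: w + (t *: z + x))| < d.
  move=> /andP[s0 sh] /andP[t0 th] wz.
  rewrite addrA opprD addrCA addrN addr0 normrN.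
  apply: (le_lt_trans (ler_normD _ _)); rewrite !normrZ !ger0_norm//.
  apply: (@le_lt_trans _ _ (h * M)).
    apply: (@le_trans _ _ (h * `|w| + h * `|z|)); first by rewrite lerD// ler_wpM2r.
    by rewrite -mulrDr ler_wpM2l// ltW.
  by rewrite /h divfK ?gt_eqF// ltr_pdivrMr// ltr_pMr// ltr1n.
have [s [t [sh th E1]]] := @second_difference g u v x h (ltW h0) dg dug.
have [s' [t' [sh' th' E2]]] := @second_difference g v u x h (ltW h0) dg dvg.
have {}H1 := H1 (s *: u + (t *: v + x)).
have {}H2 := H2 (s' *: v + (t' *: u + x)).
have E : 'D_v ('D_u g) (s *: u + (t *: v + x)) = 'D_u ('D_v g) (s' *: v + (t' *: u + x)).
  apply: (@mulfI _ (h ^+ 2)); first by rewrite expf_neq0// gt_eqF.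
  apply: (etrans (esym E1)); apply: etrans E2.
  by rewrite [h *: v + (h *: u + x)]addrCA [X in _ = X + _]addrAC.
have dd1 : d <= d1 by rewrite ge_min lexx.
have dd2 : d <= d2 by rewrite ge_min lexx orbT.
have uv : `|u| + `|v| <= M by rewrite /M lerDl.
have vu : `|v| + `|u| <= M by rewrite (addrC `|v|).
have {}H1 : `|'D_v ('D_u g) x - 'D_v ('D_u g) (s *: u + (t *: v + x))| < e / 2.
  by apply: H1; exact: lt_le_trans (B _ _ _ _ sh th uv) dd1.
have {}H2 : `|'D_u ('D_v g) x - 'D_u ('D_v g) (s' *: v + (t' *: u + x))| < e / 2.
  by apply: H2; exact: lt_le_trans (B _ _ _ _ sh' th' vu) dd2.
rewrite -E distrC in H2; move: H1 H2.
move: ('D_v ('D_u g) x) ('D_u ('D_v g) x) ('D_v ('D_u g) (s *: u + (t *: v + x))) => A B' C H1 H2.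
have -> : A - B' = (A - C) + (C - B') by rewrite addrA subrK.
apply: le_trans (ler_normD _ _) _; rewrite [X in _ <= X]splitr.
exact: lerD (ltW H1) (ltW H2).
Qed.

End Clairaut.

Section Smooth.
Context (R : realType).

Section General.
Variable V : normedModType R.
Implicit Types (g : V -> R) (u v x : V).

Lemma smooth_continuous g : smooth g -> continuous g.
Proof. by move=> /(_ [::])[]. Qed.

Lemma smooth_derivable g x v : smooth g -> derivable g x v.
Proof. by move=> /(_ [::])[]. Qed.

Lemma smooth_derive g v : smooth g -> smooth ('D_v g).
Proof. by move=> sg l; have := sg (rcons l v); rewrite foldr_rcons. Qed.

Lemma smooth_deriveC g u v : smooth g -> 'D_v ('D_u g) = 'D_u ('D_v g).
Proof.
move=> sg; apply/funext => x; apply: clairaut.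
- by move=> *; exact: smooth_derivable.
- by move=> *; exact/smooth_derivable/smooth_derive.
- by move=> *; exact/smooth_derivable/smooth_derive.
- exact/smooth_continuous/smooth_derive/smooth_derive.
- exact/smooth_continuous/smooth_derive/smooth_derive.
Qed.

End General.

Implicit Types (f : space3 R -> R).

Lemma smooth_partial i f : smooth f -> smooth (partial i f).
Proof. exact: smooth_derive. Qed.

Lemma smooth_partialC i j f : smooth f -> partial i (partial j f) = partial j (partial i f).
Proof. exact: smooth_deriveC. Qed.

Lemma smooth_C1 f : smooth f -> C1 f (fun i => partial i f).
Proof.
move=> sf; split; first exact: smooth_continuous.
move=> i; split; first exact/smooth_continuous/smooth_partial.
by move=> x; apply: derivableP; exact: smooth_derivable.
Qed.

Lemma periodic_partial i f : torus_periodic f -> torus_periodic (partial i f).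
Proof.
move=> pf k x; rewrite /partial /derive.
rewrite (_ : (fun h : R => h^-1 *: ((f \o shift (x + unit_vector k)) (h *: unit_vector i) - f (x + unit_vector k)))
  = (fun h => h^-1 *: ((f \o shift x) (h *: unit_vector i) - f x)))//.
by apply/funext => h; rewrite /= addrA !pf.
Qed.

(** A derivative of the slice along [v] is a slice of the derivative of [F] along [(0, v)]; this
    passes to iterated derivatives. *)
Lemma smooth_slice (F : R * space3 R -> R) t : smooth F -> smooth (fun x => F (t, x)).
Proof.
have D (G : R * space3 R -> R) v x : (fun h : R => h^-1 *: ((fun x => G (t, x)) (h *: v + x) - G (t, x))) =
    (fun h => h^-1 *: ((G \o shift (t, x)) (h *: (0, v)) - G (t, x))).
  apply/funext => h /=; congr (_ *: (G _ - _)).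
  by rewrite /shift/=; congr (_, _); rewrite /= scaler0 add0r.
move=> sF l.
have -> : foldr (fun v h => 'D_v h) (fun x => F (t, x)) l =
    (fun x => foldr (fun v h => 'D_v h) F [seq (0, v) | v <- l] (t, x)).
  elim: l => //= v l ->; apply/funext => x.
  rewrite /derive; congr (lim _).
  by rewrite (D (foldr (fun v h => 'D_v h) F [seq (0, v) | v <- l])).
have [c d] := sF [seq (0, v) | v <- l]; split; first exact: continuous_pairr.
move=> a v; have := d (t, a) (0, v); rewrite /derivable.
by rewrite -D.
Qed.

End Smooth.

(** * Weak identities for potential fields *)

Section SmoothAlgebra.
Context (R : realType).
Implicit Types (f g : space3 R -> R).

Lemma derive_lin (V : normedModType R) (g h : V -> R) (a b : R) v x :
  derivable g x v -> derivable h x v ->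
  is_derive x v (fun x => a * g x + b * h x) (a * 'D_v g x + b * 'D_v h x).
Proof.
move=> dg dh.
exact: (is_deriveD (is_deriveZ a (derivableP dg)) (is_deriveZ b (derivableP dh))).
Qed.

Lemma smooth_lin (V : normedModType R) (g h : V -> R) (a b : R) :
  smooth g -> smooth h -> smooth (fun x => a * g x + b * h x).
Proof.
move=> sg sh l.
have E : foldr (fun v h => 'D_v h) (fun x => a * g x + b * h x) l =
    (fun x => a * foldr (fun v h => 'D_v h) g l x + b * foldr (fun v h => 'D_v h) h l x).
  elim: l => //= v l ->; apply/funext => x.
  have [_ dg] := sg l; have [_ dh] := sh l.
  exact: (@derive_val _ _ _ _ _ _ _ (derive_lin a b (dg x v) (dh x v))).
have [cg dg] := sg l; have [ch dh] := sh l.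
rewrite E; split=> [x|x v].
  by apply: cvgD; apply: cvgM; [exact: cvg_cst|exact: cg|exact: cvg_cst|exact: ch].
exact: (@ex_derive _ _ _ _ _ _ _ (derive_lin a b (dg x v) (dh x v))).
Qed.

Lemma partial_lin i f g (a b : R) : smooth f -> smooth g ->
  partial i (fun x => a * f x + b * g x) = fun x => a * partial i f x + b * partial i g x.
Proof.
move=> sf sg; apply/funext => x; rewrite /partial.
have df : derivable f x (unit_vector i) by exact: smooth_derivable.
have dg : derivable g x (unit_vector i) by exact: smooth_derivable.
by have [_ ->] := derive_lin a b df dg.
Qed.

Lemma smoothD f g : smooth f -> smooth g -> smooth (fun x => f x + g x).
Proof.
move=> sf sg; rewrite (_ : (fun x => _) = fun x => 1 * f x + 1 * g x).
  exact: smooth_lin.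
by apply/funext => x; rewrite !mul1r.
Qed.

Lemma smoothB f g : smooth f -> smooth g -> smooth (fun x => f x - g x).
Proof.
move=> sf sg; rewrite (_ : (fun x => _) = fun x => 1 * f x + (-1) * g x).
  exact: smooth_lin.
by apply/funext => x; rewrite mul1r mulN1r.
Qed.

Lemma smoothZ f (c : R) : smooth f -> smooth (fun x => c * f x).
Proof.
move=> sf; rewrite (_ : (fun x => _) = fun x => c * f x + 0 * f x).
  exact: smooth_lin.
by apply/funext => x; rewrite mul0r addr0.
Qed.

Lemma partialD i f g : smooth f -> smooth g ->
  partial i (fun x => f x + g x) = fun x => partial i f x + partial i g x.
Proof.
move=> sf sg; rewrite (_ : (fun x => f x + g x) = fun x => 1 * f x + 1 * g x).
  by rewrite partial_lin//; apply/funext => x; rewrite !mul1r.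
by apply/funext => x; rewrite !mul1r.
Qed.

Lemma partialB i f g : smooth f -> smooth g ->
  partial i (fun x => f x - g x) = fun x => partial i f x - partial i g x.
Proof.
move=> sf sg; rewrite (_ : (fun x => f x - g x) = fun x => 1 * f x + (-1) * g x).
  by rewrite partial_lin//; apply/funext => x; rewrite mul1r mulN1r.
by apply/funext => x; rewrite mul1r mulN1r.
Qed.

Lemma partialZ i f (c : R) : smooth f ->
  partial i (fun x => c * f x) = fun x => c * partial i f x.
Proof.
move=> sf; rewrite (_ : (fun x => c * f x) = fun x => c * f x + 0 * f x).
  by rewrite partial_lin//; apply/funext => x; rewrite mul0r addr0.
by apply/funext => x; rewrite mul0r addr0.
Qed.

Lemma partial_linB i f g (c d : R) x : smooth f -> smooth g ->
  partial i (fun x => c * f x - d * g x) x = c * partial i f x - d * partial i g x.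
Proof.
move=> sf sg; rewrite (partialB i (smoothZ c sf) (smoothZ d sg)).
by rewrite (partialZ i c sf) (partialZ i d sg).
Qed.

Lemma periodicD f g : torus_periodic f -> torus_periodic g ->
  torus_periodic (fun x => f x + g x).
Proof. by move=> pf pg i x; rewrite pf pg. Qed.

Lemma periodicB f g : torus_periodic f -> torus_periodic g ->
  torus_periodic (fun x => f x - g x).
Proof. by move=> pf pg i x; rewrite pf pg. Qed.

Lemma periodicM f g : torus_periodic f -> torus_periodic g ->
  torus_periodic (fun x => f x * g x).
Proof. by move=> pf pg i x; rewrite pf pg. Qed.

Lemma periodicZ f (c : R) : torus_periodic f -> torus_periodic (fun x => c * f x).
Proof. by move=> pf i x; rewrite pf. Qed.

Lemma periodic_sum (I : Type) (r : seq I) (f : I -> space3 R -> R) :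
  (forall k, torus_periodic (f k)) -> torus_periodic (fun x => \sum_(k <- r) f k x).
Proof. by move=> pf i x; apply: eq_bigr => k _; exact: pf. Qed.

End SmoothAlgebra.

Section WeakIdentities.
Context (R : realType).
Implicit Types (f g F psi : space3 R -> R) (phi : vfield R) (eta : 'I_3 -> R).
Local Notation Int f := (\int[volume]_(x in cube) f x).

Lemma ord3D : ((0 + 1 = 1 :> 'I_3)%R * (1 + 1 = 2 :> 'I_3)%R * (2 + 1 = 0 :> 'I_3)%R *
  (0 + 2 = 2 :> 'I_3)%R * (1 + 2 = 0 :> 'I_3)%R * (2 + 2 = 1 :> 'I_3)%R)%type.
Proof. by do ![split]; exact/val_inj. Qed.

Definition cross (d eta : 'I_3 -> R) (a : 'I_3) : R :=
  d (a + 1) * eta (a + 2) - d (a + 2) * eta (a + 1).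

(** When [dF] is the gradient of [F] this is the vector product of grad F and [eta], that is, the
    curl of [F eta]. *)
Definition pot_field eta (dF : vfield R) : vfield R :=
  fun a x => cross (fun k => dF k x) eta a.

Lemma int_by_parts_sum F dF (Psi : vfield R) :
  C1 F dF -> torus_periodic F -> (forall k, smooth (Psi k)) ->
  (forall k, torus_periodic (Psi k)) ->
  Int (fun x => \sum_k dF k x * Psi k x) = - Int (fun x => F x * divergence Psi x).
Proof.
move=> CF pF sP pP.
have bF := C1_cube_bounded CF; have bdF k := C1_cube_bounded_partial k CF.
have bP k := C1_cube_bounded (smooth_C1 (sP k)).
have bdP k l := C1_cube_bounded_partial l (smooth_C1 (sP k)).
rewrite cube_int_sum; last by move=> k; exact: cube_boundedM.
under eq_bigr do rewrite (cube_int_by_parts _ CF (smooth_C1 (sP _)))//.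
rewrite sumrN; congr (- _); rewrite -cube_int_sum; last first.
  by move=> k; apply: cube_boundedM.
by apply: eq_Rintegral => x _; rewrite /divergence mulr_sumr.
Qed.

Lemma sum_cross (d eta p : 'I_3 -> R) : \sum_b cross d eta b * p b =
  \sum_k d k * (eta (k + 1) * p (k + 2) - eta (k + 2) * p (k + 1)).
Proof. by rewrite !sum3 /cross !ord3D; ring. Qed.

(** Contraction of the antisymmetric symbol with a symmetric matrix: the algebra behind div curl =
    0. *)
Lemma sum_eps_sym (eta : 'I_3 -> R) (P : 'I_3 -> 'I_3 -> R) :
  (forall i j, P i j = P j i) ->
  \sum_k (eta (k + 1) * P k (k + 2) - eta (k + 2) * P k (k + 1)) = 0.
Proof.
move=> C; rewrite sum3 !ord3D (C 1 0) (C 2 0) (C 2 1); ring.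
Qed.

(** One integration by parts moves the derivative from [F] onto the vector product of [eta] and grad
    psi, whose divergence contracts the Hessian of [psi] antisymmetrically. *)
Lemma pot_field_div_free eta F dF psi : C1 F dF -> torus_periodic F ->
  smooth psi -> torus_periodic psi ->
  Int (fun x => \sum_b pot_field eta dF b x * partial b psi x) = 0.
Proof.
move=> CF pF spsi ppsi.
pose Psi : vfield R := fun k x =>
  eta (k + 1) * partial (k + 2) psi x - eta (k + 2) * partial (k + 1) psi x.
have sp i := smooth_partial i spsi.
have sZ i (c : R) : smooth (fun x => c * partial i psi x) := smoothZ c (sp i).
have sPsi k : smooth (Psi k) := smoothB (sZ _ _) (sZ _ _).
have pPsi k : torus_periodic (Psi k).
  exact: periodicB (periodicZ _ (periodic_partial _ ppsi)) (periodicZ _ (periodic_partial _ ppsi)).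
transitivity (Int (fun x => \sum_k dF k x * Psi k x)).
  by apply: eq_Rintegral => x _; exact: sum_cross.
rewrite (int_by_parts_sum CF)// (_ : (fun x => _) = fun=> 0).
  by rewrite cube_int_cst oppr0.
apply/funext => x; rewrite /divergence.
have dPsi i k : partial i (Psi k) x =
    eta (k + 1) * partial i (partial (k + 2) psi) x - eta (k + 2) * partial i (partial (k + 1) psi) x.
  exact: (partial_linB i (eta (k + 1)) (eta (k + 2)) x (sp (k + 2)) (sp (k + 1))).
have C i j := congr1 (@^~ x) (smooth_partialC i j spsi).
under eq_bigr do rewrite dPsi.
by rewrite (sum_eps_sym eta C) mulr0.
Qed.

Lemma smooth_sum (f : 'I_3 -> space3 R -> R) : (forall i, smooth (f i)) ->
  smooth (fun x => \sum_i f i x).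
Proof.
move=> sf; rewrite (_ : (fun x => _) = fun x => f 0 x + f 1 x + f 2 x).
  exact: smoothD (smoothD (sf _) (sf _)) (sf _).
by apply/funext => x; rewrite sum3.
Qed.

Lemma partial_sum i (f : 'I_3 -> space3 R -> R) : (forall i, smooth (f i)) ->
  partial i (fun x => \sum_j f j x) = fun x => \sum_j partial i (f j) x.
Proof.
move=> sf; rewrite (_ : (fun x => _) = fun x => f 0 x + f 1 x + f 2 x).
  rewrite (partialD i (smoothD (sf 0) (sf 1)) (sf 2)) (partialD i (sf 0) (sf 1)).
  by apply/funext => x; rewrite sum3.
by apply/funext => x; rewrite sum3.
Qed.

Lemma smooth_laplacian f : smooth f -> smooth (laplacian f).
Proof. by move=> sf; apply: smooth_sum => i; exact/smooth_partial/smooth_partial. Qed.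

Lemma partial_laplacian i f : smooth f ->
  partial i (laplacian f) = fun x => \sum_j partial i (partial j (partial j f)) x.
Proof.
move=> sf.
exact: (partial_sum i (fun j => smooth_partial j (smooth_partial j sf))).
Qed.

Lemma smooth_curl phi a : (forall i, smooth (phi i)) -> smooth (curl phi a).
Proof. by move=> sp; exact: (smoothB (smooth_partial _ (sp _)) (smooth_partial _ (sp _))). Qed.

Lemma partial_curl i phi a : (forall i, smooth (phi i)) ->
  partial i (curl phi a) = fun x => partial i (partial (a + 1) (phi (a + 2))) x
    - partial i (partial (a + 2) (phi (a + 1))) x.
Proof. by move=> sp; exact: (partialB _ (smooth_partial _ (sp _)) (smooth_partial _ (sp _))). Qed.

Lemma partial2_curl i j phi a : (forall i, smooth (phi i)) ->
  partial i (partial j (curl phi a)) = fun x =>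
    partial i (partial j (partial (a + 1) (phi (a + 2)))) x
    - partial i (partial j (partial (a + 2) (phi (a + 1)))) x.
Proof.
move=> sp; rewrite partial_curl//.
by apply: partialB; exact/smooth_partial/smooth_partial.
Qed.

Lemma periodic_laplacian f : torus_periodic f -> torus_periodic (laplacian f).
Proof.
by move=> pf i x; apply: eq_bigr => j _; exact: (periodic_partial _ (periodic_partial _ pf)).
Qed.

Lemma periodic_curl phi a : (forall i, torus_periodic (phi i)) -> torus_periodic (curl phi a).
Proof. by move=> pp i x; rewrite /curl !(periodic_partial _ (pp _)). Qed.

Lemma div_curl phi x : (forall i, smooth (phi i)) -> divergence (curl phi) x = 0.
Proof.
move=> sp; rewrite /divergence; under eq_bigr do rewrite partial_curl//.
have C a i j := congr1 (@^~ x) (smooth_partialC i j (sp a)).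
rewrite sum3 !ord3D (C _ 1 0) (C _ 2 0) (C _ 2 1) => {C}.
by move: (partial _ _ x) (partial _ _ x) (partial _ _ x) => *; ring.
Qed.

Definition sym_grad eta (dF : vfield R) (a b : 'I_3) x := dF a x * eta b + eta a * dF b x.

Lemma sum_cross_sym (d eta p : 'I_3 -> R) (Q : 'I_3 -> 'I_3 -> R) :
  \sum_a cross d eta a * p a + \sum_a \sum_b (d a * eta b + eta a * d b) * Q a b =
  \sum_k d k * ((eta (k + 1) * p (k + 2) - eta (k + 2) * p (k + 1))
                + \sum_b eta b * (Q k b + Q b k)).
Proof. by rewrite !sum3 /cross !ord3D; ring. Qed.

(** Read [U k l m a] as third derivatives of the component [a] of a field phi. The first part is the
    divergence of the vector product of [eta] and the Laplacian of phi, that is, minus [eta] times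
    curl Laplacian phi. The second is [eta] times the sum of grad div curl phi, which is 0, and of
    Laplacian curl phi, which cancels the first. *)
Lemma sum_eps_sym3 (eta : 'I_3 -> R) (U : 'I_3 -> 'I_3 -> 'I_3 -> 'I_3 -> R) :
  (forall k l m a, U k l m a = U l k m a) -> (forall k l m a, U k l m a = U k m l a) ->
  \sum_k ((eta (k + 1) * \sum_j U k j j (k + 2) - eta (k + 2) * \sum_j U k j j (k + 1))
    + \sum_b eta b * ((U k b (k + 1) (k + 2) - U k b (k + 2) (k + 1)) +
                      (U k k (b + 1) (b + 2) - U k k (b + 2) (b + 1)))) = 0.
Proof.
move=> S T; rewrite !sum3 !ord3D.
rewrite ?(S 1 0) ?(S 2 0) ?(S 2 1) ?(T _ 1 0) ?(T _ 2 0) ?(T _ 2 1) ?(S 1 0) ?(S 2 0) ?(S 2 1).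
ring.
Qed.

(** The integrand of the stationary weak formulation with a general tensor [S] in place of B (x)
    B. *)
Definition weak_form (B : vfield R) (S : 'I_3 -> 'I_3 -> space3 R -> R) phi x : R :=
  \sum_a B a x * laplacian (phi a) x +
  \sum_a \sum_b S a b x * partial b (curl phi a) x.

(** This settles the linear term: pairing curl(F eta) with the Laplacian of phi is cancelled by
    pairing the symmetric gradient of [F eta] with the gradient of curl phi. That symmetric gradient
    has the size of the wave itself, hence is small in L^1. *)
Lemma int_linear_stress eta F dF phi : C1 F dF -> torus_periodic F ->
  (forall i, smooth (phi i)) -> (forall i, torus_periodic (phi i)) ->
  Int (weak_form (pot_field eta dF) (sym_grad eta dF) phi) = 0.
Proof.
move=> CF pF sphi pphi.
have sc a : smooth (curl phi a) := smooth_curl a sphi.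
have sl a : smooth (laplacian (phi a)) := smooth_laplacian (sphi a).
have pl a := periodic_laplacian (pphi a).
have pdc a b := periodic_partial b (periodic_curl a pphi).
have slZ (c : R) a : smooth (fun x => c * laplacian (phi a) x) := smoothZ c (sl a).
have sdc a b : smooth (partial b (curl phi a)) := smooth_partial b (sc a).
have ss k b : smooth (fun x => partial b (curl phi k) x + partial k (curl phi b) x)
  := smoothD (sdc k b) (sdc b k).
have ssZ k b : smooth (fun x => eta b * (partial b (curl phi k) x + partial k (curl phi b) x))
  := smoothZ _ (ss k b).
pose Psi : vfield R := fun k x =>
  (eta (k + 1) * laplacian (phi (k + 2)) x - eta (k + 2) * laplacian (phi (k + 1)) x)
  + \sum_b eta b * (partial b (curl phi k) x + partial k (curl phi b) x).
have sB k : smooth (fun x => eta (k + 1) * laplacian (phi (k + 2)) x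
    - eta (k + 2) * laplacian (phi (k + 1)) x) := smoothB (slZ _ _) (slZ _ _).
have sS k := smooth_sum (ssZ k).
have sPsi k : smooth (Psi k) := smoothD (sB k) (sS k).
have pPsi k : torus_periodic (Psi k) :=
  periodicD (periodicB (periodicZ _ (pl _)) (periodicZ _ (pl _)))
    (periodic_sum _ (fun b => periodicZ _ (periodicD (pdc k b) (pdc b k)))).
transitivity (Int (fun x => \sum_k dF k x * Psi k x)).
  by apply: eq_Rintegral => x _; exact: sum_cross_sym.
rewrite (int_by_parts_sum CF)// (_ : (fun x => _) = fun=> 0).
  by rewrite cube_int_cst oppr0.
apply/funext => x; rewrite /divergence.
pose U k l m a := partial k (partial l (partial m (phi a))) x.
have dPsi k : partial k (Psi k) x =
   ((eta (k + 1) * \sum_j U k j j (k + 2) - eta (k + 2) * \sum_j U k j j (k + 1))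
    + \sum_b eta b * ((U k b (k + 1) (k + 2) - U k b (k + 2) (k + 1)) +
                      (U k k (b + 1) (b + 2) - U k k (b + 2) (b + 1)))).
  have H1 p q (c d : R) : partial k (fun x => c * laplacian (phi p) x - d * laplacian (phi q) x) x =
      c * (\sum_j U k j j p) - d * (\sum_j U k j j q).
    apply: (etrans (partial_linB k c d x (sl p) (sl q))); congr (_ * _ - _ * _).
      exact: (congr1 (@^~ x) (partial_laplacian k (sphi p))).
    exact: (congr1 (@^~ x) (partial_laplacian k (sphi q))).
  have H2 b : partial k (fun x => eta b * (partial b (curl phi k) x + partial k (curl phi b) x)) x
     = eta b * (partial k (partial b (curl phi k)) x + partial k (partial k (curl phi b)) x).
    by rewrite (partialZ k _ (ss k b)) (partialD k (sdc k b) (sdc b k)).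
  rewrite /Psi (partialD k (sB k) (sS k)) (partial_sum k (ssZ k)).
  congr (_ + _); first exact: H1.
  apply: eq_bigr => b _; apply: (etrans (H2 b)); congr (_ * (_ + _)).
    exact: (congr1 (@^~ x) (partial2_curl k b k sphi)).
  exact: (congr1 (@^~ x) (partial2_curl k k b sphi)).
under eq_bigr do rewrite dPsi.
have US k l m a : U k l m a = U l k m a.
  exact: (congr1 (@^~ x) (smooth_partialC k l (smooth_partial m (sphi a)))).
have UT k l m a : U k l m a = U k m l a.
  exact: (congr1 (fun f => partial k f x) (smooth_partialC l m (sphi a))).
exact: (etrans (congr1 (fun z => F x * z) (sum_eps_sym3 eta US UT)) (mulr0 _)).
Qed.

Lemma ord3_eq : (((0 == 1 :> 'I_3) = false) * ((0 == 2 :> 'I_3) = false) *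
  ((1 == 0 :> 'I_3) = false) * ((1 == 2 :> 'I_3) = false) *
  ((2 == 0 :> 'I_3) = false) * ((2 == 1 :> 'I_3) = false))%type.
Proof. by []. Qed.

Lemma sum_cross_delta (d eta : 'I_3 -> R) a :
  \sum_k d k * cross (fun j => (j == k)%:R) eta a = cross d eta a.
Proof.
by elim/ord3_ind: a; rewrite sum3 /cross !ord3D !eqxx !ord3_eq /= ?mulr1n ?mulr0n; ring.
Qed.

(** The operator sending [F] to the vector product of grad F and [eta], applied twice. If [F]
    depends on x_i alone, the result is F'' xi (x) xi with xi the vector product of e_i and [eta]:
    so a mean zero function of x_i times xi (x) xi is a double derivative. *)
Definition pot_stress eta (ddF : 'I_3 -> 'I_3 -> space3 R -> R) (a b : 'I_3) x :=
  cross (fun k => cross (fun l => ddF l k x) eta b) eta a.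

Lemma C1_pot_field eta dF ddF b : (forall k, C1 (dF k) (ddF k)) ->
  C1 (pot_field eta dF b) (fun k x => cross (fun l => ddF l k x) eta b).
Proof.
move=> CF; rewrite /pot_field /cross.
have := C1D (C1Z (eta (b + 2)) (CF (b + 1))) (C1Z (- eta (b + 1)) (CF (b + 2))).
congr C1; first by apply/funext => x; ring.
by apply/funext => i; apply/funext => x; ring.
Qed.

(** The derivative that carries the first index is moved onto the test function; what remains is a
    [pot_field] in the second index paired with a gradient, which vanishes. *)
Lemma int_pot_stress eta F dF ddF phi : C1 F dF -> (forall k, C1 (dF k) (ddF k)) ->
  torus_periodic F -> (forall k, torus_periodic (dF k)) ->
  (forall i, smooth (phi i)) -> (forall i, torus_periodic (phi i)) ->
  Int (fun x => \sum_a \sum_b pot_stress eta ddF a b x * partial b (curl phi a) x) = 0.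
Proof.
move=> CF CdF pF pdF sphi pphi.
have CL b := C1_pot_field eta b CdF.
have sc a := smooth_curl a sphi.
have sdc a k := smooth_partial k (sc a).
have sddc a k l := smooth_partial l (sdc a k).
have pc a := periodic_curl a pphi.
have pL b : torus_periodic (pot_field eta dF b).
  by move=> i x; rewrite /pot_field /cross !pdF.
have bS a b : cube_bounded (fun x => pot_stress eta ddF a b x * partial b (curl phi a) x).
  apply: cube_boundedM; last exact: C1_cube_bounded (smooth_C1 (sdc a b)).
  have H k : cube_bounded (fun x => cross (fun l => ddF l k x) eta b).
    exact: C1_cube_bounded_partial (CL b).
  by apply: cube_boundedB; apply: cube_boundedM => //; exact: cube_bounded_cst.
rewrite cube_int_sum; last by move=> a; apply: cube_bounded_sum => b; exact: bS.
rewrite big1// => a _.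
have sZ (c : R) k : smooth (fun x => c * partial k (curl phi a) x) := smoothZ c (sdc a k).
pose W x := eta (a + 2) * partial (a + 1) (curl phi a) x
            - eta (a + 1) * partial (a + 2) (curl phi a) x.
have sW : smooth W := smoothB (sZ _ _) (sZ _ _).
have pW : torus_periodic W := periodicB (periodicZ _ (periodic_partial _ (pc a))) (periodicZ _ (periodic_partial _ (pc a))).
have dW b : partial b W = fun x => eta (a + 2) * partial b (partial (a + 1) (curl phi a)) x
            - eta (a + 1) * partial b (partial (a + 2) (curl phi a)) x.
  apply/funext => x.
  exact: (partial_linB b (eta (a + 2)) (eta (a + 1)) x (sdc a (a + 1)) (sdc a (a + 2))).
have Z b : Int (fun x => pot_stress eta ddF a b x * partial b (curl phi a) x) =
    - Int (fun x => pot_field eta dF b x * partial b W x).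
  (* [cross] of the [k]-th unit vector with [eta] is the coefficient of [d k] in [cross d eta a];
     with it the derivative carrying the index [a] is integrated by parts as a single divergence. *)
  pose Psi : vfield R := fun k x => (cross (fun j => (j == k)%:R) eta a) * partial b (curl phi a) x.
  have sPsi k : smooth (Psi k) := smoothZ _ (sdc a b).
  have pPsi k : torus_periodic (Psi k) := periodicZ _ (periodic_partial b (pc a)).
  transitivity (Int (fun x => \sum_k cross (fun l => ddF l k x) eta b * Psi k x)).
    apply: eq_Rintegral => x _; rewrite /pot_stress -sum_cross_delta mulr_suml.
    by apply: eq_bigr => k _; rewrite mulrA.
  rewrite (int_by_parts_sum (CL b) (pL b) sPsi pPsi); congr (- _).
  apply: eq_Rintegral => x _; congr (_ * _); rewrite dW /divergence.
  under eq_bigr => k _ do rewrite (partialZ k _ (sdc a b)) mulrC.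
  rewrite (sum_cross_delta (fun k => partial k (partial b (curl phi a)) x)) /cross.
  have C k := congr1 (@^~ x) (smooth_partialC k b (sc a)).
  have D k (c : R) : partial k (partial b (curl phi a)) x * c = c * partial b (partial k (curl phi a)) x.
    exact: (etrans (mulrC _ _) (congr1 (fun z => c * z) (C k))).
  exact: (congr2 (fun u v : R => u - v) (D (a + 1) (eta (a + 2))) (D (a + 2) (eta (a + 1)))).
rewrite cube_int_sum//; under eq_bigr do rewrite Z.
rewrite sumrN -cube_int_sum.
  by rewrite (pot_field_div_free eta CF pF sW pW) oppr0.
move=> b; apply: cube_boundedM; first exact: C1_cube_bounded (CL b).
exact: C1_cube_bounded (smooth_C1 (smooth_partial b sW)).
Qed.

End WeakIdentities.

(** * One-variable profiles *)

Section DeriveTools.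
Context (R : realType).
Implicit Types (f g : R -> R) (t d : R).

Lemma is_derive_epsilon f t d :
  (forall e, 0 < e -> exists2 r, 0 < r & forall h : R, h != 0 -> `|h| < r ->
     `|d - h^-1 * (f (h + t) - f t)| <= e) ->
  is_derive t 1 f d.
Proof.
move=> H; have L : (h^-1 *: ((f \o shift t) (h *: 1) - f t)) @[h --> (0 : R)^'] --> d.
  apply/cvgrPdist_le => e e0; have [r r0 Hr] := H e e0.
  near=> h; rewrite /= -[h *: 1]/(h * 1) mulr1 -[_ *: _]/(_ * _).
  apply: Hr; first by near: h; exact: nbhs_dnbhs_neq.
  by near: h; apply: dnbhs0_lt.
by split; [apply: (cvgP d)|apply: cvg_lim].
Unshelve. all: by end_near. Qed.

Lemma is_deriveMl f g t df dg : is_derive t 1 f df -> is_derive t 1 g dg ->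
  is_derive t 1 (fun s => f s * g s) (df * g t + f t * dg).
Proof.
move=> Df Dg; have h := is_deriveM Df Dg.
by apply: (is_derive_eq h); rewrite -[f t *: dg]/(f t * dg) -[g t *: df]/(g t * df) addrC [g t * _]mulrC.
Qed.

Lemma is_derive_affine f t (a b : R) d : is_derive (a * t + b) 1 f d ->
  is_derive t 1 (fun s => f (a * s + b)) (a * d).
Proof.
move=> Df.
have Dg : is_derive t 1 (fun s : R => a * s + b) a.
  have h := is_deriveD (is_deriveZ a (is_derive_id t (1 : R))) (is_derive_cst b t 1).
  by apply: (is_derive_eq h); rewrite addr0 -[a *: 1]/(a * 1) mulr1.
by rewrite mulrC; exact: (@is_derive1_comp R f (fun s => a * s + b) t d a Df Dg).
Qed.

Lemma is_deriveZl f t (a : R) d : is_derive t 1 f d ->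
  is_derive t 1 (fun s => a * f s) (a * d).
Proof. by move=> Df; exact: (is_deriveZ a Df). Qed.

Lemma is_deriveDl f g t df dg : is_derive t 1 f df -> is_derive t 1 g dg ->
  is_derive t 1 (fun s => f s + g s) (df + dg).
Proof. by move=> Df Dg; exact: (is_deriveD Df Dg). Qed.

Lemma is_deriveBl f g t df dg : is_derive t 1 f df -> is_derive t 1 g dg ->
  is_derive t 1 (fun s => f s - g s) (df - dg).
Proof. by move=> Df Dg; exact: (is_deriveB Df Dg). Qed.

End DeriveTools.

(** * Truncated powers and the spline from which all profiles are built *)

Section TruncatedPower.
Context (R : realType).
Implicit Types (t u v : R).

Definition tpow (n : nat) t : R := Num.max t 0 ^+ n.

Lemma tpow_neg n t : t <= 0 -> tpow n.+1 t = 0.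
Proof. by move=> t0; rewrite /tpow (max_idPr t0) expr0n. Qed.

Lemma tpow_pos n t : 0 <= t -> tpow n t = t ^+ n.
Proof. by move=> t0; rewrite /tpow (max_idPl t0). Qed.

Lemma is_derive_tpow n t : is_derive t 1 (tpow n.+2) (n.+2%:R * tpow n.+1 t).
Proof.
have [t0|t0|->] := ltgtP t 0.
- rewrite tpow_neg ?mulr0 1?ltW//; apply: near_eq_is_derive (is_derive_cst (0 : R) t 1).
  near=> s; rewrite tpow_neg//; apply: ltW; near: s; exact: lt_nbhsl.
- rewrite tpow_pos 1?ltW//; apply: (@near_eq_is_derive _ _ _ (fun s : R => s ^+ n.+2)).
    near=> s; rewrite tpow_pos//; apply: ltW; near: s; exact: lt_nbhsr.
  have h : is_derive t 1 ((id : R -> R) ^+ n.+2) (n.+2%:R * t ^+ n.+1).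
    by apply: (is_derive_eq (is_deriveX n.+2 (is_derive_id t (1 : R)))); rewrite -[_ *: 1]/(_ * 1) mulr1.
  move: h; congr is_derive.
  by apply/funext => s; rewrite exprfctE.
(* At the knot the difference quotient is at most |h|^(n+1), hence at most |h| once |h| < 1. *)
- rewrite tpow_neg// mulr0; apply: is_derive_epsilon => e e0.
  exists (Num.min e 1); first by rewrite lt_min e0 ltr01.
  move=> h h0; rewrite lt_min => /andP[he h1].
  rewrite sub0r addr0 normrN normrM normfV (tpow_neg _ (lexx 0)) subr0.
  rewrite ler_pdivrMl ?normr_gt0//.
  apply: (@le_trans _ _ (`|h| ^+ n.+2)).
    rewrite /tpow normrX lerXn2r ?nnegrE ?normr_ge0//.
    by rewrite maxEle; case: ifP => // _; rewrite normr0 normr_ge0.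
  rewrite exprS ler_wpM2l//.
  apply: (@le_trans _ _ (`|h|)); last exact: ltW.
  by rewrite exprS ler_piMr// exprn_ile1// ltW.
Unshelve. all: by end_near. Qed.

Lemma continuous_tpow n : continuous (tpow n.+1).
Proof.
move=> t; rewrite /tpow; apply: (@continuous_comp _ _ _ (fun t : R => Num.max t 0) (fun s => s ^+ n.+1)).
  by apply: (@continuous_max _ _ id (cst 0)); [exact: cvg_id|exact: cvg_cst].
exact: exprn_continuous.
Qed.

(* [spline 0] is the cumulative distribution function of the cubic B-spline with knots 0..4, and [spline m] its [m]-th derivative. *)
Definition spline (m : nat) v : R := ((4 - m)`!%:R)^-1 *
  (tpow (4 - m) v - 4 * tpow (4 - m) (v - 1) + 6 * tpow (4 - m) (v - 2)
   - 4 * tpow (4 - m) (v - 3) + tpow (4 - m) (v - 4)).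

Lemma is_derive_spline m v : (m < 3)%N -> is_derive v 1 (spline m) (spline m.+1 v).
Proof.
move=> m3; have [n E4 E3] : exists2 n, (4 - m = n.+2)%N & (4 - m.+1 = n.+1)%N.
  by case: m m3 => [|[|[|]]]// _; [exists 2%N|exists 1%N|exists 0%N].
have D (c : R) : is_derive v 1 (fun s => tpow n.+2 (s - c)) (n.+2%:R * tpow n.+1 (v - c)).
  have h := @is_derive_affine R (tpow n.+2) v 1 (- c) (n.+2%:R * tpow n.+1 (v - c)).
  rewrite mul1r in h.
  have := h (is_derive_tpow n (v - c)); rewrite mul1r; congr is_derive.
  by apply/funext => s; rewrite mul1r.
have H := is_deriveZl ((n.+2)`!%:R)^-1 (is_deriveDl (is_deriveBl (is_deriveDl (is_deriveBl
  (is_derive_tpow n v) (is_deriveZl 4 (D 1))) (is_deriveZl 6 (D 2))) (is_deriveZl 4 (D 3))) (D 4)).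
rewrite /spline E4 E3; apply: (is_derive_eq H).
rewrite factS natrM invfM.
have n0 : n.+2%:R != 0 :> R by rewrite pnatr_eq0.
have f0 : (n.+1)`!%:R != 0 :> R by rewrite pnatr_eq0 -lt0n fact_gt0.
move: (tpow n.+1 v) (tpow n.+1 (v - 1)) (tpow n.+1 (v - 2)) (tpow n.+1 (v - 3)) (tpow n.+1 (v - 4)).
move: (n.+2%:R) n0 ((n.+1)`!%:R) f0 => p p0 q q0 a b c d f.
by field; rewrite p0 q0.
Qed.

Lemma spline_continuous m : (m <= 3)%N -> continuous (spline m).
Proof.
move=> m3; have [n E] : exists n, (4 - m = n.+1)%N.
  by case: m m3 => [|[|[|[|]]]]// _; [exists 3%N|exists 2%N|exists 1%N|exists 0%N].
rewrite /spline E => v.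
have C (c : R) : {for v, continuous (fun s => tpow n.+1 (s - c))}.
  apply: (@continuous_comp _ _ _ (fun s : R => s - c) (tpow n.+1)); last exact: continuous_tpow.
  by apply: cvgB; [exact: cvg_id|exact: cvg_cst].
have CZ (a c : R) : {for v, continuous (fun s => a * tpow n.+1 (s - c))}.
  by apply: cvgM; [exact: cvg_cst|exact: C].
apply: cvgM; first exact: cvg_cst.
apply: cvgD; last exact: C.
apply: cvgB; last exact: CZ.
apply: cvgD; last exact: CZ.
apply: cvgB; last exact: CZ.
exact: continuous_tpow.
Qed.

Lemma spline_neg m v : (m <= 3)%N -> v <= 0 -> spline m v = 0.
Proof.
move=> m3 v0; have [n E] : exists n, (4 - m = n.+1)%N.
  by case: m m3 => [|[|[|[|]]]]// _; [exists 3%N|exists 2%N|exists 1%N|exists 0%N].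
by rewrite /spline E !tpow_neg ?mulr0 ?subr0 ?addr0 ?mulr0//; lra.
Qed.

(** Past the last knot no power is truncated: the fourth difference of v^4 is 4!, and that of a
    lower power is 0. *)
Lemma spline_ge4 m v : (m <= 3)%N -> 4 <= v -> spline m v = (m == 0%N)%:R.
Proof.
move=> m3 v4; rewrite /spline !tpow_pos; try lra.
case: m m3 => [|[|[|[|]]]]// _.
- by rewrite (_ : (4 - 0)%N = 4%N)// (_ : 4`! = 24%N)//=; field.
- by rewrite (_ : (4 - 1)%N = 3%N)// (_ : 3`! = 6%N)//=; field.
- by rewrite (_ : (4 - 2)%N = 2%N)// (_ : 2`! = 2%N)//=; field.
- by rewrite (_ : (4 - 3)%N = 1%N)// (_ : 1`! = 1%N)//=; field.
Qed.

Lemma spline2_01 v : 0 <= v <= 1 -> spline 2 v = v ^+ 2 / 2.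
Proof.
move=> /andP[v0 v1]; rewrite /spline /= (tpow_pos 2 v0) !(tpow_neg 1); try lra.
by rewrite mulrC !mulr0 !subr0 !addr0.
Qed.

(** 16 is the sum 1 + 4 + 6 + 4 + 1 of the absolute coefficients, and 4^4 bounds each truncated
    power for arguments up to 4. *)
Definition spline_bound : R := 16 * 4 ^+ 4.

Lemma spline_bound_gt0 : 0 < spline_bound.
Proof. by rewrite mulr_gt0// exprn_gt0. Qed.

Lemma spline_bound_ge1 : 1 <= spline_bound.
Proof. by rewrite mulr_ege1 ?exprn_ege1 ?ler1n. Qed.

Lemma spline_le m v : (m <= 3)%N -> `|spline m v| <= spline_bound.
Proof.
move=> m3; have sb := spline_bound_ge1.
have [v0|v0] := leP v 0; first by rewrite spline_neg// normr0 ltW// spline_bound_gt0.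
have [v4|v4] := leP 4 v.
  by rewrite spline_ge4//; case: (m == 0%N); rewrite ?normr1 ?normr0//; apply: le_trans sb; exact: ler01.
have [n E n4] : exists2 n, (4 - m = n.+1)%N & (n < 4)%N.
  by case: m m3 => [|[|[|[|]]]]// _; [exists 3%N|exists 2%N|exists 1%N|exists 0%N].
rewrite /spline_bound; move: sb; rewrite /spline_bound.
have B (c : R) : 0 <= c -> `|tpow n.+1 (v - c)| <= 4 ^+ 4.
  move=> c0; rewrite /tpow normrX.
  apply: (@le_trans _ _ ((4 : R) ^+ n.+1)).
    rewrite lerXn2r ?nnegrE ?normr_ge0//.
    by rewrite ger0_norm ?le_max ?lexx ?orbT// ge_max; lra.
  by apply: ler_weXn2l => //; rewrite ler1n.
have B0 : `|tpow n.+1 v| <= 4 ^+ 4 by have := B 0 (lexx 0); rewrite subr0.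
rewrite /spline E normrM.
have f1 : `|((n.+1)`!%:R : R)^-1| <= 1.
  by rewrite normfV invf_le1 ?normr_gt0 ?pnatr_eq0 -?lt0n ?fact_gt0// ger0_norm// ler1n fact_gt0.
move: (tpow n.+1 v) (tpow n.+1 (v - 1)) (tpow n.+1 (v - 2)) (tpow n.+1 (v - 3)) (tpow n.+1 (v - 4))
  B0 (B 1 ler01) (B 2 (ler0n _ _)) (B 3 (ler0n _ _)) (B 4 (ler0n _ _)) => a b c d f.
move: ((4 : R) ^+ 4) => w ha hb hc hd hf _.
rewrite -[X in _ <= X]mul1r ler_pM//.
move: ha hb hc hd hf; rewrite !ler_norml => /andP[? ?] /andP[? ?] /andP[? ?] /andP[? ?] /andP[? ?].
by apply/andP; split; lra.
Qed.

End TruncatedPower.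

(** * Jets: functions with explicit derivatives, their products and periodization *)

Section Jets.
Context (R : realType).
Implicit Types (f g : nat -> R -> R) (t u : R) (m n : nat).

Lemma continuous_bigsum (T : topologicalType) (I : Type) (r : seq I) (F : I -> T -> R) :
  (forall k, continuous (F k)) -> continuous (fun x : T => \sum_(k <- r) F k x).
Proof.
move=> cF; elim: r => [|k r IH] x.
  rewrite (_ : (fun x : T => _) = fun=> 0); first exact: cvg_cst.
  by apply/funext => s; rewrite big_nil.
rewrite (_ : (fun x : T => _) = fun x : T => F k x + \sum_(k <- r) F k x).
  by apply: cvgD; [exact: cF|exact: IH].
by apply/funext => s; rewrite big_cons.
Qed.

(** The explicit family of derivatives allows bounds that are geometric in the order to be followed
    through rescalings and products. *)
Definition jet m f : Prop :=
  (forall n t, (n < m)%N -> is_derive t 1 (f n) (f n.+1 t)) /\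
  (forall n, (n <= m)%N -> continuous (f n)).

Lemma jetP m f : (forall n t, (n < m)%N -> is_derive t 1 (f n) (f n.+1 t)) ->
  continuous (f m) -> jet m f.
Proof.
move=> D c; split=> // n; rewrite leq_eqVlt => /predU1P[->//|nm] t.
exact: is_derive_continuous (D n t nm).
Qed.

Lemma jet_le m m' f : (m' <= m)%N -> jet m f -> jet m' f.
Proof.
move=> mm [D c]; split=> [n t nm|n nm]; first by apply: D; exact: leq_trans nm mm.
by apply: c; exact: leq_trans nm mm.
Qed.

Definition jet_affine (a b : R) f : nat -> R -> R := fun n t => a ^+ n * f n (a * t + b).

Lemma jet_affineP m (a b : R) f : jet m f -> jet m (jet_affine a b f).
Proof.
move=> [D c]; split=> [n t nm|n nm t].
  rewrite /jet_affine exprSr -mulrA; apply: is_deriveZl; apply: is_derive_affine.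
  exact: D.
apply: cvgM; first exact: cvg_cst.
apply: (@continuous_comp _ _ _ (fun t : R => a * t + b) (f n)); last exact: c.
by apply: cvgD; [apply: cvgM; [exact: cvg_cst|exact: cvg_id]|exact: cvg_cst].
Qed.

Definition jet_mul f g : nat -> R -> R := fun n t =>
  \sum_(k < n.+1) 'C(n, k)%:R * (f k t * g (n - k)%N t).

(** Leibniz' rule, order by order. Three derivatives suffice: two turn a potential into a stress,
    one more bounds the gradient of that stress. *)
Lemma jet_mulP m f g : (m <= 3)%N -> jet m f -> jet m g -> jet m (jet_mul f g).
Proof.
move=> m3 [Df cf] [Dg cg]; split.
  move=> n t nm.
  have H k l : (k + l <= n)%N -> is_derive t 1 (fun s => f k s * g l s)
       (f k.+1 t * g l t + f k t * g l.+1 t).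
    move=> kl; apply: is_deriveMl.
      by apply: Df; apply: leq_ltn_trans nm; apply: leq_trans kl; exact: leq_addr.
    by apply: Dg; apply: leq_ltn_trans nm; apply: leq_trans kl; exact: leq_addl.
  case: n nm H => [|[|[|n]]] nm H; last by have := leq_trans nm m3.
  - have := H 0%N 0%N (leqnn _); rewrite /jet_mul; congr is_derive.
      by apply/funext => s; rewrite big_ord_recl big_ord0 bin0 mul1r addr0.
    by rewrite !big_ord_recl big_ord0 /= !subn0 !bin0 !bin1 !mul1r addr0 addrC.
  - have := is_deriveDl (H 0%N 1%N (leqnn _)) (H 1%N 0%N (leqnn _)); rewrite /jet_mul; congr is_derive.
      by apply/funext => s; rewrite !big_ord_recl big_ord0 /= /bump /= !subn0 !bin0 !bin1 !mul1r addr0.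
    rewrite !big_ord_recl big_ord0 /= /bump /= !subn0 !bin0 !bin1 !binn; ring.
  - have := is_deriveDl (is_deriveDl (H 0%N 2%N (leqnn _)) (is_deriveZl 2 (H 1%N 1%N (leqnn _))))
        (H 2%N 0%N (leqnn _)); rewrite /jet_mul; congr is_derive.
      apply/funext => s; rewrite !big_ord_recl big_ord0 /= /bump /= !subn0 !bin0 !bin1 !binn; ring.
    rewrite !big_ord_recl big_ord0 /= /bump /= !subn0 !bin0 !bin1 !binn.
    rewrite (_ : 'C(3, 2) = 3%N)//; ring.
move=> n nm; rewrite /jet_mul; apply: continuous_bigsum => k t.
apply: cvgM; first exact: cvg_cst.
apply: cvgM; first by apply: cf; apply: leq_trans nm; rewrite -ltnS.
by apply: cg; apply: leq_trans nm; exact: leq_subr.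
Qed.

Definition jet_bound m f (K a : R) := forall n t, (n <= m)%N -> `|f n t| <= K * a ^+ n.

(** By Leibniz' formula and the binomial theorem, geometric bounds of ratios [a] and [b] combine
    into one of ratio [b + a]. *)
Lemma jet_mul_bound m f g (K a L b : R) : 0 <= K -> 0 <= L -> 0 <= a -> 0 <= b ->
  jet_bound m f K a -> jet_bound m g L b ->
  jet_bound m (jet_mul f g) (K * L) (b + a).
Proof.
move=> K0 L0 a0 b0 bf bg n t nm; rewrite /jet_mul.
apply: (le_trans (ler_norm_sum _ _ _)).
rewrite exprDn mulr_sumr; apply: ler_sum => k _.
rewrite normrM ger0_norm ?ler0n// normrM.
apply: (@le_trans _ _ ('C(n, k)%:R * ((K * a ^+ k) * (L * b ^+ (n - k))))).
  rewrite ler_wpM2l ?ler0n// ler_pM//.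
    by apply: bf; apply: leq_trans nm; rewrite -ltnS.
  by apply: bg; apply: leq_trans nm; exact: leq_subr.
by rewrite -[X in _ <= _ * X]mulr_natr le_eqVlt; apply/orP; left; apply/eqP; ring.
Qed.

(** A profile on the unit interval that is zero near both ends can be repeated, and multiplied by a
    different constant in each cell, without loss of smoothness. *)
Definition vanish_ends m f := exists2 e : R, 0 < e &
  forall n u, (n <= m)%N -> u < e \/ 1 - e < u -> f n u = 0.

Definition fpart t : R := t - (Num.floor t)%:~R.

Lemma fpart_itv t : 0 <= fpart t < 1.
Proof.
rewrite /fpart subr_ge0 ge_floor ltrBlDr.
by have := floorD1_gt t; rewrite intrD addrC.
Qed.

(** Close to [t0] the floor can only change if [t0] is an integer and [t] lies to its left. Then [t]
    is near the right end of its own cell and outside the left end of the cell of [t0]; a profile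
    with [vanish_ends] is 0 in both readings. *)
Lemma floor_near (e t0 : R) : 0 < e -> \forall t \near t0,
  Num.floor t = Num.floor t0 \/ (1 - e < fpart t /\ t - (Num.floor t0)%:~R < e).
Proof.
move=> e0; set n := Num.floor t0.
have n1 : n%:~R <= t0 by exact: ge_floor.
have n2 : t0 < (n + 1)%:~R by exact: floorD1_gt.
near=> t.
have t1 : t < (n + 1)%:~R by near: t; exact: lt_nbhsl.
have t2 : n%:~R - e < t by near: t; apply: lt_nbhsr; lra.
have t3 : n%:~R - 1 < t by near: t; apply: lt_nbhsr; lra.
have [nt|tn] := leP n%:~R t.
  by left; apply/eqP; rewrite floor_eq nt t1.
right; have fl : Num.floor t = n - 1.
  by apply/eqP; rewrite floor_eq subrK tn intrB ltW.
by rewrite /fpart fl intrB; split; lra.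
Unshelve. all: by end_near. Qed.

Definition periodize f : nat -> R -> R := fun n t => f n (fpart t).

Lemma periodize_near m n f t0 : vanish_ends m f -> (n <= m)%N ->
  \forall t \near t0, f n (t - (Num.floor t0)%:~R) = periodize f n t.
Proof.
move=> [e e0 H] nm; near=> t.
have : Num.floor t = Num.floor t0 \/ (1 - e < fpart t /\ t - (Num.floor t0)%:~R < e).
  by near: t; exact: floor_near.
rewrite /periodize; case=> [E|[h1 h2]]; first by rewrite /fpart E.
by rewrite !H//; [right|left].
Unshelve. all: by end_near. Qed.

Lemma jet_periodize m f : jet m f -> vanish_ends m f -> jet m (periodize f).
Proof.
move=> [D c] v; apply: jetP => [n t nm|t].
  apply: (near_eq_is_derive (periodize_near t v (ltnW nm))).
  have := @is_derive_affine R (f n) t 1 (- (Num.floor t)%:~R) (f n.+1 (fpart t)).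
  rewrite !mul1r; have -> : t - (Num.floor t)%:~R = fpart t by [].
  move=> /(_ (D n (fpart t) nm)); congr is_derive.
  by apply/funext => s; rewrite mul1r.
have cs : {for t, continuous (fun s : R => f m (s - (Num.floor t)%:~R))}.
  apply: (@continuous_comp _ _ _ (fun s : R => s - (Num.floor t)%:~R) (f m)); last exact: c.
  by apply: cvgB; [exact: cvg_id|exact: cvg_cst].
rewrite /continuous_at; have -> : periodize f m t = f m (t - (Num.floor t)%:~R) by [].
apply: cvg_trans cs; apply: near_eq_cvg.
by apply: filterS (periodize_near t v (leqnn m)) => s ->.
Qed.

Lemma fpartDz t (k : int) : fpart (t + k%:~R) = fpart t.
Proof.
rewrite /fpart (_ : Num.floor (t + k%:~R) = Num.floor t + k); first by rewrite intrD; ring.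
apply/eqP; rewrite floor_eq addrAC !intrD lerD2r ltrD2r ge_floor /=.
by have := floorD1_gt t; rewrite intrD.
Qed.

Lemma fpartD1 t : fpart (t + 1) = fpart t.
Proof. exact: (fpartDz t 1). Qed.

Lemma fpart_id t : 0 <= t < 1 -> fpart t = t.
Proof.
move=> /andP[t0 t1]; rewrite /fpart (_ : Num.floor t = 0) ?subr0//.
by apply/eqP; rewrite floor_eq add0r t0 t1.
Qed.

Lemma vanish_jet_mul m f g : vanish_ends m f -> vanish_ends m (jet_mul f g).
Proof.
move=> [e e0 H]; exists e => // n u nm hu; rewrite /jet_mul big1// => k _.
by rewrite H ?mul0r ?mulr0//; apply: leq_trans nm; rewrite -ltnS.
Qed.

End Jets.

(** * Primitives on the line and periodic correctors *)

Section Primitive.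
Context (R : realType).
Implicit Types (f F : R -> R) (t : R).
Local Notation mu := (@lebesgue_measure R).

Lemma continuous_integrable_itv f (a b : R) : continuous f ->
  mu.-integrable `[a, b] (EFin \o f).
Proof.
move=> cf; apply: continuous_compact_integrable; first exact: segment_compact.
exact: continuous_subspaceT.
Qed.

(** Integrability is at hand on segments only, so the base point -(|t| + 1) moves with [t];
    subtracting the integral up to 0 makes the value independent of it. *)
Lemma exists_primitive f : continuous f ->
  exists F, forall t : R, is_derive t 1 F (f t).
Proof.
move=> cf; pose G a t := \int[mu]_(s in `[a, t]) f s.
pose F t := G (- (`|t| + 1)) t - G (- (`|t| + 1)) 0.
have GB (a b t : R) : a <= b -> b <= t -> G a t = G a b + G b t.
  move=> ab bt; have := @Rintegral_itvB R f (BLeft a) (BRight t) b (continuous_integrable_itv a t cf).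
  rewrite !bnd_simp => /(_ ab bt) H.
  rewrite /G -[X in _ = _ + X](@Rintegral_itv_obnd_cbnd _ b (BRight t))// -?H; first by rewrite addrC subrK.
  apply: integrableS (continuous_integrable_itv b t cf) => //.
  by apply: subset_itvr; rewrite bnd_simp.
have FE (a t : R) : a <= - (`|t| + 1) -> F t = G a t - G a 0.
  move=> at_; rewrite /F; set b := - (`|t| + 1) in at_ *.
  have bt : b <= t by rewrite /b lerNl; have := ler_norm (- t); rewrite normrN; lra.
  have b0 : b <= 0 by rewrite /b oppr_le0 addr_ge0.
  by rewrite (GB a b t)// (GB a b 0)//; ring.
exists F => t0; pose a := - (`|t0| + 2).
have at0 : a < t0 by rewrite /a ltrNl; have := ler_norm (- t0); rewrite normrN; lra.
have tu : t0 < t0 + 1 by rewrite ltrDl.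
have [D1 D2] := continuous_FTC1_closed tu (continuous_integrable_itv a (t0 + 1) cf) at0 (cf t0).
apply: (@near_eq_is_derive _ _ _ (fun t => G a t - G a 0)).
  near=> t; rewrite (FE a)// /a lerN2.
  have : `|t - t0| < 1.
    by rewrite distrC; near: t; apply: cvgr_dist_lt => //; exact: cvg_id.
  have := ler_distD t0 t 0; rewrite !subr0; lra.
have DG : is_derive t0 1 (G a) (f t0) by split; [exact: D1|rewrite -derive1E; exact: D2].
have := is_deriveBl DG (is_derive_cst (G a 0) t0 1).
by rewrite subr0.
Unshelve. all: by end_near. Qed.

Lemma derivative_segment f F (a b : R) : (forall t : R, is_derive t 1 F (f t)) -> a <= b ->
  exists2 c, a <= c <= b & F b - F a = f c * (b - a).
Proof.
move=> D ab; have [|c ci E] := @MVT_segment R F f a b ab (fun x _ => D x).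
  by apply: continuous_subspaceT => x; exact: is_derive_continuous (D x).
by exists c; first by move: ci; rewrite in_itv.
Qed.

Lemma derivative_le f F (a b M : R) : (forall t : R, is_derive t 1 F (f t)) -> a <= b ->
  (forall t, a <= t <= b -> f t <= M) -> F b - F a <= M * (b - a).
Proof.
move=> D ab fM; have [c /fM h ->] := derivative_segment D ab.
by rewrite ler_wpM2r// subr_ge0.
Qed.

Lemma derivative_ge f F (a b M : R) : (forall t : R, is_derive t 1 F (f t)) -> a <= b ->
  (forall t, a <= t <= b -> M <= f t) -> M * (b - a) <= F b - F a.
Proof.
move=> D ab fM; have [c /fM h ->] := derivative_segment D ab.
by rewrite ler_wpM2r// subr_ge0.
Qed.

Definition periodic1 f := forall t, f (t + 1) = f t.

Lemma periodic1_nat f (k : nat) t : periodic1 f -> f (t + k%:R) = f t.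
Proof.
move=> pf; elim: k => [|k IH]; first by rewrite addr0.
by rewrite -natr1 addrA pf.
Qed.

Lemma periodic1_int f (k : int) t : periodic1 f -> f (t + k%:~R) = f t.
Proof.
move=> pf; case: k => k; first exact: periodic1_nat.
rewrite NegzE mulrNz; have := periodic1_nat k.+1 (t - k.+1%:R) pf.
by rewrite subrK => H; exact: (esym H).
Qed.

Lemma periodic1_fpart f t : periodic1 f -> f t = f (fpart t).
Proof. by move=> pf; rewrite -[in RHS](periodic1_int (Num.floor t) (fpart t) pf) /fpart subrK. Qed.

Lemma primitive_shift f F t : (forall t : R, is_derive t 1 F (f t)) -> periodic1 f ->
  F (t + 1) - F t = F 1 - F 0.
Proof.
move=> D pf.
have DD (s : R) : is_derive s 1 (fun s => F (s + 1) - F s) 0.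
  have h := is_deriveBl (@is_derive_affine R F s 1 1 _ (D (1 * s + 1))) (D s).
  rewrite !mul1r pf subrr in h; move: h; congr is_derive.
  by apply/funext => u; rewrite mul1r.
have := @MVT_le R _ _ 0 0 t DD (fun s => _); rewrite mul0r add0r => H.
by apply/eqP; rewrite -subr_eq0 -normr_le0; apply: H; rewrite normr0.
Qed.

Lemma periodic_integral_scale f (k : nat) : (0 < k)%N -> continuous f -> periodic1 f ->
  \int[mu]_(t in `[0, 1]) f (k%:R * t) = \int[mu]_(t in `[0, 1]) f t.
Proof.
move=> k0 cf pf; have [F DF] := exists_primitive cf.
rewrite (Rintegral_derivative ler01 DF cf).
have kn0 : k%:R != 0 :> R by rewrite pnatr_eq0 -lt0n.
have DFk (t : R) : is_derive t 1 (fun t => k%:R^-1 * F (k%:R * t)) (f (k%:R * t)).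
  have h := is_deriveZl k%:R^-1 (@is_derive_affine R F t k%:R 0 _ (DF (k%:R * t + 0))).
  rewrite mulrA mulVf// mul1r addr0 in h; move: h; congr is_derive.
  by apply/funext => s; rewrite addr0.
have cfk : continuous (fun t : R => f (k%:R * t)).
  move=> t; apply: (@continuous_comp _ _ _ (fun t : R => k%:R * t) f); last exact: cf.
  by apply: cvgM; [exact: cvg_cst|exact: cvg_id].
rewrite (Rintegral_derivative ler01 DFk cfk) mulr1 mulr0 -mulrBr.
have E n : F n%:R - F 0 = n%:R * (F 1 - F 0).
  elim: n => [|n IH]; first by rewrite subrr mul0r.
  rewrite -natr1 mulrDl -IH mul1r -(primitive_shift n%:R DF pf); ring.
by rewrite E mulrA mulVf// mul1r.
Qed.

(** [f - 1] is integrated twice. Its first primitive is periodic because [f] has mean 1, and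
    removing its mean makes the second one periodic. As [f] is nonnegative, its integral over any
    part of the unit interval lies in [0, 1], so the bounds do not depend on how concentrated [f]
    is. *)
Lemma exists_corrector f : continuous f -> periodic1 f -> (forall t, 0 <= f t) ->
  \int[mu]_(t in `[0, 1]) f t = 1 ->
  exists h0 h1 : R -> R, [/\ forall t : R, is_derive t 1 h0 (h1 t),
    forall t : R, is_derive t 1 h1 (f t - 1), periodic1 h0, periodic1 h1 &
    forall t, `|h0 t| <= 2 /\ `|h1 t| <= 2].
Proof.
move=> cf pf f0 f1; have [F DF] := exists_primitive cf.
have F1 : F 1 - F 0 = 1 by rewrite -(Rintegral_derivative ler01 DF cf).
pose H t := F t - F 0 - t.
have DH (t : R) : is_derive t 1 H (f t - 1).
  have := is_deriveBl (is_deriveBl (DF t) (is_derive_cst (F 0) t 1)) (is_derive_id t (1 : R)).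
  by rewrite subr0.
have pH : periodic1 H.
  by move=> t; rewrite /H; have := primitive_shift t DF pf; rewrite F1; lra.
have bH01 t : 0 <= t <= 1 -> `|H t| <= 1.
  move=> /andP[t0 t1]; rewrite /H.
  have := derivative_ge DF t0 (fun s _ => f0 s); rewrite mul0r => h1.
  have := derivative_ge DF t1 (fun s _ => f0 s); rewrite mul0r => h2.
  by rewrite ler_norml; apply/andP; split; lra.
have bH t : `|H t| <= 1.
  rewrite (periodic1_fpart t pH); apply: bH01; have /andP[h /ltW ->] := fpart_itv t.
  by rewrite h.
have cH : continuous H by move=> t; exact: is_derive_continuous (DH t).
have [Q DQ] := exists_primitive cH.
pose c := Q 1 - Q 0.
have bc : `|c| <= 1.
  have := @MVT_le R Q H 1 0 1 DQ bH.
  by rewrite subr0 normr1 mulr1.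
pose h1 t := H t - c; pose h0 t := Q t - Q 0 - c * t.
have bh1 t : `|h1 t| <= 2.
  by rewrite (le_trans (ler_normB _ _))// (_ : 2 = 1 + 1)// lerD.
have Dh0 (t : R) : is_derive t 1 h0 (h1 t).
  have := is_deriveBl (is_deriveBl (DQ t) (is_derive_cst (Q 0) t 1)) (is_deriveZl c (is_derive_id t (1 : R))).
  by rewrite subr0 mulr1.
have ph0 : periodic1 h0.
  by move=> t; rewrite /h0; have := primitive_shift t DQ pH; rewrite -/c; lra.
exists h0, h1; split => //.
- by move=> t; have := is_deriveBl (DH t) (is_derive_cst c t 1); rewrite subr0.
- by move=> t; rewrite /h1 pH.
- move=> t; split => //; rewrite (periodic1_fpart t ph0).
  have /andP[f0' /ltW f1'] := fpart_itv t.
  have := @MVT_le R h0 h1 2 0 (fpart t) Dh0 bh1.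
  rewrite /h0 mulr0 subrr subr0 subr0 => h; apply: (le_trans h).
  by rewrite ger0_norm//; lra.
Qed.

End Primitive.

(** * The intermittent profile and the cell cutoff *)

Section Profiles.
Context (R : realType).
Implicit Types (K t u : R).
Local Notation mu := (@lebesgue_measure R).
Local Notation sb := (@spline_bound R).

(** 300 exceeds 288 = 2 * 12 * 12, the factor in the bound of [h 3 = 2 * G 1 * G 2], which is the
    worst one. *)
Definition profile_C : R := 300 * sb ^+ 2.

Lemma profile_C_ge1 : 1 <= profile_C.
Proof.
rewrite /profile_C; have := spline_bound_ge1 R; move: sb => b b1.
have : 1 <= b ^+ 2 by rewrite exprn_ege1.
lra.
Qed.

(* G 1 is the intermittent profile: of mean square 1 but small in L^1.  The jet h of its
   corrector satisfies h 2 = (G 1)^2 - 1. *)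
Record sheet K (G h : nat -> R -> R) : Prop := Sheet {
  sheet_jetG : jet 2 G;
  sheet_jeth : jet 3 h;
  sheet_perG : forall n, periodic1 (G n);
  sheet_perh : forall n, periodic1 (h n);
  sheet_boundG : forall n t, (n <= 2)%N -> `|G n t| <= profile_C * K^-1 * (K ^+ 2) ^+ n;
  sheet_boundh : forall n t, (n <= 3)%N -> `|h n t| <= profile_C * (K ^+ 2) ^+ n.-1;
  sheet_h2 : forall t, h 2 t = G 1 t ^+ 2 - 1;
  sheet_int : \int[mu]_(t in `[0, 1]) `|G 1 t| <= profile_C * K^-1 }.

(** A plateau: it rises from 0 to 1 on [1/K, 5/K] and falls back to 0 on [1 - 5/K, 1 - 1/K]. *)
Definition cutoff K n u : R :=
  jet_affine K (-1) (@spline R) n u - jet_affine K (5 - K) (@spline R) n u.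

Lemma spline_jet : jet 3 (@spline R).
Proof.
apply: jetP => [n t n3|]; first exact: is_derive_spline.
exact: spline_continuous.
Qed.

Lemma jetB m (f g : nat -> R -> R) : jet m f -> jet m g -> jet m (fun n t => f n t - g n t).
Proof.
move=> [Df cf] [Dg cg]; split=> [n t nm|n nm t].
  by apply: is_deriveBl; [exact: Df|exact: Dg].
by apply: cvgB; [exact: cf|exact: cg].
Qed.

Lemma cutoff_jet K : jet 3 (cutoff K).
Proof. by apply: jetB; apply: jet_affineP; exact: spline_jet. Qed.

Lemma cutoff_bound K : 0 <= K -> jet_bound 3 (cutoff K) (2 * sb) K.
Proof.
move=> K0 n u n3; rewrite /cutoff /jet_affine -mulrBr normrM ger0_norm ?exprn_ge0//.
rewrite mulrC ler_wpM2r ?exprn_ge0//.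
apply: (le_trans (ler_normB _ _)).
by rewrite (_ : 2 * sb = sb + sb); [rewrite lerD// spline_le|rewrite mulrDl mul1r].
Qed.

Lemma cutoff_vanish K : 12 <= K -> vanish_ends 3 (cutoff K).
Proof.
move=> K12; have K0 : 0 < K by lra.
exists K^-1; first by rewrite invr_gt0.
move=> n u n3 [h|h]; rewrite /cutoff /jet_affine.
  have h1 : K * u + -1 <= 0.
    by have := ltW h; rewrite -(ler_pM2l K0) mulfV ?gt_eqF//; lra.
  by rewrite !spline_neg ?mulr0 ?subrr//; lra.
have h1 : K - 1 <= K * u.
  by have := ltW h; rewrite -(ler_pM2l K0) mulrBr mulr1 mulfV ?gt_eqF//.
by rewrite !spline_ge4// ?subrr//; lra.
Qed.

Lemma cutoff_plateau K u : 12 <= K -> 5 / K <= u <= 1 - 5 / K -> cutoff K 0 u = 1.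
Proof.
move=> K12 /andP[h1 h2]; have K0 : 0 < K by lra.
have {}h1 : 5 <= K * u by have := h1; rewrite ler_pdivrMr// mulrC.
have {}h2 : K * u <= K - 5.
  by have := h2; rewrite -(ler_pM2l K0) mulrBr mulr1 mulrC (mulrC K (5 / K)) divfK ?gt_eqF// mulrC.
rewrite /cutoff /jet_affine !expr0 !mul1r spline_ge4// ?spline_neg// ?subr0//; lra.
Qed.

(** The shift of the order by one makes level 0 a cubic B-spline supported in [c, c + 4/K^2] and
    level 1 its derivative. The latter is the profile of the wave: it has mean 0 and its potential
    has the same small support. *)
Definition bump_profile K (c A : R) n u : R := A * jet_affine (K ^+ 2) (- (K ^+ 2 * c)) (fun n => @spline R n.+1) n u.

Lemma jetZ m (a : R) (f : nat -> R -> R) : jet m f -> jet m (fun n t => a * f n t).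
Proof.
move=> [Df cf]; split=> [n t nm|n nm t]; first by apply: is_deriveZl; exact: Df.
by apply: cvgM; [exact: cvg_cst|exact: cf].
Qed.

Lemma bump_jet K c A : jet 2 (bump_profile K c A).
Proof.
apply/jetZ/jet_affineP; have [D cc] := spline_jet; split=> [n t n2|n n2].
  exact: D.
exact: cc.
Qed.

Lemma bump_zero K c A n u : (n <= 2)%N -> 0 < K -> u <= c \/ c + 4 / K ^+ 2 <= u ->
  bump_profile K c A n u = 0.
Proof.
move=> n2 K0 h; rewrite /bump_profile /jet_affine.
have K20 : 0 < K ^+ 2 by rewrite exprn_gt0.
have -> : spline n.+1 (K ^+ 2 * u + - (K ^+ 2 * c)) = 0; last by rewrite !mulr0.
case: h => h.
  by apply: spline_neg => //; rewrite -mulrBr pmulr_rle0// subr_le0.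
rewrite spline_ge4//; have := h.
by rewrite -(ler_pM2l K20) mulrDr [_ * (4 / _)]mulrC divfK ?gt_eqF//; lra.
Qed.

Lemma bump_le K c A n u : 0 <= A -> (n <= 2)%N -> `|bump_profile K c A n u| <= A * (K ^+ 2) ^+ n * sb.
Proof.
move=> A0 n2; rewrite /bump_profile /jet_affine mulrA normrM.
have h : 0 <= A * (K ^+ 2) ^+ n by rewrite mulr_ge0// exprn_ge0// sqr_ge0.
by rewrite (ger0_norm h); apply: ler_wpM2l => //; exact: spline_le.
Qed.

Lemma periodize_periodic1 (f : nat -> R -> R) n : periodic1 (periodize f n).
Proof. by move=> t; rewrite /periodize fpartD1. Qed.

Lemma fpart_01 t : 0 <= t <= 1 -> fpart t = t \/ (t = 1 /\ fpart t = 0).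
Proof.
move=> /andP[t0]; rewrite le_eqVlt => /predU1P[->|t1].
  by right; split=> //; rewrite -[in LHS](add0r 1) fpartD1 fpart_id// lexx ltr01.
by left; rewrite fpart_id// t0 t1.
Qed.

Lemma continuous_primitive_split (f : R -> R) (a b M : R) : continuous f ->
  0 <= a -> a <= b -> b <= 1 ->
  (forall t, 0 <= t <= a -> f t <= 0) -> (forall t, b <= t <= 1 -> f t <= 0) ->
  (forall t, a <= t <= b -> f t <= M) ->
  \int[mu]_(t in `[0, 1]) f t <= M * (b - a).
Proof.
move=> cf a0 ab b1 h1 h2 h3; have [F DF] := exists_primitive cf.
rewrite (Rintegral_derivative ler01 DF cf).
have := derivative_le DF a0 h1; have := derivative_le DF b1 h2.
have := derivative_le DF ab h3; rewrite !mul0r; lra.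
Qed.

Lemma continuous_primitive_ge (f : R -> R) (a b M : R) : continuous f ->
  0 <= a -> a <= b -> b <= 1 -> (forall t, 0 <= t <= 1 -> 0 <= f t) ->
  (forall t, a <= t <= b -> M <= f t) ->
  M * (b - a) <= \int[mu]_(t in `[0, 1]) f t.
Proof.
move=> cf a0 ab b1 h1 h3; have [F DF] := exists_primitive cf.
rewrite (Rintegral_derivative ler01 DF cf).
have ha t : 0 <= t <= a -> 0 <= f t by move=> /andP[? ?]; apply: h1; lra.
have hb t : b <= t <= 1 -> 0 <= f t by move=> /andP[? ?]; apply: h1; lra.
have := derivative_ge DF a0 ha; have := derivative_ge DF b1 hb.
have := derivative_ge DF ab h3; rewrite !mul0r; lra.
Qed.

Lemma exists_sheet K c : 12 <= K -> 0 <= c -> c + 4 / K ^+ 2 <= 7 / 8 -> 1 / 8 <= c ->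
  exists A h, sheet K (periodize (bump_profile K c A)) h.
Proof.
move=> K12 c0 c1 c2; have K0 : 0 < K by lra.
have K20 : 0 < K ^+ 2 by rewrite exprn_gt0.
have sb1 := spline_bound_ge1 R; have sb0 := spline_bound_gt0 R.
have k4 : 0 < 4 / K ^+ 2 by rewrite divr_gt0.
have vb A : vanish_ends 2 (bump_profile K c A).
  exists (1 / 8); first lra.
  move=> n u n2 [h|h]; apply: bump_zero => //; [left|right]; lra.
have jG A : jet 2 (periodize (bump_profile K c A)) := jet_periodize (bump_jet K c A) (vb A).
have pG A n : periodic1 (periodize (bump_profile K c A) n) := periodize_periodic1 _ _.
have zero A n t : (n <= 2)%N -> 0 <= t <= c \/ c + 4 / K ^+ 2 <= t <= 1 ->
    periodize (bump_profile K c A) n t = 0.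
  move=> n2 h; rewrite /periodize; apply: bump_zero => //.
  have t01 : 0 <= t <= 1 by move: h => [/andP[? ?]|/andP[? ?]]; lra.
  have [->|[_ ->]] := fpart_01 t01; last by left.
  by move: h => [/andP[_ h]|/andP[h _]]; [left|right].
have cG A n : (n <= 2)%N -> continuous (periodize (bump_profile K c A) n).
  by move=> n2; have [_] := jG A; exact.
pose g0 := periodize (bump_profile K c (K ^- 2)) 1.
have cg0 : continuous (fun t => g0 t ^+ 2).
  move=> t; apply: (@continuous_comp _ _ _ g0 (fun s => s ^+ 2)); last exact: exprn_continuous.
  exact: cG.
pose J := \int[mu]_(t in `[0, 1]) g0 t ^+ 2.
have kinv : K ^- 2 * K ^+ 2 = 1 by rewrite mulVf// gt_eqF.
(* On the right half of [c, c + K^-2] the unnormalized profile is v^2/2 with v >= 1/2, so its square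
   is at least 1/64 there. Hence J >= K^-2/128, and the normalization kap is at most 12 K because
   128 <= 12^2. *)
have J_ge : 1 / 64 * (1 / 2 * K ^- 2) <= J.
  have -> : 1 / 2 * K ^- 2 = (c + K ^- 2) - (c + 1 / 2 * K ^- 2) :> R by lra.
  have k1 : 0 < K ^- 2 by rewrite invr_gt0.
  apply: continuous_primitive_ge => //; try lra.
    by move=> t _; exact: sqr_ge0.
  move=> t /andP[h1 h2]; rewrite /g0 /periodize fpart_id; last by apply/andP; split; lra.
  rewrite /bump_profile /jet_affine expr1 mulrA kinv mul1r.
  have v1 : 1 / 2 <= K ^+ 2 * t + - (K ^+ 2 * c) <= 1.
    rewrite -mulrBr; apply/andP; split.
      rewrite -(ler_pM2l k1) [X in _ <= X]mulrA kinv mul1r; lra.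
    rewrite -(ler_pM2l k1) [X in X <= _]mulrA kinv mul1r; lra.
  move: v1; set v := _ + _ => /andP[v1 v2].
  rewrite spline2_01; last by apply/andP; split; lra.
  have : 1 / 4 <= v ^+ 2.
    have -> : 1 / 4 = (1 / 2) ^+ 2 :> R by rewrite expr2; lra.
    by rewrite lerXn2r ?nnegrE; lra.
  move: (v ^+ 2) => w w1; rewrite expr2; nra.
have J0 : 0 < J by apply: lt_le_trans J_ge; rewrite !mulr_gt0 ?invr_gt0//; lra.
pose kap := (Num.sqrt J)^-1.
have sJ0 : 0 < Num.sqrt J by rewrite sqrtr_gt0.
have kap0 : 0 < kap by rewrite invr_gt0.
have kap2 : kap ^+ 2 = J^-1 by rewrite exprVn sqr_sqrtr// ltW.
have kapK : kap <= 12 * K.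
  have K12' : 0 <= 12 * K by rewrite mulr_ge0// ltW.
  have -> // : (kap <= 12 * K) = (kap ^+ 2 <= (12 * K) ^+ 2).
    by rewrite ler_pXn2r ?nnegrE// ltW.
  rewrite kap2 exprMn -[J^-1]mul1r ler_pdivrMr//.
  have : 12 ^+ 2 * K ^+ 2 * (1 / 64 * (1 / 2 * K ^- 2)) = 144 / 128 :> R.
    by field; rewrite gt_eqF.
  have : 12 ^+ 2 * K ^+ 2 * (1 / 64 * (1 / 2 * K ^- 2)) <= 12 ^+ 2 * K ^+ 2 * J.
    by rewrite ler_wpM2l// mulr_ge0// ltW.
  by move=> h1 h2; apply: le_trans h1; rewrite h2; lra.
pose A := kap * K ^- 2; pose G := periodize (bump_profile K c A).
have A0 : 0 <= A by rewrite mulr_ge0 ?invr_ge0 ?ltW.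
have G1E t : G 1 t = kap * g0 t.
  by rewrite /G /g0 /periodize /bump_profile /A !mulrA.
have cG2 : continuous (fun t => G 1 t ^+ 2).
  move=> t; apply: (@continuous_comp _ _ _ (G 1) (fun s => s ^+ 2)); last exact: exprn_continuous.
  exact: cG.
have intG : \int[mu]_(t in `[0, 1]) (G 1 t ^+ 2) = 1.
  have [F DF] := exists_primitive cg0.
  have DG (t : R) : is_derive t 1 (fun t => kap ^+ 2 * F t) (G 1 t ^+ 2).
    by rewrite G1E exprMn; exact: is_deriveZl.
  rewrite (Rintegral_derivative ler01 DG cG2) -mulrBr.
  rewrite -(Rintegral_derivative ler01 DF cg0) -/J kap2 mulVf// gt_eqF//.
have [h0 [h1 [Dh0 Dh1 ph0 ph1 bh]]] := exists_corrector cG2 (fun t => congr1 (fun z => z ^+ 2) (pG A 1%N t))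
  (fun t => sqr_ge0 _) intG.
(* Orders 0 and 1 are the corrector; order 2 is the equation it solves and order 3 the derivative of
   that. *)
pose h (n : nat) : R -> R := match n with
  | 0 => h0 | 1 => h1 | 2 => fun t => G 1 t ^+ 2 - 1 | _ => fun t => 2 * G 1 t * G 2 t end.
have bG n t : (n <= 2)%N -> `|G n t| <= 12 * sb * K^-1 * (K ^+ 2) ^+ n.
  move=> n2; apply: (le_trans (bump_le _ _ _ A0 n2)).
  have -> : A * (K ^+ 2) ^+ n * sb = kap * (K ^- 2 * sb * (K ^+ 2) ^+ n) by rewrite /A; ring.
  apply: (@le_trans _ _ (12 * K * (K ^- 2 * sb * (K ^+ 2) ^+ n))).
    by apply: ler_wpM2r => //; rewrite !mulr_ge0 ?invr_ge0 ?exprn_ge0 ?sqr_ge0// ltW.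
  by rewrite le_eqVlt; apply/orP; left; apply/eqP; field; rewrite gt_eqF.
have Dh2 (t : R) : is_derive t 1 (fun s => G 1 s ^+ 2 - 1) (2 * G 1 t * G 2 t).
  have [/(_ 1%N t isT) D _] : jet 2 G := jG A.
  have D' : is_derive t 1 (fun s => G 1 s * G 1 s - 1) (G 2 t * G 1 t + G 1 t * G 2 t - 0).
    exact: (is_deriveBl (is_deriveMl D D) (is_derive_cst (1 : R) t 1)).
  rewrite (_ : (fun s => G 1 s ^+ 2 - 1) = (fun s => G 1 s * G 1 s - 1)); last first.
    by apply/funext => s; rewrite expr2.
  apply: (is_derive_eq D'); move: (G 1 t) (G 2 t) => a b; ring.
have C12 : 12 * sb <= profile_C.
  rewrite /profile_C expr2 mulrA ler_pM2r//; lra.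
exists A, h; split => //.
- split.
    by move=> [|[|[|]]].
  move=> [|[|[|[|]]]]// _ t.
  + exact: is_derive_continuous (Dh0 t).
  + exact: is_derive_continuous (Dh1 t).
  + by apply: cvgB; [exact: cG2|exact: cvg_cst].
  + apply: cvgM; last exact: cG.
    by apply: cvgM; [exact: cvg_cst|exact: cG].
- have pG' n t : G n (t + 1) = G n t := pG A n t.
  by move=> [|[|[|n]]]//= t; rewrite !pG'.
- move=> n t n2; apply: (le_trans (bG n t n2)).
  by rewrite -[12 * sb * _ * _]mulrA -[profile_C * _ * _]mulrA ler_pM2r ?mulr_gt0 ?invr_gt0 ?exprn_gt0.
- have C300 : 300 * sb ^+ 2 = profile_C by [].
  move: (bG 1%N) (bG 2%N) => b1 b2.
  have K1 : 1 <= K ^+ 2 by rewrite exprn_ege1//; lra.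
  have sb2 : 1 <= sb ^+ 2 by rewrite exprn_ege1.
  have C2 : 2 <= profile_C by rewrite -C300; lra.
  move=> [|[|[|[|]]]]// t _; rewrite [_.-1]/= ?expr0 ?mulr1 ?expr1.
  + by apply: le_trans C2; have [] := bh t.
  + by apply: le_trans C2; have [] := bh t.
  + rewrite /h; apply: (le_trans (ler_normB _ _)); rewrite normr1 normrX.
    have := b1 t isT; rewrite expr1 (_ : 12 * sb * K^-1 * K ^+ 2 = 12 * sb * K); last first.
      by field; rewrite gt_eqF.
    move=> b1t; have : `|G 1 t| ^+ 2 <= (12 * sb * K) ^+ 2.
      by rewrite lerXn2r ?nnegrE// !mulr_ge0// ltW.
    have -> : (12 * sb * K) ^+ 2 = 144 * (sb ^+ 2 * K ^+ 2) by move: sb => b; ring.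
    rewrite -C300 -[300 * _ * _]mulrA; have : 1 <= sb ^+ 2 * K ^+ 2 by rewrite mulr_ege1// exprn_ege1.
    move: (sb ^+ 2 * K ^+ 2) (`|G 1 t| ^+ 2) => p z; lra.
  + rewrite /h normrM normrM ger0_norm//.
    have := b1 t isT; have := b2 t isT; rewrite expr1.
    rewrite (_ : 12 * sb * K^-1 * K ^+ 2 = 12 * sb * K); last by field; rewrite gt_eqF.
    rewrite (_ : 12 * sb * K^-1 * (K ^+ 2) ^+ 2 = 12 * sb * K ^+ 3); last by field; rewrite gt_eqF.
    move=> g2 g1; have H : `|G 1 t| * `|G 2 t| <= (12 * sb * K) * (12 * sb * K ^+ 3) by rewrite ler_pM.
    have E : (12 * sb * K) * (12 * sb * K ^+ 3) = 144 * (sb ^+ 2 * (K ^+ 2) ^+ 2) by move: sb => b; ring.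
    have P : 0 <= sb ^+ 2 * (K ^+ 2) ^+ 2 by rewrite mulr_ge0// sqr_ge0.
    rewrite E in H; rewrite -mulrA -C300 -[300 * _ * _]mulrA; move: H P.
    by move: (`|G 1 t| * _) (sb ^+ 2 * _) => x y; lra.
- have cGn : continuous (fun t => `|G 1 t|).
    move=> t; apply: (@continuous_comp _ _ _ (G 1) (fun s : R => `|s|)); first exact: cG.
    exact: norm_continuous.
  apply: (@le_trans _ _ (12 * sb * K * ((c + 4 / K ^+ 2) - c))).
    apply: continuous_primitive_split => //; try lra.
    + by move=> t t0; rewrite zero ?normr0//; left.
    + by move=> t t0; rewrite zero ?normr0//; right.
    + move=> t _; have := bG 1%N t isT; rewrite expr1.
      by rewrite (_ : 12 * sb * K^-1 * K ^+ 2 = 12 * sb * K)//; field; rewrite gt_eqF.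
  rewrite addrC addKr (_ : 12 * sb * K * (4 / K ^+ 2) = 48 * sb * K^-1); last first.
    by field; rewrite gt_eqF.
  rewrite ler_pM2r ?invr_gt0// /profile_C expr2 mulrA ler_pM2r//; lra.
Qed.

Definition disjoint_profiles (G G' : nat -> R -> R) :=
  forall m n t, (m <= 2)%N -> (n <= 2)%N -> G m t * G' n t = 0.

(** The bumps start at 1/8 and 5/8 and have width 4/K^2 <= 1/8. Disjointness is essential for two
    waves oscillating in the same variable, whose product gains nothing from Fubini. *)
Lemma exists_sheet_pair K : 12 <= K -> exists Gp hp Gm hm,
  [/\ sheet K Gp hp, sheet K Gm hm & disjoint_profiles Gp Gm].
Proof.
move=> K12; have K0 : 0 < K by lra.
have k4 : 4 / K ^+ 2 <= 1 / 8.
  rewrite ler_pdivrMr ?exprn_gt0// expr2.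
  have : 12 * 12 <= K * K by rewrite ler_pM//; lra.
  lra.
have k40 : 0 <= 4 / K ^+ 2 by rewrite divr_ge0// sqr_ge0.
have [|||Ap [hp Sp]] := @exists_sheet K (1 / 8) K12; try lra.
have [|||Am [hm Sm]] := @exists_sheet K (5 / 8) K12; try lra.
exists (periodize (bump_profile K (1 / 8) Ap)), hp, (periodize (bump_profile K (5 / 8) Am)), hm.
split=> // m n t m2 n2; rewrite /periodize.
have [h|h] := leP (1 / 8 + 4 / K ^+ 2) (fpart t).
  by rewrite bump_zero ?mul0r//; right.
by rewrite [X in _ * X]bump_zero ?mulr0//; left; lra.
Qed.

(** The defect is at most 5 sb^2 and is carried by two layers of length 5/K, hence the factor 50. *)
Lemma cutoff_defect K : 12 <= K -> exists2 f : R -> R,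
  [/\ continuous f, periodic1 f, forall t, 0 <= f t &
      forall t, `|1 - cutoff K 0 (fpart t) ^+ 2| = f t] &
  \int[mu]_(t in `[0, 1]) f t <= 50 * sb ^+ 2 / K.
Proof.
move=> K12; have K0 : 0 < K by lra.
pose Y := periodize (cutoff K) 0.
have cY : continuous Y.
  by have [_] := jet_periodize (cutoff_jet K) (cutoff_vanish K12); apply.
pose f t := `|1 - Y t ^+ 2|.
have cf : continuous f.
  move=> t; apply: (@continuous_comp _ _ _ (fun t => 1 - Y t ^+ 2) (fun s : R => `|s|)); last exact: norm_continuous.
  apply: cvgB; first exact: cvg_cst.
  by apply: (@continuous_comp _ _ _ Y (fun s => s ^+ 2)); [exact: cY|exact: exprn_continuous].
have pY : periodic1 Y := periodize_periodic1 _ _.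
exists f; first by split=> // [t|t]; [rewrite /f pY|exact: normr_ge0].
have sb1 : 1 <= sb ^+ 2 by rewrite exprn_ege1// spline_bound_ge1.
have fM t : f t <= 5 * sb ^+ 2.
  rewrite /f (le_trans (ler_normB _ _))// normr1 normrX.
  have h := @cutoff_bound K (ltW K0) 0%N (fpart t) isT; rewrite expr0 mulr1 in h.
  have : `|Y t| ^+ 2 <= (2 * sb) ^+ 2.
    by rewrite lerXn2r ?nnegrE// mulr_ge0// ltW// spline_bound_gt0.
  have -> : (2 * sb) ^+ 2 = 4 * sb ^+ 2 by move: sb => b; ring.
  move: (`|Y t| ^+ 2) (sb ^+ 2) sb1 => x y y1; lra.
have f0 t : 5 / K <= t <= 1 - 5 / K -> f t <= 0.
  move=> h; rewrite /f /Y /periodize fpart_id.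
    by rewrite cutoff_plateau// expr1n subrr normr0.
  have k5 : 0 < 5 / K by rewrite divr_gt0.
  by move: h => /andP[? ?]; apply/andP; split; lra.
have [F DF] := exists_primitive cf.
rewrite (Rintegral_derivative ler01 DF cf).
have k5 : 0 < 5 / K by rewrite divr_gt0.
have k5' : 5 / K <= 5 / 12 by rewrite ler_pM2l ?ltr0n// lef_pV2 ?posrE ?ltr0n.
have h1 := derivative_le DF (ltW k5) (fun t _ => fM t).
have h2 : 5 / K <= 1 - 5 / K by lra.
have {}h2 := derivative_le DF h2 f0.
have h3 : 1 - 5 / K <= 1 by lra.
have {}h3 := derivative_le DF h3 (fun t _ => fM t).
have -> : 50 * sb ^+ 2 / K = 5 * sb ^+ 2 * (5 / K) + 5 * sb ^+ 2 * (5 / K) by field; rewrite gt_eqF.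
move: h1 h2 h3; rewrite mul0r; move: (5 / K) (5 * sb ^+ 2) => x y.
have -> : y * (1 - (1 - x)) = y * x by ring.
rewrite subr0; lra.
Qed.

End Profiles.

(** * Cellwise products *)

Section StepProducts.
Context (R : realType).
Implicit Types (x : space3 R) (c : ('I_3 -> int) -> R) (f : 'I_3 -> nat -> R -> R).
Implicit Types (al : 'I_3 -> nat) (N m : nat).
Local Notation e_ := (@unit_vector R).

Definition cell N x : 'I_3 -> int := fun j => Num.floor (N%:R * co j x).

(* c is constant on the cells of side 1/N; the multi-index al says how often each factor is differentiated *)
Definition step_prod N c f al x : R :=
  c (cell N x) * \prod_j f j (al j) (fpart (N%:R * co j x)).

(** A point near [x0] may lie in another cell, where [c] is different, but then some factor vanishes
    both there and in the formula continued from the cell of [x0]. Locally the coefficient may thus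
    be treated as constant. *)
Lemma step_prod_near N m c f al x0 :
  (forall j, vanish_ends m (f j)) -> (forall j, (al j <= m)%N) ->
  \forall x \near x0, c (cell N x0) *
    \prod_j f j (al j) (N%:R * co j x - (cell N x0 j)%:~R) = step_prod N c f al x.
Proof.
move=> v am.
have P j : \forall x \near x0, cell N x j = cell N x0 j \/
    (f j (al j) (fpart (N%:R * co j x)) = 0 /\
     f j (al j) (N%:R * co j x - (cell N x0 j)%:~R) = 0).
  have [e e0 He] := v j.
  have cc : {for x0, continuous (fun x => N%:R * co j x)}.
    by apply: cvgM; [exact: cvg_cst|exact: continuous_co].
  have := cc _ (floor_near (N%:R * co j x0) e0).
  rewrite /nbhs /=; apply: filterS => x /= [E|[h1 h2]]; first by left.
  by right; rewrite !He//; [left|right].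
near=> x.
have Px j : cell N x j = cell N x0 j \/
    (f j (al j) (fpart (N%:R * co j x)) = 0 /\
     f j (al j) (N%:R * co j x - (cell N x0 j)%:~R) = 0).
  by elim/ord3_ind: j; near: x; exact: P.
rewrite /step_prod.
have [E|] := pselect (forall j, cell N x j = cell N x0 j).
  rewrite (_ : cell N x = cell N x0); last exact/funext.
  by congr (_ * _); apply: eq_bigr => j _; rewrite /fpart -[Num.floor _]/(cell N x j) E.
move=> /existsNP[j hj]; have [//|[z1 z2]] := Px j.
by rewrite [in LHS](bigD1 j)// [in RHS](bigD1 j)//= z1 z2 !mul0r !mulr0.
Unshelve. all: by end_near. Qed.

Lemma step_prod_C1 N m c f al :
  (forall j, jet m (f j)) -> (forall j, vanish_ends m (f j)) -> (forall j, (al j < m)%N) ->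
  C1 (step_prod N c f al)
     (fun i x => N%:R * step_prod N c f (fun j => (al j + (i == j))%N) x).
Proof.
move=> J v am.
have cont be : (forall j, (be j <= m)%N) -> continuous (step_prod N c f be).
  move=> bm x0; rewrite /continuous_at.
  have near0 := step_prod_near N c x0 v bm.
  rewrite -(nbhs_singleton near0).
  set g := fun x => c (cell N x0) * \prod_j f j (be j) (N%:R * co j x - (cell N x0 j)%:~R).
  have cg : {for x0, continuous g}.
    have cj j : {for x0, continuous (fun x => f j (be j) (N%:R * co j x - (cell N x0 j)%:~R))}.
      apply: (@continuous_comp _ _ _ (fun x => N%:R * co j x - (cell N x0 j)%:~R) (f j (be j))).
        by apply: cvgB; [apply: cvgM; [exact: cvg_cst|exact: continuous_co]|exact: cvg_cst].
      by have [_] := J j; apply.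
    rewrite (_ : g = fun x => c (cell N x0) * (f 0 (be 0) (N%:R * co 0 x - (cell N x0 0)%:~R) *
       f 1 (be 1) (N%:R * co 1 x - (cell N x0 1)%:~R) * f 2 (be 2) (N%:R * co 2 x - (cell N x0 2)%:~R))).
      by apply: cvgM; [exact: cvg_cst|apply: cvgM; [apply: cvgM|]; exact: cj].
    by apply/funext => x; rewrite /g prod3.
  by apply: cvg_trans cg; exact: near_eq_cvg.
split; first by apply: cont => j; exact: ltnW.
move=> i; have bm j : (al j + (i == j) <= m)%N.
  apply: leq_trans (am j); move: (i == j) (al j) => b k.
  by case: b; rewrite ?addn1 ?addn0.
split.
  by move=> x; apply: cvgM; [exact: cvg_cst|exact: cont].
move=> x0; apply: (near_eq_is_derive (step_prod_near N c x0 v (fun j => ltnW (am j)))).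
apply/is_derive_line0.
have E (h : R) : c (cell N x0) * \prod_j f j (al j) (N%:R * co j (h *: e_ i + x0) - (cell N x0 j)%:~R) =
  (c (cell N x0) * \prod_(j | j != i) f j (al j) (fpart (N%:R * co j x0))) *
   f i (al i) (N%:R * h + fpart (N%:R * co i x0)).
  rewrite (bigD1 i)//= co_line eqxx mulr1 -mulrA [X in _ = _ * X]mulrC; congr (_ * (_ * _)).
    by congr (f i _ _); rewrite /fpart /cell; ring.
  apply: eq_bigr => j ji; rewrite co_line eq_sym (negbTE ji) mulr0 addr0//.
under eq_fun do rewrite E.
have [D _] := J i.
have := is_deriveZl (c (cell N x0) * \prod_(j | j != i) f j (al j) (fpart (N%:R * co j x0)))
  (@is_derive_affine R (f i (al i)) 0 N%:R (fpart (N%:R * co i x0)) _ (D (al i) _ (am i))).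
rewrite mulr0 add0r; congr is_derive.
rewrite /step_prod [in RHS](bigD1 i)//= eqxx addn1.
rewrite [in RHS](eq_bigr (fun j => f j (al j) (fpart (N%:R * co j x0)))); first by ring.
by move=> j ji; rewrite eq_sym (negbTE ji) addn0.
Qed.

Definition cell_periodic N c := forall i n, c (fun j => n j + (N%:Z * (i == j)%:R)) = c n.

Lemma step_prod_periodic N c f al : cell_periodic N c -> torus_periodic (step_prod N c f al).
Proof.
move=> pc i x; rewrite /step_prod.
have E j : N%:R * co j (x + e_ i) = N%:R * co j x + (N%:Z * (i == j)%:R)%:~R.
  by rewrite coD co_unit mulrDr intrM; congr (_ + _ * _); case: (i == j).
have -> : cell N (x + e_ i) = fun j => cell N x j + (N%:Z * (i == j)%:R).
  apply/funext => j; rewrite /cell E.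
  apply/eqP; rewrite floor_eq addrAC !intrD lerD2r ltrD2r ge_floor /=.
  by have := floorD1_gt (N%:R * co j x); rewrite intrD.
rewrite pc; congr (_ * _); apply: eq_bigr => j _.
by rewrite E fpartDz.
Qed.

Lemma prod_not_i (i : 'I_3) (Q : R) : \prod_(j < 3 | j != i) Q = Q ^+ 2.
Proof. by rewrite prodr_const; congr (_ ^+ _); elim/ord3_ind: i; rewrite cardC1 card_ord. Qed.

(** [i] is the direction of oscillation and has its own bound [V]; the other two directions see
    cutoffs only, with geometric bounds. *)
Lemma step_prod_bound i N m c f al (Kc Q b : R) (V : nat -> R) x :
  0 <= Q -> 0 <= b ->
  (forall n, `|c n| <= Kc) -> (forall n t, (n <= m)%N -> `|f i n t| <= V n) ->
  (forall j n t, j != i -> (n <= m)%N -> `|f j n t| <= Q * b ^+ n) ->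
  (forall j, (al j <= m)%N) ->
  `|step_prod N c f al x| <= Kc * (V (al i) * (Q ^+ 2 * b ^+ (\sum_(j | j != i) al j))).
Proof.
move=> Q0 b0 cK fV fQ am; rewrite /step_prod normrM ler_pM// normr_prod (bigD1 i)//=.
rewrite ler_pM ?fV ?prodr_ge0//.
rewrite -(prod_not_i i) expr_sum -big_split /=.
by apply: ler_prod => j ji; rewrite normr_ge0 fQ.
Qed.

End StepProducts.

(** * Waves *)

Section Wave.
Context (R : realType) (K N : nat) (G h : nat -> R -> R).
Hypotheses (K12 : (12 <= K)%N) (N0 : (0 < N)%N) (sheetGh : sheet K%:R G h).
Local Notation k := (K%:R : R).
Local Notation B := (2 * spline_bound R).
Local Notation Cp := (profile_C R).

(** One constant for all bounds below: the product of three squared cutoffs gives the power 6, the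
    profile gives the last factor. *)
Definition wave_const : R := 64 * B ^+ 6 * Cp.

Let k12 : 12 <= k. Proof. by rewrite ler_nat. Qed.
Let k0 : 0 < k. Proof. exact: lt_le_trans k12. Qed.
Let k1 : 1 <= k. Proof. by apply: le_trans k12; rewrite ler1n. Qed.
Let B1 : 1 <= B. Proof. have := spline_bound_ge1 R; lra. Qed.
Let B0 : 0 < B. Proof. exact: lt_le_trans B1. Qed.
Let Cp1 : 1 <= Cp. Proof. exact: profile_C_ge1. Qed.
Let Cp0 : 0 < Cp. Proof. exact: lt_le_trans Cp1. Qed.

Let X := cutoff k.
Definition cutoff2 : nat -> R -> R := jet_mul (cutoff k) (cutoff k).
Let X2 := cutoff2.

Let X2_bound : jet_bound 3 X2 (B * B) (k + k).
Proof. by apply: jet_mul_bound => //; rewrite ?(ltW B0) ?(ltW k0)//; exact/cutoff_bound/ltW. Qed.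

Let h_bound n t : (n <= 3)%N -> `|jet_affine (k ^+ 2) 0 h n t| <= Cp * ((k ^+ 2) ^+ n * (k ^+ 2) ^+ n.-1).
Proof.
move=> n3; rewrite /jet_affine normrM ger0_norm ?exprn_ge0 ?sqr_ge0//.
by rewrite mulrCA ler_wpM2l ?exprn_ge0 ?sqr_ge0//; exact: (sheet_boundh sheetGh).
Qed.

Let G_bound : jet_bound 2 (jet_affine (k ^+ 2) 0 G) (Cp * k^-1) (k ^+ 4).
Proof.
move=> n t n2; rewrite /jet_affine normrM ger0_norm ?exprn_ge0 ?sqr_ge0//.
have -> : Cp * k^-1 * (k ^+ 4) ^+ n = (k ^+ 2) ^+ n * (Cp * k^-1 * (k ^+ 2) ^+ n).
  rewrite (_ : k ^+ 4 = k ^+ 2 * k ^+ 2); last by rewrite -exprD.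
  by rewrite exprMn; move: ((k ^+ 2) ^+ n) => z; ring.
by rewrite ler_wpM2l ?exprn_ge0 ?sqr_ge0//; exact: (sheet_boundG sheetGh).
Qed.

(** In direction [i] the profile has K^2 periods per cell. [stress_factors] uses squared cutoffs,
    because the stress has to match the square of the wave. *)
Definition wave_factors (i j : 'I_3) : nat -> R -> R :=
  if j == i then jet_mul (cutoff k) (jet_affine (k ^+ 2) 0 G) else cutoff k.
Definition stress_factors (i j : 'I_3) : nat -> R -> R :=
  if j == i then jet_mul cutoff2 (jet_affine (k ^+ 2) 0 h) else cutoff2.

Let k4 : k <= k ^+ 4.
Proof. by rewrite -[X in X <= _]expr1 ler_weXn2l. Qed.

Let wave_factor_bound i n t : (n <= 2)%N ->
  `|wave_factors i i n t| <= B * (Cp * k^-1) * (2 * k ^+ 4) ^+ n.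
Proof.
move=> n2; rewrite /wave_factors eqxx.
have h0 : 0 <= Cp * k^-1 by rewrite mulr_ge0 ?invr_ge0 ?ltW.
have kk : 0 <= k ^+ 4 by rewrite exprn_ge0 ?ltW.
have XB : jet_bound 2 X B k by move=> m s m2; apply: cutoff_bound; [exact: ltW|exact: leq_trans m2 _].
apply: (le_trans (jet_mul_bound (ltW B0) h0 (ltW k0) kk XB G_bound t n2)).
apply: ler_wpM2l; first exact: mulr_ge0 (ltW B0) h0.
have kk1 : 0 <= k ^+ 4 + k by rewrite addr_ge0// ltW.
have kk2 : 0 <= 2 * k ^+ 4 by rewrite mulr_ge0.
by apply: lerXn2r; rewrite ?nnegrE// mulrDl mul1r lerD2l.
Qed.

(** The exponent is 2n + 2(n - 1) for n >= 1: every derivative costs K^2 by rescaling, and every one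
    after the first costs K^2 more through the growth of [h]. *)
Definition stress_weight (n : nat) : R := match n with
  | 0 => 1 | 1 => k ^+ 2 | 2 => k ^+ 6 | _ => k ^+ 10 end.

Let stress_factor_bound i n t : (n <= 3)%N ->
  `|stress_factors i i n t| <= 4 * (B ^+ 2 * Cp) * stress_weight n.
Proof.
move=> n3; rewrite /stress_factors eqxx /jet_mul.
have H l m : (l <= 3)%N -> (m <= 3)%N -> `|X2 l t * jet_affine (k ^+ 2) 0 h m t| <=
   B ^+ 2 * Cp * ((k + k) ^+ l * ((k ^+ 2) ^+ m * (k ^+ 2) ^+ m.-1)).
  move=> l3 m3; have := ler_pM (normr_ge0 _) (normr_ge0 _) (X2_bound t l3) (h_bound t m3).
  by rewrite -normrM; congr (_ <= _); ring.
have P0 : 0 <= B ^+ 2 * Cp by rewrite mulr_ge0 ?exprn_ge0 ?ltW.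
set P := B ^+ 2 * Cp in H P0 *.
apply: (le_trans (ler_norm_sum _ _ _)).
apply: (@le_trans _ _ (\sum_(l < n.+1) P * ('C(n, l)%:R *
    ((k + k) ^+ l * ((k ^+ 2) ^+ (n - l) * (k ^+ 2) ^+ (n - l).-1))))).
  apply: ler_sum => l _; rewrite normrM ger0_norm ?ler0n// [X in _ <= X]mulrCA; apply: ler_wpM2l; first exact: ler0n.
  apply: H; first by apply: leq_trans n3; rewrite -ltnS.
  by apply: leq_trans n3; exact: leq_subr.
rewrite -mulr_sumr [4 * P]mulrC -[P * 4 * _]mulrA; apply: ler_wpM2l => //.
have kp a : 12 * k ^+ a <= k ^+ a.+1 by rewrite exprS ler_wpM2r// exprn_ge0// ltW.
have kk a : 0 < k ^+ a by rewrite exprn_gt0.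
case: n n3 => [|[|[|[|n]]]]// _; rewrite !big_ord_recl big_ord0 /= /bump /= ?addn0 ?bin0 ?bin1 ?binn ?addr0 ?mul1r ?mulr1 ?expr0 ?subn0 ?expr1.
- lra.
- have := kp 1%N; have := kk 1%N; rewrite expr1; lra.
- have -> : (k ^+ 2) ^+ 2 * k ^+ 2 + (2 * ((k + k) * k ^+ 2) + (k + k) ^+ 2) = k ^+ 6 + (4 * k ^+ 3 + 4 * k ^+ 2) by ring.
  have := kp 2%N; have := kp 3%N; have := kp 4%N; have := kp 5%N.
  have := kk 2%N; have := kk 3%N; have := kk 4%N; have := kk 5%N.
  move: (k ^+ 2) (k ^+ 3) (k ^+ 4) (k ^+ 5) (k ^+ 6) => x2 x3 x4 x5 x6; lra.
- rewrite (_ : 'C(3, 2) = 3%N)//.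
  have -> : (k ^+ 2) ^+ 3 * (k ^+ 2) ^+ 2 + (3 * ((k + k) * ((k ^+ 2) ^+ 2 * k ^+ 2)) + (3 * ((k + k) ^+ 2 * k ^+ 2) + (k + k) ^+ 3))
     = k ^+ 10 + (6 * k ^+ 7 + (12 * k ^+ 4 + 8 * k ^+ 3)) by ring.
  have := kp 3%N; have := kp 4%N; have := kp 5%N; have := kp 6%N; have := kp 7%N; have := kp 8%N; have := kp 9%N.
  have := kk 3%N; have := kk 4%N; have := kk 5%N; have := kk 6%N; have := kk 7%N; have := kk 8%N; have := kk 9%N.
  move: (k ^+ 3) (k ^+ 4) (k ^+ 5) (k ^+ 6) (k ^+ 7) (k ^+ 8) (k ^+ 9) (k ^+ 10) => x3 x4 x5 x6 x7 x8 x9 x10; lra.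
Qed.

Let X_vanish : vanish_ends 3 X. Proof. exact: cutoff_vanish. Qed.
Let X2_jet : jet 3 X2. Proof. exact: (jet_mulP (leqnn 3) (cutoff_jet k) (cutoff_jet k)). Qed.
Let X2_vanish : vanish_ends 3 X2. Proof. exact: (vanish_jet_mul _ X_vanish). Qed.

Lemma wave_factors_jet i j : jet 2 (wave_factors i j).
Proof.
rewrite /wave_factors; case: ifP => _; last exact: jet_le (cutoff_jet k).
have J := jet_le (isT : (2 <= 3)%N) (cutoff_jet k).
exact: (jet_mulP (isT : (2 <= 3)%N) J (jet_affineP _ _ (sheet_jetG sheetGh))).
Qed.

Lemma vanish_ends_le m m' (f : nat -> R -> R) : (m' <= m)%N -> vanish_ends m f -> vanish_ends m' f.
Proof. by move=> mm [e e0 H]; exists e => // n u nm; apply: H; exact: leq_trans nm mm. Qed.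

Lemma wave_factors_vanish i j : vanish_ends 2 (wave_factors i j).
Proof.
have v := vanish_ends_le (isT : (2 <= 3)%N) X_vanish.
by rewrite /wave_factors; case: ifP => _; [exact: (vanish_jet_mul _ v)|exact: v].
Qed.

Lemma stress_factors_jet i j : jet 3 (stress_factors i j).
Proof.
rewrite /stress_factors; case: ifP => _; last exact: X2_jet.
exact: (jet_mulP (leqnn 3) X2_jet (jet_affineP _ _ (sheet_jeth sheetGh))).
Qed.

Lemma stress_factors_vanish i j : vanish_ends 3 (stress_factors i j).
Proof. by rewrite /stress_factors; case: ifP => _; [exact: (vanish_jet_mul _ X2_vanish)|exact: X2_vanish]. Qed.

Section Potential.
Variables (i : 'I_3) (c : ('I_3 -> int) -> R) (sig : R).
Hypotheses (c0 : forall n, 0 <= c n) (sig0 : 0 <= sig) (csig : forall n, c n <= sig ^+ 2).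
Hypothesis pc : cell_periodic N c.
Local Notation n_ := (N%:R : R).
Local Notation M := (k ^+ 2).

Let s n := Num.sqrt (c n).
Let s_le n : `|s n| <= sig.
Proof. by rewrite ger0_norm ?sqrtr_ge0// -(ger0_norm sig0) -sqrtr_sqr ler_sqrt// sqr_ge0. Qed.
Let ps : cell_periodic N s. Proof. by move=> j n; rewrite /s pc. Qed.

Let n0 : 0 < n_. Proof. by rewrite ltr0n. Qed.
Let M0 : 0 < M. Proof. by rewrite exprn_gt0. Qed.

Definition mi0 (j : 'I_3) := 0%N.
Definition mi1 (a j : 'I_3) : nat := (a == j)%N.
Definition mi2 (a b j : 'I_3) : nat := ((a == j) + (b == j))%N.
Definition mi3 (a b d j : 'I_3) : nat := ((a == j) + (b == j) + (d == j))%N.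

(** The prefactors compensate the derivatives that fall on the oscillation, of frequency N K^2 in
    x_i: one derivative of [wave_pot] and two of [stress_pot] have a leading part without power of
    the frequency. *)
Definition wave_pot x := (n_ * M)^-1 * step_prod N s (wave_factors i) mi0 x.
Definition wave_dpot a x := M^-1 * step_prod N s (wave_factors i) (mi1 a) x.
Definition wave_ddpot a b x := M^-1 * (n_ * step_prod N s (wave_factors i) (mi2 a b) x).

Definition stress_pot x := (n_ * M)^-2 * step_prod N c (stress_factors i) mi0 x.
Definition stress_dpot a x := (n_ * M ^+ 2)^-1 * step_prod N c (stress_factors i) (mi1 a) x.
Definition stress_ddpot a b x := M^-2 * step_prod N c (stress_factors i) (mi2 a b) x.
Definition stress_dddpot a b d x := M^-2 * (n_ * step_prod N c (stress_factors i) (mi3 a b d) x).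

Lemma wave_pot_C1 : C1 wave_pot wave_dpot.
Proof.
have := C1Z (n_ * M)^-1 (step_prod_C1 N s (al := mi0) (wave_factors_jet i) (wave_factors_vanish i) (fun j => isT)).
congr C1; apply/funext => a; apply/funext => x; rewrite /wave_dpot /mi1 /mi0.
by rewrite invfM mulrACA mulVf ?gt_eqF// mul1r.
Qed.

Lemma wave_dpot_C1 a : C1 (wave_dpot a) (wave_ddpot a).
Proof.
have m2 j : (mi1 a j < 2)%N by rewrite /mi1; case: (a == j).
exact: (C1Z M^-1 (step_prod_C1 N s (wave_factors_jet i) (wave_factors_vanish i) m2)).
Qed.

Lemma stress_pot_C1 : C1 stress_pot stress_dpot.
Proof.
have := C1Z ((n_ * M)^-2) (step_prod_C1 N c (al := mi0) (stress_factors_jet i) (stress_factors_vanish i) (fun j => isT)).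
congr C1; apply/funext => a; apply/funext => x; rewrite /stress_dpot /mi1 /mi0 mulrA; congr (_ * _).
by field; rewrite !gt_eqF.
Qed.

Lemma stress_dpot_C1 a : C1 (stress_dpot a) (stress_ddpot a).
Proof.
have m2 j : (mi1 a j < 3)%N by rewrite /mi1; case: (a == j).
have := C1Z ((n_ * M ^+ 2)^-1) (step_prod_C1 N c (stress_factors_jet i) (stress_factors_vanish i) m2).
congr C1; apply/funext => b; apply/funext => x; rewrite /stress_ddpot /mi2 /mi1 mulrA; congr (_ * _).
by field; rewrite !gt_eqF.
Qed.

Lemma stress_ddpot_C1 a b : C1 (stress_ddpot a b) (stress_dddpot a b).
Proof.
have m2 j : (mi2 a b j < 3)%N by rewrite /mi2; case: (a == j); case: (b == j).
exact: (C1Z (M^-2) (step_prod_C1 N c (stress_factors_jet i) (stress_factors_vanish i) m2)).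
Qed.

Lemma wave_pot_periodic : torus_periodic wave_pot.
Proof. exact/periodicZ/step_prod_periodic. Qed.
Lemma wave_dpot_periodic a : torus_periodic (wave_dpot a).
Proof. exact/periodicZ/step_prod_periodic. Qed.
Lemma stress_pot_periodic : torus_periodic stress_pot.
Proof. exact/periodicZ/step_prod_periodic. Qed.
Lemma stress_dpot_periodic a : torus_periodic (stress_dpot a).
Proof. exact/periodicZ/step_prod_periodic. Qed.
Lemma stress_ddpot_periodic a b : torus_periodic (stress_ddpot a b).
Proof. exact/periodicZ/step_prod_periodic. Qed.

Lemma sum_mi1 (a j0 : 'I_3) : (\sum_(j | j != j0) (a == j))%N = (a != j0).
Proof.
case: eqVneq => [->|aj] /=.
  by rewrite big1// => j jj; rewrite eq_sym (negbTE jj).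
rewrite (bigD1 a)//= eqxx big1// => j /andP[_ ja].
by rewrite eq_sym (negbTE ja).
Qed.

Let W1 : 64 * (B ^+ 3 * Cp) <= wave_const.
Proof.
rewrite /wave_const -mulrA ler_wpM2l// ler_wpM2r ?(ltW Cp0)//.
by rewrite ler_weXn2l.
Qed.

Let W2 : 64 * (B ^+ 6 * Cp) = wave_const. Proof. by rewrite /wave_const mulrA. Qed.

Let kX a : 0 < k ^+ a. Proof. by rewrite exprn_gt0. Qed.
Let P3 : 0 <= B ^+ 3 * Cp. Proof. by rewrite mulr_ge0 ?exprn_ge0 ?ltW. Qed.
Let P6 : 0 <= B ^+ 6 * Cp. Proof. by rewrite mulr_ge0 ?exprn_ge0 ?ltW. Qed.

Let wave_step_bound al x : (forall j, (al j <= 2)%N) ->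
  `|step_prod N s (wave_factors i) al x| <=
  sig * ((B * (Cp * k^-1) * (2 * k ^+ 4) ^+ al i) * (B ^+ 2 * k ^+ (\sum_(j | j != i) al j))).
Proof.
move=> al2; apply: (@step_prod_bound R i N 2 s (wave_factors i) al sig B k (fun n => B * (Cp * k^-1) * (2 * k ^+ 4) ^+ n) x) => //.
- exact: ltW.
- by move=> n t; exact: wave_factor_bound.
- move=> j n t ji n2; rewrite /wave_factors (negbTE ji).
  by apply: cutoff_bound; [exact: ltW|exact: leq_trans n2 _].
Qed.

Let stress_step_bound al x : (forall j, (al j <= 3)%N) ->
  `|step_prod N c (stress_factors i) al x| <=
  sig ^+ 2 * ((4 * (B ^+ 2 * Cp) * stress_weight (al i)) * ((B * B) ^+ 2 * (k + k) ^+ (\sum_(j | j != i) al j))).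
Proof.
move=> al3; apply: (@step_prod_bound R i N 3 c (stress_factors i) al (sig ^+ 2) (B * B) (k + k) (fun n => 4 * (B ^+ 2 * Cp) * stress_weight n) x) => //.
- by rewrite mulr_ge0// ltW.
- by move=> n; rewrite ger0_norm.
- by move=> n t; exact: stress_factor_bound.
- by move=> j n t ji n3; rewrite /stress_factors (negbTE ji); exact: X2_bound.
Qed.

Lemma wave_dpot_bound a x : `|wave_dpot a x| <= wave_const * (sig * k).
Proof.
rewrite /wave_dpot normrM (ger0_norm (ltW _)) ?invr_gt0//.
rewrite ler_pdivrMl//; apply: (le_trans (wave_step_bound _ _)).
  by move=> j; rewrite /mi1; case: (a == j).
rewrite /mi1 sum_mi1.
have -> : M * (wave_const * (sig * k)) = sig * (wave_const * k ^+ 3) by ring.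
apply: ler_wpM2l => //; apply: (@le_trans _ _ (64 * (B ^+ 3 * Cp) * k ^+ 3)); last first.
  by rewrite ler_wpM2r// ltW.
case: (a == i); rewrite /= ?expr1 ?expr0 ?mulr1.
  have -> : B * (Cp / k) * (2 * k ^+ 4) * B ^+ 2 = 2 * (B ^+ 3 * Cp) * k ^+ 3 by field; rewrite gt_eqF.
  apply: ler_wpM2r; first exact: ltW.
  by apply: ler_wpM2r => //; lra.
have -> : B * (Cp / k) * (B ^+ 2 * k) = B ^+ 3 * Cp by field; rewrite gt_eqF.
have : 1 <= k ^+ 3 by rewrite exprn_ege1.
move: (B ^+ 3 * Cp) (k ^+ 3) P3 => p q p0 q1; nra.
Qed.

Lemma wave_ddpot_bound a b x : `|wave_ddpot a b x| <= wave_const * (sig * k) * (n_ * k ^+ 4).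
Proof.
rewrite /wave_ddpot normrM (ger0_norm (ltW _)) ?invr_gt0//.
rewrite ler_pdivrMl// normrM (ger0_norm (ltW n0)).
have H : (forall j, (mi2 a b j <= 2)%N) by move=> j; rewrite /mi2; case: (a == j); case: (b == j).
apply: (le_trans (ler_wpM2l (ltW n0) (wave_step_bound x H))).
rewrite /mi2 big_split /= !sum_mi1.
have -> : M * (wave_const * (sig * k) * (n_ * k ^+ 4)) = n_ * (sig * (wave_const * k ^+ 7)) by ring.
apply: ler_wpM2l; first exact: ltW.
apply: ler_wpM2l => //; apply: (@le_trans _ _ (64 * (B ^+ 3 * Cp) * k ^+ 7)); last first.
  by rewrite ler_wpM2r// ltW.
have kk c1 c2 (r : R) : (c1 <= c2)%N -> 0 <= r -> r <= 64 -> r * (B ^+ 3 * Cp) * k ^+ c1 <= 64 * (B ^+ 3 * Cp) * k ^+ c2.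
  move=> cc r0 r64; apply: ler_pM; [exact: mulr_ge0|exact: ltW|exact: ler_wpM2r|exact: ler_weXn2l].
case: (a == i); case: (b == i) => /=; rewrite ?addn0 ?add0n ?expr1 ?expr0 ?mulr1.
- have -> : B * (Cp / k) * (2 * k ^+ 4) ^+ 2 * B ^+ 2 = 4 * (B ^+ 3 * Cp) * k ^+ 7 by field; rewrite gt_eqF.
  by apply: kk => //; lra.
- have -> : B * (Cp / k) * (2 * k ^+ 4) * (B ^+ 2 * k) = 2 * (B ^+ 3 * Cp) * k ^+ 4 by field; rewrite gt_eqF.
  by apply: kk => //; lra.
- have -> : B * (Cp / k) * (2 * k ^+ 4) * (B ^+ 2 * k) = 2 * (B ^+ 3 * Cp) * k ^+ 4 by field; rewrite gt_eqF.
  by apply: kk => //; lra.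
- have -> : B * (Cp / k) * (B ^+ 2 * k ^+ 2) = 1 * (B ^+ 3 * Cp) * k ^+ 1 by field; rewrite gt_eqF.
  by apply: kk => //; lra.
Qed.

Let sig2 : 0 <= sig ^+ 2. Proof. exact: sqr_ge0. Qed.

Let stress_kk c1 c2 (r : R) : (c1 <= c2)%N -> 0 <= r -> r <= 64 ->
  r * (B ^+ 6 * Cp) * k ^+ c1 <= wave_const * k ^+ c2.
Proof.
move=> cc r0 r64; rewrite -W2.
by apply: ler_pM; [exact: mulr_ge0|exact: ltW|exact: ler_wpM2r|exact: ler_weXn2l].
Qed.

Lemma stress_ddpot_bound a b x : `|stress_ddpot a b x| <= wave_const * (sig ^+ 2 * k ^+ 2).
Proof.
rewrite /stress_ddpot normrM (ger0_norm (ltW _)) ?invr_gt0 ?exprn_gt0//.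
rewrite ler_pdivrMl ?exprn_gt0//.
have H : (forall j, (mi2 a b j <= 3)%N) by move=> j; rewrite /mi2; case: (a == j); case: (b == j).
apply: (le_trans (stress_step_bound x H)).
rewrite /mi2 big_split /= !sum_mi1.
have -> : M ^+ 2 * (wave_const * (sig ^+ 2 * k ^+ 2)) = sig ^+ 2 * (wave_const * k ^+ 6) by ring.
apply: ler_wpM2l => //.
case: (a == i); case: (b == i) => /=; rewrite ?addn0 ?add0n ?expr1 ?expr0 ?mulr1.
- have -> : 4 * (B ^+ 2 * Cp) * k ^+ 6 * (B * B) ^+ 2 = 4 * (B ^+ 6 * Cp) * k ^+ 6 by ring.
  by apply: stress_kk => //; lra.
- have -> : 4 * (B ^+ 2 * Cp) * k ^+ 2 * ((B * B) ^+ 2 * (k + k)) = 8 * (B ^+ 6 * Cp) * k ^+ 3 by ring.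
  by apply: stress_kk => //; lra.
- have -> : 4 * (B ^+ 2 * Cp) * k ^+ 2 * ((B * B) ^+ 2 * (k + k)) = 8 * (B ^+ 6 * Cp) * k ^+ 3 by ring.
  by apply: stress_kk => //; lra.
- have -> : 4 * (B ^+ 2 * Cp) * ((B * B) ^+ 2 * (k + k) ^+ 2) = 16 * (B ^+ 6 * Cp) * k ^+ 2 by ring.
  by apply: stress_kk => //; lra.
Qed.

Lemma stress_dddpot_bound a b d x :
  `|stress_dddpot a b d x| <= wave_const * (sig ^+ 2 * k ^+ 2) * (n_ * k ^+ 4).
Proof.
rewrite /stress_dddpot normrM (ger0_norm (ltW _)) ?invr_gt0 ?exprn_gt0//.
rewrite ler_pdivrMl ?exprn_gt0// normrM (ger0_norm (ltW n0)).
have H : (forall j, (mi3 a b d j <= 3)%N).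
  by move=> j; rewrite /mi3; case: (a == j); case: (b == j); case: (d == j).
apply: (le_trans (ler_wpM2l (ltW n0) (stress_step_bound x H))).
rewrite /mi3 !big_split /= !sum_mi1.
have -> : M ^+ 2 * (wave_const * (sig ^+ 2 * k ^+ 2) * (n_ * k ^+ 4)) = n_ * (sig ^+ 2 * (wave_const * k ^+ 10)) by ring.
apply: ler_wpM2l; first exact: ltW.
apply: ler_wpM2l => //.
have [p p3 E] : exists2 p, (p <= 3)%N & ((a == i) + (b == i) + (d == i) = 3 - p /\ (a != i) + (b != i) + (d != i) = p)%N.
  by case: (a == i); case: (b == i); case: (d == i) => /=; [exists 0%N|exists 1%N|exists 1%N|exists 2%N|exists 1%N|exists 2%N|exists 2%N|exists 3%N].
case: E => -> ->; case: p p3 => [|[|[|[|p]]]]// _ /=; rewrite ?expr1 ?expr0 ?mulr1.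
- have -> : 4 * (B ^+ 2 * Cp) * k ^+ 10 * (B * B) ^+ 2 = 4 * (B ^+ 6 * Cp) * k ^+ 10 by ring.
  by apply: stress_kk => //; lra.
- have -> : 4 * (B ^+ 2 * Cp) * k ^+ 6 * ((B * B) ^+ 2 * (k + k)) = 8 * (B ^+ 6 * Cp) * k ^+ 7 by ring.
  by apply: stress_kk => //; lra.
- have -> : 4 * (B ^+ 2 * Cp) * k ^+ 2 * ((B * B) ^+ 2 * (k + k) ^+ 2) = 16 * (B ^+ 6 * Cp) * k ^+ 4 by ring.
  by apply: stress_kk => //; lra.
- have -> : 4 * (B ^+ 2 * Cp) * ((B * B) ^+ 2 * (k + k) ^+ 3) = 32 * (B ^+ 6 * Cp) * k ^+ 3 by ring.
  by apply: stress_kk => //; lra.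
Qed.

Local Notation u_ x := (fun j => fpart (n_ * co j x)).

Definition envelope x := \prod_j cutoff k 0 (fpart (n_ * co j x)).
Definition wave_main x := s (cell N x) * envelope x * G 1 (M * fpart (n_ * co i x)).

Let jet_mul1 (f g : nat -> R -> R) t : jet_mul f g 1 t = f 0%N t * g 1%N t + f 1%N t * g 0%N t.
Proof. by rewrite /jet_mul !big_ord_recl big_ord0 /= /bump /= bin0 bin1 !mul1r addr0. Qed.

Let jet_mul2 (f g : nat -> R -> R) t :
  jet_mul f g 2 t = f 0%N t * g 2%N t + (2 * (f 1%N t * g 1%N t) + f 2%N t * g 0%N t).
Proof. by rewrite /jet_mul !big_ord_recl big_ord0 /= /bump /= bin0 bin1 binn !mul1r addr0. Qed.

Let Mi : M^-1 * M = 1. Proof. by rewrite mulVf// gt_eqF. Qed.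

(** The leading part arises when the derivative falls on the profile. On a cutoff it gains only K
    and meets [G 0], of size 1/K; the prefactor K^-2 remains as the error. *)
Lemma wave_dpot_main a x : `|wave_dpot a x - (a == i)%:R * wave_main x| <= wave_const * (sig * k ^- 2).
Proof.
have k2 : 0 <= k ^- 2 by rewrite invr_ge0 ltW.
have [->|ai] := eqVneq a i; last first.
  rewrite mul0r subr0 /wave_dpot normrM (ger0_norm (ltW _)) ?invr_gt0//.
  have H : (forall j, (mi1 a j <= 2)%N) by move=> j; rewrite /mi1; case: (a == j).
  rewrite ler_pdivrMl//; apply: (le_trans (wave_step_bound x H)).
  rewrite /mi1 sum_mi1 ai (negbTE ai) expr0 mulr1 expr1.
  have -> : M * (wave_const * (sig * k ^- 2)) = sig * wave_const by field; rewrite gt_eqF.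
  apply: ler_wpM2l => //; apply: le_trans W1.
  have -> : B * (Cp / k) * (B ^+ 2 * k) = B ^+ 3 * Cp by field; rewrite gt_eqF.
  by move: (B ^+ 3 * Cp) P3 => p p0; lra.
rewrite mul1r /wave_dpot /step_prod /wave_main /envelope (bigD1 i)//= [X in _ - s _ * X * _](bigD1 i)//=.
rewrite /mi1 eqxx {1}/wave_factors eqxx jet_mul1 /jet_affine expr1 expr0 mul1r addr0.
set t := fpart (n_ * co i x).
rewrite (eq_bigr (fun j => cutoff k 0 (fpart (n_ * co j x)))); last first.
  by move=> j ji; rewrite /wave_factors (negbTE ji) eq_sym (negbTE ji).
set Pi := \prod_(j < 3 | j != i) _.
have Pb : `|Pi| <= B ^+ 2.
  rewrite normr_prod -(prod_not_i i); apply: ler_prod => j _; rewrite normr_ge0.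
  by have := @cutoff_bound R k (ltW k0) 0%N (fpart (n_ * co j x)) isT; rewrite expr0 mulr1.
rewrite (_ : _ - _ = M^-1 * (s (cell N x) * (cutoff k 1 t * G 0%N (M * t) * Pi))); last first.
  rewrite mulrDl mulrDr mulrDr.
  have -> : M^-1 * (s (cell N x) * (cutoff k 0 t * (M * G 1 (M * t)) * Pi)) =
    (M^-1 * M) * (s (cell N x) * (cutoff k 0 t * Pi) * G 1 (M * t)) by ring.
  by rewrite Mi mul1r addrAC subrr add0r.
rewrite normrM (ger0_norm (ltW _)) ?invr_gt0// ler_pdivrMl//.
have -> : M * (wave_const * (sig * k ^- 2)) = sig * wave_const by field; rewrite gt_eqF.
rewrite normrM; apply: ler_pM => //; rewrite !normrM.
have h1 := @cutoff_bound R k (ltW k0) 1%N t isT; rewrite expr1 in h1.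
have h2 := sheet_boundG sheetGh (M * t) (isT : (0 <= 2)%N); rewrite expr0 mulr1 in h2.
apply: (@le_trans _ _ (B * k * (Cp * k^-1) * B ^+ 2)).
  by rewrite ler_pM ?mulr_ge0// ler_pM.
apply: le_trans W1.
have -> : B * k * (Cp / k) * B ^+ 2 = B ^+ 3 * Cp by field; rewrite gt_eqF.
by move: (B ^+ 3 * Cp) P3 => p p0; lra.
Qed.

(** With both derivatives on [h] the equation [h 2 = (G 1)^2 - 1] gives the leading part. The worst
    remainder has one derivative on a cutoff, worth K, and one on [h], worth K^2, against the
    prefactor K^-4. *)
Lemma stress_ddpot_main a b x :
  `|stress_ddpot a b x - (a == i)%:R * (b == i)%:R *
    (c (cell N x) * envelope x ^+ 2 * (G 1 (M * fpart (n_ * co i x)) ^+ 2 - 1))|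
  <= wave_const * (sig ^+ 2 * k^-1).
Proof.
have ki : 0 <= k ^-1 by rewrite invr_ge0 ltW.
have [/andP[/eqP -> /eqP ->]|ab] := boolP ((a == i) && (b == i)); last first.
  have -> : ((a == i)%:R * (b == i)%:R : R) = 0.
    by move: ab; case: (a == i); case: (b == i); rewrite ?mulr0 ?mul0r.
  rewrite mul0r subr0 /stress_ddpot normrM (ger0_norm (ltW _)) ?invr_gt0 ?exprn_gt0//.
  have H : (forall j, (mi2 a b j <= 3)%N) by move=> j; rewrite /mi2; case: (a == j); case: (b == j).
  rewrite ler_pdivrMl ?exprn_gt0//; apply: (le_trans (stress_step_bound x H)).
  rewrite /mi2 big_split /= !sum_mi1.
  have -> : M ^+ 2 * (wave_const * (sig ^+ 2 / k)) = sig ^+ 2 * (wave_const * k ^+ 3) by field; rewrite gt_eqF.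
  apply: ler_wpM2l => //; move: ab.
  case: (a == i); case: (b == i) => //= _; rewrite ?addn0 ?add0n ?expr1 ?expr0 ?mulr1.
  - have -> : 4 * (B ^+ 2 * Cp) * k ^+ 2 * ((B * B) ^+ 2 * (k + k)) = 8 * (B ^+ 6 * Cp) * k ^+ 3 by ring.
    by apply: stress_kk => //; lra.
  - have -> : 4 * (B ^+ 2 * Cp) * k ^+ 2 * ((B * B) ^+ 2 * (k + k)) = 8 * (B ^+ 6 * Cp) * k ^+ 3 by ring.
    by apply: stress_kk => //; lra.
  - have -> : 4 * (B ^+ 2 * Cp) * ((B * B) ^+ 2 * (k + k) ^+ 2) = 16 * (B ^+ 6 * Cp) * k ^+ 2 by ring.
    by apply: stress_kk => //; lra.
rewrite eqxx mulr1 mul1r /stress_ddpot /step_prod /envelope (bigD1 i)//= [X in _ - c _ * X ^+ 2 * _](bigD1 i)//=.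
rewrite /mi2 eqxx {1}/stress_factors eqxx jet_mul2 -(sheet_h2 sheetGh).
set t := fpart (n_ * co i x).
have X20 v : cutoff2 0 v = cutoff k 0 v ^+ 2.
  by rewrite /cutoff2 /jet_mul big_ord_recl big_ord0 bin0 mul1r addr0 expr2.
rewrite (eq_bigr (fun j => cutoff k 0 (fpart (n_ * co j x)) ^+ 2)); last first.
  by move=> j ji; rewrite /stress_factors (negbTE ji) eq_sym (negbTE ji) X20.
rewrite prodrXl; set Pi := \prod_(j < 3 | j != i) _.
have Pb : `|Pi ^+ 2| <= (B * B) ^+ 2.
  rewrite normrX lerXn2r ?nnegrE ?normr_ge0 ?mulr_ge0 ?(ltW B0)//.
  rewrite -expr2 normr_prod -(prod_not_i i); apply: ler_prod => j _; rewrite normr_ge0.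
  by have := @cutoff_bound R k (ltW k0) 0%N (fpart (n_ * co j x)) isT; rewrite expr0 mulr1.
have hJ1 : `|jet_affine M 0 h 1 t| <= Cp * M.
  by have := h_bound t (isT : (1 <= 3)%N); rewrite /= expr1 expr0 mulr1.
have hJ0 : `|jet_affine M 0 h 0 t| <= Cp.
  by have := h_bound t (isT : (0 <= 3)%N); rewrite /= !expr0 !mulr1.
have hX1 := X2_bound t (isT : (1 <= 3)%N); have hX2 := X2_bound t (isT : (2 <= 3)%N).
rewrite expr1 in hX1.
have hM : jet_affine M 0 h 2 t = M ^+ 2 * h 2 (M * t) by rewrite /jet_affine addr0.
rewrite hM X20.
move: (jet_affine M 0 h 1 t) (jet_affine M 0 h 0 t) hJ1 hJ0 => J1 J0 hJ1 hJ0.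
rewrite (_ : _ - _ = M ^- 2 * (c (cell N x) * ((2 * (cutoff2 1 t * J1) + cutoff2 2 t * J0) * Pi ^+ 2))); last first.
  rewrite mulrDl mulrDr mulrDr.
  have -> : M ^- 2 * (c (cell N x) * (cutoff k 0 t ^+ 2 * (M ^+ 2 * h 2 (M * t)) * Pi ^+ 2)) =
    (M ^- 2 * M ^+ 2) * (c (cell N x) * (cutoff k 0 t * Pi) ^+ 2 * h 2 (M * t)) by ring.
  by rewrite mulVf ?expf_neq0 ?gt_eqF// mul1r addrAC subrr add0r.
rewrite normrM (ger0_norm (ltW _)) ?invr_gt0 ?exprn_gt0// ler_pdivrMl ?exprn_gt0//.
have -> : M ^+ 2 * (wave_const * (sig ^+ 2 / k)) = sig ^+ 2 * (wave_const * k ^+ 3) by field; rewrite gt_eqF.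
rewrite normrM; apply: ler_pM => //; first by rewrite ger0_norm.
rewrite normrM.
apply: (@le_trans _ _ ((2 * ((B * B * (k + k)) * (Cp * k ^+ 2)) + B * B * (k + k) ^+ 2 * Cp) * (B * B) ^+ 2)).
  apply: ler_pM => //; apply: (le_trans (ler_normD _ _)); apply: lerD; rewrite !normrM.
    rewrite (ger0_norm (ler0n R 2)); apply: ler_wpM2l => //.
    exact: (ler_pM (normr_ge0 _) (normr_ge0 _) hX1 hJ1).
  exact: (ler_pM (normr_ge0 _) (normr_ge0 _) hX2 hJ0).
have -> : (2 * ((B * B * (k + k)) * (Cp * k ^+ 2)) + B * B * (k + k) ^+ 2 * Cp) * (B * B) ^+ 2
   = 4 * (B ^+ 6 * Cp) * k ^+ 3 + 4 * (B ^+ 6 * Cp) * k ^+ 2 by ring.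
rewrite -W2; have : k ^+ 2 <= k ^+ 3 by rewrite ler_weXn2l.
have := kX 2; move: (B ^+ 6 * Cp) (k ^+ 2) (k ^+ 3) P6 => p y z p0 y0 yz; nra.
Qed.

End Potential.
End Wave.

(** * Frames *)

Section BoundedC1.
Context (R : realType).
Implicit Types (f g : space3 R -> R) (K L : R).
Local Notation Int f := (\int[volume]_(x in cube) f x).
Local Notation mu := (@lebesgue_measure R).

(** [K] is an amplitude and [L] a frequency: sums add amplitudes, products multiply them and double
    [L]. *)
Definition bC1 K L f : Prop := [/\ C1 f (fun i => partial i f), torus_periodic f,
  (forall x, `|f x| <= K) & (forall i x, `|partial i f x| <= K * L)].

Lemma bC1_intro K L f df : C1 f df -> torus_periodic f -> (forall x, `|f x| <= K) ->
  (forall i x, `|df i x| <= K * L) -> bC1 K L f.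
Proof.
move=> Cf pf fK dfK; have E i : partial i f = df i := C1_partial i Cf.
split=> //; last by move=> i x; rewrite E.
by rewrite (_ : (fun i => partial i f) = df)//; apply/funext.
Qed.

Lemma bC1_continuous K L f : bC1 K L f -> continuous f.
Proof. by move=> [[]]. Qed.

Lemma bC1_cube_bounded K L f : bC1 K L f -> cube_bounded f.
Proof. by move=> [h _ _ _]; exact: C1_cube_bounded h. Qed.

Lemma bC1_ge0 K L f : bC1 K L f -> 0 <= K.
Proof. by move=> [_ _ h _]; exact: le_trans (normr_ge0 _) (h (0, 0, 0)). Qed.

Lemma bC1_weaken K L K' L' f : K <= K' -> L <= L' -> 0 <= L' -> bC1 K L f -> bC1 K' L' f.
Proof.
move=> KK LL L0 bf; have K0 := bC1_ge0 bf; have [Cf pf fK dfK] := bf.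
split=> // [x|i x]; first exact: le_trans (fK x) KK.
apply: (le_trans (dfK i x)); apply: (@le_trans _ _ (K * L')); first exact: ler_wpM2l.
exact: ler_wpM2r.
Qed.

Lemma bC1D K K' L f g : bC1 K L f -> bC1 K' L g -> bC1 (K + K') L (fun x => f x + g x).
Proof.
move=> [Cf pf fK dfK] [Cg pg gK dgK]; apply: (bC1_intro (C1D Cf Cg)).
- exact: periodicD.
- by move=> x; apply: (le_trans (ler_normD _ _)); exact: lerD.
- by move=> i x; rewrite mulrDl; apply: (le_trans (ler_normD _ _)); exact: lerD.
Qed.

Lemma bC1Z K L c f : bC1 K L f -> bC1 (`|c| * K) L (fun x => c * f x).
Proof.
move=> [Cf pf fK dfK]; apply: (bC1_intro (C1Z c Cf)).
- exact: periodicZ.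
- by move=> x; rewrite normrM; apply: ler_wpM2l.
- by move=> i x; rewrite normrM -mulrA; apply: ler_wpM2l.
Qed.

Lemma bC1N K L f : bC1 K L f -> bC1 K L (fun x => - f x).
Proof.
move=> /(bC1Z (-1)); rewrite normrN1 mul1r; congr bC1.
by apply/funext => x; rewrite mulN1r.
Qed.

Lemma bC1B K K' L f g : bC1 K L f -> bC1 K' L g -> bC1 (K + K') L (fun x => f x - g x).
Proof. by move=> bf /bC1N; exact: bC1D. Qed.

Lemma bC1M K K' L f g : bC1 K L f -> bC1 K' L g -> bC1 (K * K') (2 * L) (fun x => f x * g x).
Proof.
move=> bf bg; have K0 := bC1_ge0 bf; have K0' := bC1_ge0 bg.
move: bf bg => [Cf pf fK dfK] [Cg pg gK dgK]; apply: (bC1_intro (C1M Cf Cg)).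
- exact: periodicM.
- by move=> x; rewrite normrM; exact: ler_pM.
- move=> i x; apply: (le_trans (ler_normD _ _)).
  rewrite (_ : K * K' * (2 * L) = K * L * K' + K * (K' * L)); last by ring.
  by apply: lerD; rewrite normrM; exact: ler_pM.
Qed.

Lemma bC1_sum (I : finType) (F : I -> space3 R -> R) K L : 0 <= K ->
  (forall k, bC1 K L (F k)) -> bC1 (#|I|%:R * K) L (fun x => \sum_k F k x).
Proof.
move=> K0 bF.
have CF k : C1 (F k) (fun i => partial i (F k)) by have [] := bF k.
apply: (bC1_intro (C1_sum (index_enum I) CF)).
- by move=> i x; apply: eq_bigr => k _; have [_ pk _ _] := bF k; exact: pk.
- move=> x; apply: (le_trans (ler_norm_sum _ _ _)).
  rewrite -sum1_card natr_sum mulr_suml; apply: ler_sum => k _; rewrite mul1r.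
  by have [] := bF k.
- move=> i x; apply: (le_trans (ler_norm_sum _ _ _)).
  rewrite -sum1_card natr_sum !mulr_suml; apply: ler_sum => k _; rewrite mul1r.
  by have [] := bF k.
Qed.

Lemma bC1_lipschitz K L f x y : bC1 K L f -> `|f x - f y| <= K * L * dist3 x y.
Proof. by move=> [Cf _ _ dK]; exact: (C1_lipschitz Cf dK). Qed.

Lemma cube_int_prod (v : 'I_3 -> R -> R) : (forall j, continuous (v j)) ->
  Int (fun x => v 0 (co 0 x) * v 1 (co 1 x) * v 2 (co 2 x)) =
  \int[mu]_(t in `[0, 1]) v 0 t * \int[mu]_(t in `[0, 1]) v 1 t * \int[mu]_(t in `[0, 1]) v 2 t.
Proof.
move=> cv.
have cc j : continuous (fun x : space3 R => v j (co j x)).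
  by move=> x; apply: (@continuous_comp _ _ _ (co j) (v j)); [exact: continuous_co|exact: cv].
have iv j := continuous_integrable_itv 0 1 (cv j).
rewrite cube_integral_iter1; last first.
  by apply: continuous_cube_bounded => x; apply: cvgM; [apply: cvgM|]; exact: cc.
have Z j (c : R) : \int[mu]_(t in `[0, 1]) (c * v j t) = c * \int[mu]_(t in `[0, 1]) v j t.
  by apply: RintegralZl => //; exact: iv.
rewrite /co /=; set I0 := \int[mu]_(t in _) v 0 t; set I1 := \int[mu]_(t in _) v 1 t.
rewrite -(Z 2); apply: eq_Rintegral => z _.
have -> : I0 * I1 * v 2 z = I0 * v 2 z * I1 by ring.
rewrite -(Z 1); apply: eq_Rintegral => y _.
have -> : I0 * v 2 z * v 1 y = v 2 z * v 1 y * I0 by ring.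
by rewrite -(Z 0); apply: eq_Rintegral => x _; ring.
Qed.

Lemma cube_int_co (v : R -> R) j : continuous v ->
  Int (fun x => v (co j x)) = \int[mu]_(t in `[0, 1]) v t.
Proof.
move=> cv; pose w (l : 'I_3) : R -> R := if l == j then v else cst 1.
have cw l : continuous (w l) by rewrite /w; case: ifP => _ //; exact: cst_continuous.
have I1 : \int[mu]_(t in `[0, 1]) (cst 1 t : R) = 1.
  by rewrite Rintegral_cst// [X in fine X](lebesgue_itv01 R) mulr1.
have := cube_int_prod cw; rewrite /w; elim/ord3_ind: j {w cw} => /=.
all: rewrite ?I1 ?mulr1 ?mul1r => <-; apply: eq_Rintegral => x _ /=; by rewrite ?mulr1 ?mul1r.
Qed.

(** Independence of two coordinates: the product of two waves of different directions has integral
    O(1/K^2), the product of two L^1 norms. *)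
Lemma cube_int_co2 (v w : R -> R) i j : i != j -> continuous v -> continuous w ->
  Int (fun x => v (co i x) * w (co j x)) =
  \int[mu]_(t in `[0, 1]) v t * \int[mu]_(t in `[0, 1]) w t.
Proof.
move=> ij cv cw; pose u (l : 'I_3) : R -> R := if l == i then v else if l == j then w else cst 1.
have cu l : continuous (u l).
  by rewrite /u; case: ifP => _ //; case: ifP => _ //; exact: cst_continuous.
have I1 : \int[mu]_(t in `[0, 1]) (cst 1 t : R) = 1.
  by rewrite Rintegral_cst// [X in fine X](lebesgue_itv01 R) mulr1.
have := cube_int_prod cu; rewrite /u; elim/ord3_ind: i {u cu} ij => //=; elim/ord3_ind: j => //= _.
all: rewrite ?I1 ?mulr1 ?mul1r => H; rewrite -?H 1?mulrC -?H; apply: eq_Rintegral => x _ /=; by rewrite ?mulr1 ?mul1r 1?mulrC.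
Qed.

End BoundedC1.

Section Frames.
Context (R : realType).

Definition sgn (b : bool) : R := (-1) ^+ b.
Definition eta_ (w : 'I_3 * bool) (a : 'I_3) : R :=
  sgn w.2 * (a == w.1 + 1)%:R - (a == w.1 + 2)%:R.
(* eta_ w is chosen so that e_i x eta_ w = xi_ w for w = (i, sign) *)
Definition xi_ (w : 'I_3 * bool) (a : 'I_3) : R :=
  (a == w.1 + 1)%:R + sgn w.2 * (a == w.1 + 2)%:R.

Lemma sgn_norm b : `|sgn b| = 1. Proof. by rewrite /sgn normrX normrN1 expr1n. Qed.

Lemma eta_norm w a : `|eta_ w a| <= 1.
Proof.
case: w => i b; rewrite /eta_ /=; elim/ord3_ind: i; elim/ord3_ind: a;
rewrite !ord3D ?eqxx ?ord3_eq /= ?mulr1n ?mulr0n ?mulr1 ?mulr0 ?subr0 ?sub0r ?normrN ?normr0 ?normr1 ?sgn_norm//; exact: ler01.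
Qed.

Lemma xi_norm w a : `|xi_ w a| <= 1.
Proof.
case: w => i b; rewrite /xi_ /=; elim/ord3_ind: i; elim/ord3_ind: a;
rewrite !ord3D ?eqxx ?ord3_eq /= ?mulr1n ?mulr0n ?mulr1 ?mulr0 ?addr0 ?add0r ?normrN ?normr0 ?normr1 ?sgn_norm//; exact: ler01.
Qed.

Lemma cross_delta w a : cross (fun k => (k == w.1)%:R) (eta_ w) a = xi_ w a.
Proof.
case: w => i b; rewrite /cross /eta_ /xi_ /=; elim/ord3_ind: i; elim/ord3_ind: a;
rewrite !ord3D ?eqxx ?ord3_eq /= ?mulr1n ?mulr0n; ring.
Qed.

Lemma cross_norm (d : 'I_3 -> R) w a (M : R) : (forall k, `|d k| <= M) -> `|cross d (eta_ w) a| <= M + M.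
Proof.
move=> dM; have M0 : 0 <= M := le_trans (normr_ge0 _) (dM 0).
rewrite /cross; apply: (le_trans (ler_normB _ _)); rewrite !normrM.
by apply: lerD; rewrite -[X in _ <= X]mulr1; apply: ler_pM => //; exact: eta_norm.
Qed.

Lemma big_wave (F : 'I_3 * bool -> R) :
  \sum_w F w = \sum_i (F (i, false) + F (i, true)).
Proof.
rewrite (eq_bigr (fun w => F (w.1, w.2))); last by case.
rewrite -(pair_bigA _ (fun i b => F (i, b)))/=; apply: eq_bigr => i _.
by rewrite big_bool /= addrC.
Qed.

(** For a given direction i the two signs differ in the off-diagonal entry (i+1, i+2) only, which
    the signed term fits. The diagonal is reached through the trace: [Q i i / 2] contributes [Q i i]
    to the two other diagonal entries, so that entry a receives the trace minus [Q a a]. *)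
Lemma amplitude_identity (r : R) (Q : 'I_3 -> 'I_3 -> R) a b :
  (forall a b, Q a b = Q b a) ->
  \sum_w (r + Q w.1 w.1 / 2 - sgn w.2 * Q (w.1 + 1) (w.1 + 2) / 2) * (xi_ w a * xi_ w b) =
  - Q a b + (a == b)%:R * (4 * r + \sum_j Q j j).
Proof.
move=> S; rewrite big_wave !sum3 /xi_ /sgn /= expr0 expr1 !ord3D.
have S10 := S 1 0; have S20 := S 2 0; have S21 := S 2 1.
elim/ord3_ind: a; elim/ord3_ind: b; rewrite !eqxx ?ord3_eq /= ?mulr1n ?mulr0n ?S10 ?S20 ?S21; by field.
Qed.

End Frames.

(** * One stage of the construction *)

Section Superposition.
Context (R : realType).
Local Notation Int f := (\int[volume]_(x in cube) f x).
Implicit Types (B : vfield R) (S : 'I_3 -> 'I_3 -> space3 R -> R).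

(* The pair (B, S) solves the stationary equation up to the error div S; A bounds the
   field, Lam the frequencies, and kap is what makes the final field nontrivial. *)
Record relaxed (A Lam dl kap : R) B S : Prop := Relaxed {
  relaxed_field : forall a, bC1 A Lam (B a);
  relaxed_stress : forall a b, bC1 (A ^+ 2) Lam (S a b);
  relaxed_sym : forall a b x, S a b x = S b a x;
  relaxed_small : forall a b, Int (fun x => `|S a b x|) <= dl;
  relaxed_weak : forall phi : vfield R, (forall i, smooth (phi i)) ->
    (forall i, torus_periodic (phi i)) ->
    Int (weak_form B (fun a b x => B a x * B b x - S a b x) phi) = 0;
  relaxed_div : forall psi, smooth psi -> torus_periodic psi ->
    Int (fun x => \sum_a B a x * partial a psi x) = 0;
  relaxed_mean : forall a, Int (B a) = 0;
  relaxed_moment : Int (fun x => B 0 x * B 1 x - S 0 1 x) = kap }.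

Variables (I : finType) (eta : I -> 'I_3 -> R).
Variables (F P : I -> space3 R -> R) (dF dP : I -> vfield R)
  (ddF ddP : I -> 'I_3 -> 'I_3 -> space3 R -> R) (p : space3 R -> R).
Hypotheses (CF : forall w, C1 (F w) (dF w)) (CdF : forall w a, C1 (dF w a) (ddF w a))
  (CP : forall w, C1 (P w) (dP w)) (CdP : forall w a, C1 (dP w a) (ddP w a))
  (pF : forall w, torus_periodic (F w)) (pdF : forall w a, torus_periodic (dF w a))
  (pP : forall w, torus_periodic (P w)) (pdP : forall w a, torus_periodic (dP w a))
  (cp : cube_bounded p).
Variables (B : vfield R) (S : 'I_3 -> 'I_3 -> space3 R -> R).
Hypotheses (bB : forall a, cube_bounded (B a)) (bS : forall a b, cube_bounded (S a b)).

Definition wave_field a x := \sum_w pot_field (eta w) (dF w) a x.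
Definition wave_stress a b x :=
  \sum_w (sym_grad (eta w) (dF w) a b x + pot_stress (eta w) (ddP w) a b x) + (a == b)%:R * p x.
Definition new_field a x := B a x + wave_field a x.
(** Chosen so that B (x) B - S grows by exactly [wave_stress]: its symmetric gradients balance the
    linear term, and its other parts are invisible to the weak form. That the result is small is a
    separate matter. *)
Definition new_stress a b x := S a b x + (B a x * wave_field b x + wave_field a x * B b x)
  + wave_field a x * wave_field b x - wave_stress a b x.

Let bZ (c : R) f : cube_bounded f -> cube_bounded (fun x => c * f x).
Proof. by move=> bf; apply: cube_boundedM => //; exact: cube_bounded_cst. Qed.

Let bcross (d : vfield R) e a : (forall k, cube_bounded (d k)) -> cube_bounded (fun x => cross (fun k => d k x) e a).
Proof. by move=> bd; apply: cube_boundedB; (apply: cube_boundedM; [exact: bd|exact: cube_bounded_cst]). Qed.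

Let bdF w a : cube_bounded (dF w a). Proof. exact: C1_cube_bounded (CdF w a). Qed.
Let bddP w a b : cube_bounded (ddP w a b). Proof. exact: C1_cube_bounded_partial (CdP w a). Qed.
Let bpot w a : cube_bounded (pot_field (eta w) (dF w) a). Proof. exact: bcross. Qed.
Let bsym w a b : cube_bounded (sym_grad (eta w) (dF w) a b).
Proof. by apply: cube_boundedD; apply: cube_boundedM => //; exact: cube_bounded_cst. Qed.
Let bstr w a b : cube_bounded (pot_stress (eta w) (ddP w) a b).
Proof. by apply: bcross => k; apply: bcross. Qed.

Lemma wave_field_cube_bounded a : cube_bounded (wave_field a).
Proof. exact: cube_bounded_sum. Qed.
Let bw := wave_field_cube_bounded.

Let int0 (V : nmodType) (f : I -> V) : (forall w, f w = 0) -> \sum_w f w = 0.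
Proof. by move=> f0; apply: big1 => w _; exact: f0. Qed.

Let sumD3 (G H : 'I_3 -> 'I_3 -> R) : \sum_a \sum_b (G a b + H a b) = \sum_a \sum_b G a b + \sum_a \sum_b H a b.
Proof. by rewrite -big_split; apply: eq_bigr => a _; rewrite big_split. Qed.

Lemma new_weak_form (phi : vfield R) x : (forall i, smooth (phi i)) ->
  weak_form new_field (fun a b x => new_field a x * new_field b x - new_stress a b x) phi x =
  weak_form B (fun a b x => B a x * B b x - S a b x) phi x +
  (\sum_w weak_form (pot_field (eta w) (dF w)) (sym_grad (eta w) (dF w)) phi x +
   \sum_w \sum_a \sum_b pot_stress (eta w) (ddP w) a b x * partial b (curl phi a) x).
Proof.
move=> sphi; rewrite /weak_form.
set l := fun a => laplacian (phi a) x; set t := fun a b => partial b (curl phi a) x.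
(* The isotropic part is a pressure: against the gradient of a curl it contracts to div curl = 0. *)
have tr : \sum_a \sum_b ((a == b)%:R * p x) * t a b = 0.
  transitivity (p x * divergence (curl phi) x); last by rewrite div_curl ?mulr0.
  rewrite /divergence mulr_sumr; apply: eq_bigr => a _; rewrite (bigD1 a)//= eqxx mul1r big1 ?addr0// => b.
  by rewrite eq_sym => /negbTE ->; rewrite !mul0r.
have -> : \sum_a new_field a x * laplacian (phi a) x = \sum_a B a x * l a + \sum_a wave_field a x * l a.
  by rewrite -big_split; apply: eq_bigr => a _; rewrite /new_field mulrDl.
have -> : \sum_a \sum_b (new_field a x * new_field b x - new_stress a b x) * partial b (curl phi a) x =
  \sum_a \sum_b (B a x * B b x - S a b x) * t a b + (
  \sum_a \sum_b (\sum_w (sym_grad (eta w) (dF w) a b x + pot_stress (eta w) (ddP w) a b x)) * t a b).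
  rewrite -[RHS]addr0 -[X in _ + X]tr -!sumD3; apply: eq_bigr => a _; apply: eq_bigr => b _.
  by rewrite /new_field /new_stress /wave_stress /t; ring.
rewrite addrACA; congr (_ + _).
have -> : \sum_a wave_field a x * l a = \sum_w \sum_a pot_field (eta w) (dF w) a x * l a.
  by rewrite [RHS]exchange_big; apply: eq_bigr => a _; rewrite mulr_suml.
have -> : \sum_a \sum_b (\sum_w (sym_grad (eta w) (dF w) a b x + pot_stress (eta w) (ddP w) a b x)) * t a b =
  \sum_w \sum_a \sum_b (sym_grad (eta w) (dF w) a b x + pot_stress (eta w) (ddP w) a b x) * t a b.
  rewrite [RHS]exchange_big; apply: eq_bigr => a _; rewrite [RHS]exchange_big; apply: eq_bigr => b _.
  by rewrite mulr_suml.
rewrite -!big_split; apply: eq_bigr => w _ /=; rewrite -addrA; congr (_ + _).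
by rewrite -sumD3; apply: eq_bigr => a _; apply: eq_bigr => b _; rewrite mulrDl.
Qed.

Lemma new_relaxed_weak (phi : vfield R) : (forall i, smooth (phi i)) ->
  (forall i, torus_periodic (phi i)) ->
  Int (weak_form new_field (fun a b x => new_field a x * new_field b x - new_stress a b x) phi) =
  Int (weak_form B (fun a b x => B a x * B b x - S a b x) phi).
Proof.
move=> sphi pphi.
have bl a : cube_bounded (laplacian (phi a)).
  exact/continuous_cube_bounded/smooth_continuous/smooth_laplacian.
have bt a b : cube_bounded (partial b (curl phi a)).
  exact/continuous_cube_bounded/smooth_continuous/smooth_partial/smooth_curl.
have bW C U : (forall a, cube_bounded (C a)) -> (forall a b, cube_bounded (U a b)) -> cube_bounded (weak_form C U phi).
  move=> bC bU; apply: cube_boundedD; first by apply: cube_bounded_sum => a; exact: cube_boundedM.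
  by apply: cube_bounded_sum => a; apply: cube_bounded_sum => b; exact: cube_boundedM.
have bq w : cube_bounded (fun x => \sum_a \sum_b pot_stress (eta w) (ddP w) a b x * partial b (curl phi a) x).
  by apply: cube_bounded_sum => a; apply: cube_bounded_sum => b; exact: cube_boundedM.
apply: etrans; first by apply: eq_Rintegral => x _; exact: new_weak_form.
have bV w : cube_bounded (weak_form (pot_field (eta w) (dF w)) (sym_grad (eta w) (dF w)) phi).
  by apply: bW => [a|a b]; [exact: bpot|exact: bsym].
have b0 : cube_bounded (weak_form B (fun a b x => B a x * B b x - S a b x) phi).
  by apply: bW => // a b; apply: cube_boundedB => //; exact: cube_boundedM.
have b1 : cube_bounded (fun x => \sum_w weak_form (pot_field (eta w) (dF w)) (sym_grad (eta w) (dF w)) phi x).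
  exact: cube_bounded_sum.
have b2 : cube_bounded (fun x => \sum_w \sum_a \sum_b pot_stress (eta w) (ddP w) a b x * partial b (curl phi a) x).
  exact: cube_bounded_sum.
apply: (etrans (cube_intD b0 (cube_boundedD b1 b2))); rewrite (cube_intD b1 b2) (cube_int_sum _ bV) (cube_int_sum _ bq).
rewrite !int0 ?addr0// => w.
- exact: (int_pot_stress (eta w) (CP w) (CdP w) (pP w) (pdP w) sphi pphi).
- exact: (int_linear_stress (eta w) (CF w) (pF w) sphi pphi).
Qed.

Lemma new_relaxed_div psi : smooth psi -> torus_periodic psi ->
  Int (fun x => \sum_a new_field a x * partial a psi x) = Int (fun x => \sum_a B a x * partial a psi x).
Proof.
move=> spsi ppsi.
have bp a : cube_bounded (partial a psi) by exact/continuous_cube_bounded/smooth_continuous/smooth_partial.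
have E x : \sum_a new_field a x * partial a psi x =
  \sum_a B a x * partial a psi x + \sum_w \sum_a pot_field (eta w) (dF w) a x * partial a psi x.
  rewrite exchange_big -big_split; apply: eq_bigr => a _ /=.
  by rewrite /new_field /wave_field mulrDl mulr_suml.
have bs C : (forall a, cube_bounded (C a)) -> cube_bounded (fun x => \sum_a C a x * partial a psi x).
  by move=> bC; apply: cube_bounded_sum => a; exact: cube_boundedM.
apply: etrans; first by apply: eq_Rintegral => x _; exact: E.
have b1 w : cube_bounded (fun x => \sum_a pot_field (eta w) (dF w) a x * partial a psi x) by exact: bs.
rewrite (cube_intD (bs _ bB) (cube_bounded_sum _ b1)) (cube_int_sum _ b1).
rewrite int0 ?addr0// => w; exact: (pot_field_div_free (eta w) (CF w) (pF w) spsi ppsi).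
Qed.

Let int_dF w a : Int (dF w a) = 0.
Proof. by have [_ /(_ a)[? ?]] := CF w; exact: (cube_int_partial (i := a) (f := F w)). Qed.

Let int_ddP w a b : Int (ddP w a b) = 0.
Proof. by have [_ /(_ b)[? ?]] := CdP w a; exact: (cube_int_partial (i := b) (f := dP w a)). Qed.

Let int_cross (d : vfield R) e a : (forall k, cube_bounded (d k)) -> (forall k, Int (d k) = 0) ->
  Int (fun x => cross (fun k => d k x) e a) = 0.
Proof.
move=> bd d0; rewrite /cross cube_intB; try by apply: cube_boundedM => //; exact: cube_bounded_cst.
rewrite (eq_Rintegral _ (fun x _ => mulrC _ _)) cube_intZ// d0 mulr0.
by rewrite (eq_Rintegral _ (fun x _ => mulrC _ _)) cube_intZ// d0 mulr0 subr0.
Qed.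

Lemma int_wave_field a : Int (wave_field a) = 0.
Proof. by rewrite cube_int_sum// int0// => w; exact: int_cross. Qed.

Lemma new_relaxed_mean a : Int (new_field a) = Int (B a).
Proof. by rewrite cube_intD// int_wave_field addr0. Qed.

(** In position (0, 1) only derivatives of periodic functions are added to B (x) B - S, since the
    isotropic part is diagonal. *)
Lemma new_relaxed_moment : Int (fun x => new_field 0 x * new_field 1 x - new_stress 0 1 x) =
  Int (fun x => B 0 x * B 1 x - S 0 1 x).
Proof.
have E x : new_field 0 x * new_field 1 x - new_stress 0 1 x = (B 0 x * B 1 x - S 0 1 x) +
  \sum_w (sym_grad (eta w) (dF w) 0 1 x + pot_stress (eta w) (ddP w) 0 1 x).
  by rewrite /new_field /new_stress /wave_stress mul0r; ring.
apply: etrans; first by apply: eq_Rintegral => x _; exact: E.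
have b1 w : cube_bounded (fun x => sym_grad (eta w) (dF w) 0 1 x + pot_stress (eta w) (ddP w) 0 1 x) by exact: cube_boundedD.
rewrite (cube_intD (cube_boundedB (cube_boundedM (bB 0) (bB 1)) (bS 0 1)) (cube_bounded_sum _ b1)) (cube_int_sum _ b1).
rewrite int0 ?addr0// => w; rewrite cube_intD// cube_intD.
- rewrite (eq_Rintegral _ (fun x _ => mulrC _ _)) !cube_intZ// !int_dF !mulr0 !add0r.
  by apply: int_cross => k; [exact: bcross|exact: int_cross].
- by apply: cube_boundedM => //; exact: cube_bounded_cst.
- by apply: cube_boundedM => //; exact: cube_bounded_cst.
Qed.

Lemma new_stress_sym : (forall a b x, S a b x = S b a x) -> (forall w a b x, ddP w a b x = ddP w b a x) ->
  forall a b x, new_stress a b x = new_stress b a x.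
Proof.
move=> sS sP a b x; rewrite /new_stress /wave_stress sS (eq_sym a b).
have -> : \sum_w (sym_grad (eta w) (dF w) a b x + pot_stress (eta w) (ddP w) a b x) =
  \sum_w (sym_grad (eta w) (dF w) b a x + pot_stress (eta w) (ddP w) b a x).
  apply: eq_bigr => w _; congr (_ + _); first by rewrite /sym_grad; ring.
  rewrite /pot_stress /cross (sP w (b + 1) (a + 1)) (sP w (b + 2) (a + 1)).
  by rewrite (sP w (b + 1) (a + 2)) (sP w (b + 2) (a + 2)); ring.
by ring.
Qed.

End Superposition.

(** * Amplitudes and pressure frozen at the corners of the cells *)

Section Stage.
Context (R : realType) (K Lam : nat).
Implicit Types (x : space3 R) (n : 'I_3 -> int).
Local Notation N := (K * Lam)%N.
Local Notation k := (K%:R : R).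
Local Notation W := (wave_const R).
Local Notation Int f := (\int[volume]_(x in cube) f x).

Definition corner n : space3 R := ((n 0)%:~R / N%:R, (n 1)%:~R / N%:R, (n 2)%:~R / N%:R).

Lemma co_corner j n : co j (corner n) = (n j)%:~R / N%:R.
Proof. by elim/ord3_ind: j. Qed.

Section Amplitudes.
Variable S : 'I_3 -> 'I_3 -> space3 R -> R.

Definition stress_size n := \sum_a \sum_b `|S a b (corner n)|.
(** The coefficients of [amplitude_identity] with [r] the size of the stress: large enough to be
    nonnegative, yet comparable to |S|, so that the energy of the waves is controlled by the L^1
    norm of S. *)
Definition amplitude (w : 'I_3 * bool) n := stress_size n + S w.1 w.1 (corner n) / 2
  - sgn R w.2 * S (w.1 + 1) (w.1 + 2) (corner n) / 2.
Definition pressure n := 4 * stress_size n + \sum_j S j j (corner n).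

Lemma stress_size_ge a b n : `|S a b (corner n)| <= stress_size n.
Proof.
rewrite /stress_size (bigD1 a)//= (bigD1 b)//= -addrA lerDl.
by rewrite addr_ge0 ?sumr_ge0// => ? _; rewrite ?sumr_ge0.
Qed.

Lemma stress_size_le (A : R) n : (forall a b x, `|S a b x| <= A) -> stress_size n <= 9 * A.
Proof.
move=> SA; rewrite /stress_size !sum3.
have := SA 0 0 (corner n); have := SA 0 1 (corner n); have := SA 0 2 (corner n).
have := SA 1 0 (corner n); have := SA 1 1 (corner n); have := SA 1 2 (corner n).
have := SA 2 0 (corner n); have := SA 2 1 (corner n); have := SA 2 2 (corner n).
lra.
Qed.

Let sgn_le b (r s : R) : `|r| <= s -> `|sgn R b * r| <= s.
Proof. by rewrite normrM sgn_norm mul1r. Qed.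

Lemma amplitude_ge0 w n : 0 <= amplitude w n.
Proof.
have := stress_size_ge w.1 w.1 n; rewrite ler_norml => /andP[h1 _].
have := sgn_le w.2 (stress_size_ge (w.1 + 1) (w.1 + 2) n); rewrite ler_norml => /andP[_ h2].
rewrite /amplitude; lra.
Qed.

Lemma amplitude_le w n : amplitude w n <= 2 * stress_size n.
Proof.
have := stress_size_ge w.1 w.1 n; rewrite ler_norml => /andP[_ h1].
have := sgn_le w.2 (stress_size_ge (w.1 + 1) (w.1 + 2) n); rewrite ler_norml => /andP[h2 _].
rewrite /amplitude; lra.
Qed.

Lemma amplitude_le_sqr (A : R) w n : (forall a b x, `|S a b x| <= A ^+ 2) -> amplitude w n <= (4 * A) ^+ 2.
Proof.
move=> SA; have := stress_size_le n SA.
have := SA w.1 w.1 (corner n); rewrite ler_norml => /andP[_ h1].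
have := sgn_le w.2 (SA (w.1 + 1) (w.1 + 2) (corner n)); rewrite ler_norml => /andP[h2 _].
have A0 : 0 <= A ^+ 2 by exact: sqr_ge0.
rewrite /amplitude exprMn; lra.
Qed.

Lemma pressure_le (A : R) n : (forall a b x, `|S a b x| <= A) -> `|pressure n| <= 39 * A.
Proof.
move=> SA; have := stress_size_le n SA.
have : 0 <= stress_size n by exact: le_trans (stress_size_ge 0 0 n).
have := SA 0 0 (corner n); have := SA 1 1 (corner n); have := SA 2 2 (corner n).
rewrite /pressure sum3 !ler_norml => /andP[? ?] /andP[? ?] /andP[? ?] ? ?; apply/andP; split; lra.
Qed.

Lemma amplitude_sum n a b : (forall a b x, S a b x = S b a x) ->
  \sum_w amplitude w n * (xi_ R w a * xi_ R w b) = - S a b (corner n) + (a == b)%:R * pressure n.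
Proof. by move=> sS; exact: (amplitude_identity (stress_size n) (Q := fun a b => S a b (corner n))). Qed.

Lemma corner_periodic (T : Type) (f : space3 R -> T) : (0 < N)%N ->
  (forall i x, f (x + unit_vector i) = f x) -> forall i n, f (corner (fun j => n j + N%:Z * (i == j)%:R)) = f (corner n).
Proof.
move=> N0 pf i n; rewrite -(pf i (corner n)); congr f.
have E (z : int) (b : bool) : (z + N%:Z * b%:R)%:~R / N%:R = z%:~R / N%:R + b%:R :> R.
  rewrite intrD mulrDl; congr (_ + _); rewrite intrM; case: b => /=; last by rewrite mulr0 mul0r.
  by rewrite mulr1 divff// pnatr_eq0 -lt0n.
by rewrite /corner !E; elim/ord3_ind: i.
Qed.

Hypotheses (N0 : (0 < N)%N) (pS : forall a b, torus_periodic (S a b)).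

Lemma amplitude_periodic w : cell_periodic N (amplitude w).
Proof.
move=> i n; rewrite /amplitude /stress_size.
have E a b := corner_periodic N0 (pS a b) i n.
rewrite !E; congr (_ + _ - _); apply: eq_bigr => a _; apply: eq_bigr => b _; by rewrite E.
Qed.

Lemma pressure_periodic : cell_periodic N pressure.
Proof.
move=> i n; rewrite /pressure /stress_size.
have E a b := corner_periodic N0 (pS a b) i n.
congr (_ * _ + _); last by apply: eq_bigr => a _; rewrite E.
by apply: eq_bigr => a _; apply: eq_bigr => b _; rewrite E.
Qed.

End Amplitudes.

Lemma corner_near j x : (0 < N)%N -> `|co j x - co j (corner (cell N x))| <= N%:R^-1.
Proof.
move=> N0; have n0 : 0 < (N%:R : R) by rewrite ltr0n.
rewrite co_corner /cell; set y := N%:R * co j x.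
have -> : co j x = y / N%:R by rewrite /y mulrC mulrA mulVf ?mul1r// gt_eqF.
rewrite -mulrBl normrM [X in _ * X]gtr0_norm ?invr_gt0// ler_piMl ?invr_ge0 ?ltW//.
have /andP[h0 h1] := fpart_itv y.
by rewrite -/(fpart y) ger0_norm// ltW.
Qed.

(** [f] varies at frequency Lam and the cells have side 1/(K Lam), so freezing costs a factor
    1/K. *)
Lemma corner_lipschitz (A : R) f x : (0 < K)%N -> (0 < Lam)%N -> bC1 A Lam%:R f ->
  `|f x - f (corner (cell N x))| <= 3 * A / k.
Proof.
move=> K0 L0 bf; have N0 : (0 < N)%N by rewrite muln_gt0 K0.
have A0 := bC1_ge0 bf.
apply: (le_trans (bC1_lipschitz _ _ bf)).
have -> : 3 * A / k = A * Lam%:R * (3 * N%:R^-1).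
  by rewrite natrM; field; rewrite !pnatr_eq0 -!lt0n K0 L0.
apply: ler_wpM2l; first by rewrite mulr_ge0.
have := corner_near 0 x N0; have := corner_near 1 x N0; have := corner_near 2 x N0.
rewrite /dist3; lra.
Qed.

End Stage.

(** * Uniform and gradient bounds for the constituents of a stage *)

Section StepBounds.
Context (R : realType).
Local Notation W := (wave_const R).
Local Notation Bd := (2 * spline_bound R).
Implicit Types (x : space3 R).

Let Bd1 : 1 <= Bd. Proof. have := spline_bound_ge1 R; lra. Qed.

Lemma wave_const_ge : 64 * Bd ^+ 6 <= W.
Proof. by rewrite /wave_const ler_peMr ?profile_C_ge1// mulr_ge0// exprn_ge0// (le_trans _ Bd1). Qed.

Lemma wave_const_ge64 : 64 <= W.
Proof. by apply: le_trans wave_const_ge; rewrite ler_peMr// exprn_ege1. Qed.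

Lemma bC1_mulr (K L c : R) f : `|c| <= 1 -> bC1 K L f -> bC1 K L (fun x => f x * c).
Proof.
move=> c1 bf; have K0 := bC1_ge0 bf; have := bC1Z c bf.
rewrite (_ : (fun x => c * f x) = (fun x => f x * c)); last by apply/funext => x; rewrite mulrC.
move=> [Cf pf fK dfK]; split=> // [x|i x].
  by apply: (le_trans (fK x)); exact: ler_piMl.
apply: (le_trans (dfK i x)); rewrite -mulrA; apply: ler_piMl => //.
by have [_ _ _ h] := bf; exact: le_trans (normr_ge0 _) (h 0 (0, 0, 0)).
Qed.

Lemma bC1_cross (K L : R) (d : vfield R) w a : (forall k, bC1 K L (d k)) ->
  bC1 (K + K) L (fun x => cross (fun k => d k x) (eta_ R w) a).
Proof. by move=> bd; apply: bC1B; apply: bC1_mulr => //; exact: eta_norm. Qed.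

Variables (K Lam : nat) (K12 : (12 <= K)%N) (Lam0 : (0 < Lam)%N).
Local Notation N := (K * Lam)%N.
Local Notation k := (K%:R : R).
Local Notation Int f := (\int[volume]_(x in cube) f x).
Variables (G_ h_ : bool -> nat -> R -> R).
Hypothesis sheets : forall b, sheet k (G_ b) (h_ b).
Variables (A dl kap : R) (B : vfield R) (S : 'I_3 -> 'I_3 -> space3 R -> R).
Hypotheses (A1 : 1 <= A) (rel : relaxed A Lam%:R dl kap B S).

Definition step_amp w := amplitude K Lam S w.
Definition step_dF (w : 'I_3 * bool) : vfield R := wave_dpot K N (G_ w.2) w.1 (step_amp w).
Definition step_ddP (w : 'I_3 * bool) := stress_ddpot K N (h_ w.2) w.1 (step_amp w).
Definition step_pressure x := step_prod N (pressure K Lam S) (fun=> cutoff2 K) mi0 x.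
Definition step_wave : vfield R := wave_field (eta_ R) step_dF.
Definition step_field : vfield R := new_field (eta_ R) step_dF B.
Definition step_stress := new_stress (eta_ R) step_dF step_ddP step_pressure B S.

Let N0 : (0 < N)%N. Proof. by rewrite muln_gt0 Lam0 (leq_trans _ K12). Qed.
Let k12 : 12 <= k. Proof. by rewrite ler_nat. Qed.
Let k1 : 1 <= k. Proof. by apply: le_trans k12; rewrite ler1n. Qed.
Let k0 : 0 < k. Proof. exact: lt_le_trans k12. Qed.
Let pS a b : torus_periodic (S a b). Proof. by have [_ + _ _] := relaxed_stress rel a b. Qed.
Let S_le a b x : `|S a b x| <= A ^+ 2. Proof. by have [_ _ + _] := relaxed_stress rel a b; exact. Qed.
Let c0 w n : 0 <= step_amp w n. Proof. exact: amplitude_ge0. Qed.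
Let cA w n : step_amp w n <= (4 * A) ^+ 2. Proof. exact: amplitude_le_sqr. Qed.
Let pc w : cell_periodic N (step_amp w). Proof. exact: amplitude_periodic. Qed.
Let A0 : 0 < A. Proof. exact: lt_le_trans A1. Qed.
Let s0 : 0 <= 4 * A. Proof. by rewrite mulr_ge0 ?ltW. Qed.

Lemma step_dF_bC1 w a : bC1 (W * (4 * A * k)) (N%:R * k ^+ 4) (step_dF w a).
Proof.
apply: (bC1_intro (wave_dpot_C1 N K12 (sheets w.2) w.1 (step_amp w) a)).
- exact: wave_dpot_periodic.
- by move=> x; exact: (wave_dpot_bound N K12 (sheets w.2) w.1 s0 (cA w)).
- by move=> i x; exact: (wave_ddpot_bound K12 N0 (sheets w.2) w.1 s0 (cA w)).
Qed.

Lemma step_ddP_bC1 w a b : bC1 (W * ((4 * A) ^+ 2 * k ^+ 2)) (N%:R * k ^+ 4) (step_ddP w a b).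
Proof.
apply: (bC1_intro (stress_ddpot_C1 N K12 (sheets w.2) w.1 (step_amp w) a b)).
- exact: stress_ddpot_periodic.
- by move=> x; exact: (stress_ddpot_bound N K12 (sheets w.2) w.1 (c0 w) (cA w)).
- by move=> i x; exact: (stress_dddpot_bound K12 N0 (sheets w.2) w.1 (c0 w) (cA w)).
Qed.

Let X2_bound : jet_bound 3 (@cutoff2 R K) (Bd * Bd) (k + k).
Proof.
have Bd0 : 0 <= Bd by exact: le_trans Bd1.
by apply: jet_mul_bound => //; exact: (cutoff_bound (ltW k0)).
Qed.

Let X2_jet : jet 3 (@cutoff2 R K). Proof. exact: (jet_mulP (leqnn 3) (cutoff_jet k) (cutoff_jet k)). Qed.
Let X2_vanish : vanish_ends 3 (@cutoff2 R K). Proof. exact: (vanish_jet_mul _ (cutoff_vanish k12)). Qed.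

Lemma step_pressure_bC1 : bC1 (W * A ^+ 2) (N%:R * k ^+ 4) step_pressure.
Proof.
have C := step_prod_C1 N (pressure K Lam S) (al := mi0) (fun=> X2_jet) (fun=> X2_vanish) (fun=> isT).
have Bd0 : 0 <= Bd by exact: le_trans Bd1.
have pA n : `|pressure K Lam S n| <= 39 * A ^+ 2 by exact: pressure_le.
have bnd al x : (forall j, (al j <= 3)%N) -> `|step_prod N (pressure K Lam S) (fun=> cutoff2 K) al x| <=
   39 * A ^+ 2 * (Bd * Bd * (k + k) ^+ al 0 * ((Bd * Bd) ^+ 2 * (k + k) ^+ (\sum_(j | j != 0) al j))).
  have Q0 : 0 <= Bd * Bd by exact: mulr_ge0.
  have kk0 : 0 <= k + k by rewrite addr_ge0 ?ltW.
  move=> al3; apply: (@step_prod_bound _ 0 N 3 _ _ _ _ _ _ (fun n => Bd * Bd * (k + k) ^+ n)) => //.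
  - by move=> *; exact: X2_bound.
have E n m : 39 * A ^+ 2 * (Bd * Bd * (k + k) ^+ n * ((Bd * Bd) ^+ 2 * (k + k) ^+ m)) =
    39 * Bd ^+ 6 * (A ^+ 2 * (k + k) ^+ (n + m)).
  by rewrite exprD; move: (k + k) => y; move: (2 * _) => z; ring.
have W39 y : 0 <= y -> 39 * Bd ^+ 6 * y <= W * y.
  move=> y0; apply: ler_wpM2r => //; apply: le_trans wave_const_ge; apply: ler_wpM2r; first exact: exprn_ge0.
  lra.
have A20 : 0 <= A ^+ 2 by exact: sqr_ge0.
apply: (bC1_intro C).
- exact/step_prod_periodic/pressure_periodic.
- move=> x; apply: (le_trans (bnd mi0 x (fun=> isT))); rewrite E big1 ?addn0 ?expr0 ?mulr1//; exact: W39.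
- move=> i x; rewrite normrM ger0_norm//.
  have le1 j : ((mi0 j + (i == j)) <= 3)%N by case: (i == j).
  rewrite [X in _ <= X]mulrCA; apply: ler_wpM2l; first by [].
  apply: (le_trans (bnd (fun j => (mi0 j + (i == j))%N) x le1)); rewrite E.
  have -> : (mi0 (0%R : 'I_3) + (i == (0%R : 'I_3)) + \sum_(j < 3 | j != (0%R : 'I_3)) (mi0 j + (i == j)))%N = 1%N.
    have -> : (\sum_(j < 3 | j != (0%R : 'I_3)) (mi0 j + (i == j)))%N = (i != (0%R : 'I_3)).
      by rewrite -(sum_mi1 i 0); apply: eq_bigr.
    by rewrite /mi0; case: (i == _).
  apply: le_trans (W39 _ _) _; first by rewrite mulr_ge0// exprn_ge0// addr_ge0// ltW.
  rewrite -[leRHS]mulrA; apply: ler_wpM2l; first by have := wave_const_ge64; lra.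
  apply: ler_wpM2l => //; rewrite expr1.
  have k_dbl : k + k <= k * k.
    have k2 : 2 <= k by apply: le_trans k12; rewrite ler_nat.
    have -> : k + k = 2 * k by ring.
    by apply: ler_wpM2r => //; exact: ltW.
  apply: (@le_trans _ _ (k * k)); first by apply: k_dbl.
  by rewrite -expr2 ler_weXn2l.
Qed.

End StepBounds.

Section StepRelaxed.
Context (R : realType).
Local Notation W := (wave_const R).
Local Notation Bd := (2 * spline_bound R).
Implicit Types (x : space3 R).
Variables (K Lam : nat) (K12 : (12 <= K)%N) (Lam0 : (0 < Lam)%N).
Local Notation N := (K * Lam)%N.
Local Notation k := (K%:R : R).
Local Notation Int f := (\int[volume]_(x in cube) f x).
Variables (G_ h_ : bool -> nat -> R -> R).
Hypothesis sheets : forall b, sheet k (G_ b) (h_ b).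
Variables (A dl kap : R) (B : vfield R) (S : 'I_3 -> 'I_3 -> space3 R -> R).
Hypotheses (A1 : 1 <= A) (rel : relaxed A Lam%:R dl kap B S).
Local Notation amp := (step_amp K Lam S).
Local Notation dF := (step_dF K Lam G_ S).
Local Notation ddP := (step_ddP K Lam h_ S).
Local Notation press := (step_pressure K Lam S).
Local Notation u := (step_wave K Lam G_ S).
Local Notation B' := (step_field K Lam G_ B S).
Local Notation S' := (step_stress K Lam G_ h_ B S).
Let N0 : (0 < N)%N. Proof. by rewrite muln_gt0 Lam0 (leq_trans _ K12). Qed.
Let k12 : 12 <= k. Proof. by rewrite ler_nat. Qed.
Let k1 : 1 <= k. Proof. by apply: le_trans k12; rewrite ler1n. Qed.
Let k0 : 0 < k. Proof. exact: lt_le_trans k12. Qed.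
Let A0 : 0 < A. Proof. exact: lt_le_trans A1. Qed.
Let W64 : 64 <= W. Proof. exact: wave_const_ge64. Qed.
Let W0 : 0 < W. Proof. exact: lt_le_trans W64. Qed.

Local Notation y := (A * k).
Let W1 : 1 <= W. Proof. by move: W64; lra. Qed.
Let y0 : 0 < y. Proof. exact: mulr_gt0. Qed.
Let Ay : A <= y. Proof. by rewrite ler_peMr// ltW. Qed.
Let y1 : 1 <= y. Proof. exact: le_trans Ay. Qed.
Let L0 : 0 <= N%:R * k ^+ 4. Proof. by rewrite mulr_ge0// exprn_ge0// ltW. Qed.
Let Lam_le : Lam%:R <= N%:R * k ^+ 4.
Proof.
rewrite natrM (mulrC k) -mulrA -exprS ler_peMr//; exact: exprn_ege1.
Qed.

Let bdF w a : bC1 (4 * W * y) (N%:R * k ^+ 4) (dF w a).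
Proof.
have := step_dF_bC1 K12 Lam0 sheets A1 rel w a.
by rewrite (_ : W * (4 * A * k) = 4 * W * y)//; ring.
Qed.

Let bddP w a b : bC1 (16 * W * y ^+ 2) (N%:R * k ^+ 4) (ddP w a b).
Proof.
have := step_ddP_bC1 K12 Lam0 sheets rel w a b.
by rewrite (_ : W * ((4 * A) ^+ 2 * k ^+ 2) = 16 * W * y ^+ 2)//; ring.
Qed.

Let card6 : #|{: 'I_3 * bool}| = 6%N. Proof. by rewrite card_prod card_ord card_bool. Qed.

Lemma step_wave_bC1 a : bC1 (48 * W * y) (N%:R * k ^+ 4) (u a).
Proof.
have M0 : 0 <= 4 * W * y + 4 * W * y by have Wy := mulr_ge0 (ltW W0) (ltW y0); lra.
have := bC1_sum M0 (fun w => bC1_cross w a (bdF w)).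
by rewrite card6 (_ : 6%:R * _ = 48 * W * y)//; ring.
Qed.

Lemma step_field_bC1 a : bC1 (W ^+ 2 * (A * k)) (2 * (N%:R * k ^+ 4)) (B' a).
Proof.
have bB := bC1_weaken (lexx _) Lam_le L0 (relaxed_field rel a).
have := bC1D bB (step_wave_bC1 a); apply: bC1_weaken; last by rewrite mulr_ge0.
- apply: (@le_trans _ _ (W * W * y)); last by rewrite -expr2.
  have h : 64 * (W * y) <= W * W * y by rewrite -mulrA ler_wpM2r// mulr_ge0// ltW.
  have h2 : y <= W * y by rewrite ler_peMl// ltW.
  have p := mulr_ge0 (ltW W0) (ltW y0).
  by move: Ay h h2 p; move: (A * k) => z; lra.
- by rewrite ler_peMl// ler1n.
Qed.

(** Only a bound of the order of the squared new field is claimed here: the new stress is small in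
    L^1, not uniformly. *)
Lemma step_stress_bC1 a b : bC1 ((W ^+ 2 * (A * k)) ^+ 2) (2 * (N%:R * k ^+ 4)) (S' a b).
Proof.
have L2 : N%:R * k ^+ 4 <= 2 * (N%:R * k ^+ 4) by rewrite ler_peMl// ler1n.
have L20 : 0 <= 2 * (N%:R * k ^+ 4) by rewrite mulr_ge0.
have bS := bC1_weaken (lexx _) (le_trans Lam_le L2) L20 (relaxed_stress rel a b).
have bB c := bC1_weaken (lexx _) Lam_le L0 (relaxed_field rel c).
have bBu := bC1M (bB a) (step_wave_bC1 b); have buB := bC1M (step_wave_bC1 a) (bB b).
have buu := bC1M (step_wave_bC1 a) (step_wave_bC1 b).
have bsym w : bC1 (4 * W * y + 4 * W * y) (N%:R * k ^+ 4) (sym_grad (eta_ R w) (dF w) a b).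
  apply: bC1D; first exact: bC1_mulr (eta_norm _ _ _) (bdF w a).
  rewrite (_ : (fun x => _) = (fun x => dF w b x * eta_ R w a)); last by apply/funext => x; rewrite mulrC.
  exact: bC1_mulr (eta_norm _ _ _) (bdF w b).
have bpot w := bC1_cross w a (fun c => bC1_cross w b (fun l => bddP w l c)).
have sum0 : 0 <= 4 * W * y + 4 * W * y + (16 * W * y ^+ 2 + 16 * W * y ^+ 2 + (16 * W * y ^+ 2 + 16 * W * y ^+ 2)).
  have Wy := mulr_ge0 (ltW W0) (ltW y0); have Wy2 := mulr_ge0 (ltW W0) (sqr_ge0 y).
  by move: Wy Wy2; rewrite -![_ * W * _]mulrA; move: (W * y) (W * y ^+ 2) => p q; lra.
have bsum := bC1_sum sum0 (fun w => bC1D (bsym w) (bpot w)).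
have bP := bC1Z (a == b)%:R (step_pressure_bC1 K12 Lam0 rel).
have bsp := bC1_weaken (lexx _) L2 L20 (bC1D bsum bP).
have := bC1B (bC1D (bC1D bS (bC1D bBu buB)) buu) bsp.
apply: bC1_weaken => //; rewrite card6.
move: y0 Ay y1 {bS bB bBu buB buu bsym bpot sum0 bsum bP bsp}; move: (A * k) => z z0 Az z1'.
have y2 : 0 <= z ^+ 2 by exact: sqr_ge0.
have A2y : A ^+ 2 <= z ^+ 2 by rewrite lerXn2r// nnegrE ltW.
have yy : z <= z ^+ 2 by rewrite expr2 ler_peMl// ltW.
have AWy : A * (48 * W * z) <= 48 * W * z ^+ 2.
  have Wz := mulr_ge0 (ltW W0) (ltW z0); rewrite (_ : 48 * W * z ^+ 2 = 48 * W * z * z); last by ring.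
  by rewrite mulrC; apply: ler_wpM2l => //; lra.
have Wy : W * z <= W * z ^+ 2 by rewrite ler_wpM2l// ltW.
have d1 : `|(a == b)%:R : R| <= 1 by case: (a == b); rewrite ?normr0 ?normr1.
have dP : `|(a == b)%:R : R| * (W * A ^+ 2) <= W * z ^+ 2.
  apply: (@le_trans _ _ (1 * (W * A ^+ 2))); first by apply: ler_wpM2r => //; rewrite mulr_ge0 ?sqr_ge0 ?ltW.
  by rewrite mul1r ler_wpM2l// ltW.
have z1 : 64 * (W * z ^+ 2) <= W ^+ 2 * z ^+ 2.
  by rewrite [W ^+ 2]expr2 -[leRHS]mulrA; apply: ler_wpM2r => //; rewrite mulr_ge0// ltW.
have z2 : 64 * z ^+ 2 <= W * z ^+ 2 by apply: ler_wpM2r.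
have z3 : 64 * 64 * (W ^+ 2 * z ^+ 2) <= W ^+ 2 * (W ^+ 2 * z ^+ 2).
  apply: ler_wpM2r; first by rewrite mulr_ge0 ?sqr_ge0.
  by rewrite [W ^+ 2]expr2; apply: ler_pM.
have -> : (W ^+ 2 * z) ^+ 2 = W ^+ 2 * (W ^+ 2 * z ^+ 2) by ring.
have -> : (48 * W * z) * (48 * W * z) = 2304 * (W ^+ 2 * z ^+ 2) by ring.
have : (48 * W * z) * A <= 48 * W * z ^+ 2 by rewrite mulrC.
move: z3 z2 z1 dP Wy AWy yy A2y y2.
move: (W ^+ 2 * (W ^+ 2 * z ^+ 2)) => t1; move: (W ^+ 2 * z ^+ 2) => t2.
lra.
Qed.

End StepRelaxed.

(** * Algebra of the new stress at a fixed point *)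

Section Pointwise.
Context (R : realType).
Local Notation wave := ('I_3 * bool)%type.
Local Notation eta := (eta_ R).
Local Notation xi := (xi_ R).
Variables (m q c : wave -> R) (D : wave -> 'I_3 -> R) (Q : wave -> 'I_3 -> 'I_3 -> R).
Variables (E e1 e2 p : R) (T : 'I_3 -> 'I_3 -> R).
Hypothesis Dm : forall w a, `|D w a - (a == w.1)%:R * m w| <= e1.
Hypothesis Qq : forall w a b, `|Q w a b - (a == w.1)%:R * (b == w.1)%:R * q w| <= e2.
Hypothesis mq : forall w, m w ^+ 2 = q w + c w * E ^+ 2.
Hypothesis cT : forall a b, \sum_w c w * (xi w a * xi w b) = - T a b + (a == b)%:R * p.

Definition velocity a := \sum_w cross (D w) (eta w) a.
Definition main_velocity a := \sum_w m w * xi w a.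
Local Notation U := velocity.
Local Notation V := main_velocity.
Local Notation M := (\sum_w `|m w|).

Lemma sum_wave_cst (r : R) : \sum_(w : wave) r = 6 * r.
Proof. by rewrite sumr_const card_prod card_ord card_bool mulr_natl. Qed.

Lemma sum_wave_le (f : wave -> R) (r : R) : (forall w, `|f w| <= r) -> `|\sum_w f w| <= 6 * r.
Proof.
move=> fr; apply: (le_trans (ler_norm_sum _ _ _)).
apply: (@le_trans _ _ (\sum_(w : wave) r)); first by apply: ler_sum => w _.
by rewrite sum_wave_cst.
Qed.

Lemma velocity_near a : `|U a - V a| <= 12 * e1.
Proof.
rewrite /U /V -sumrB; have -> : 12 * e1 = 6 * (e1 + e1) by ring.
apply: sum_wave_le => w; rewrite -cross_delta.
rewrite (_ : _ - _ = cross (fun k => D w k - (k == w.1)%:R * m w) (eta w) a).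
  exact: cross_norm.
by rewrite /cross; ring.
Qed.

Lemma main_velocity_le a : `|V a| <= M.
Proof.
apply: (le_trans (ler_norm_sum _ _ _)); apply: ler_sum => w _.
by rewrite normrM ler_piMr// xi_norm.
Qed.

Lemma stress_near a b :
  `|\sum_w cross (fun k => cross (fun l => Q w l k) (eta w) b) (eta w) a - \sum_w q w * (xi w a * xi w b)| <= 24 * e2.
Proof.
rewrite -sumrB; have -> : 24 * e2 = 6 * ((e2 + e2) + (e2 + e2)) by ring.
apply: sum_wave_le => w; rewrite -!cross_delta.
rewrite (_ : _ - _ = cross (fun k => cross (fun l => Q w l k - (l == w.1)%:R * (k == w.1)%:R * q w) (eta w) b) (eta w) a).
  by apply: cross_norm => k; exact: cross_norm.
by rewrite /cross; ring.
Qed.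

Lemma off_diagonal a b : `|V a * V b - \sum_w m w ^+ 2 * (xi w a * xi w b)| <=
  \sum_w \sum_(w' | w' != w) `|m w| * `|m w'|.
Proof.
rewrite /V big_distrlr /= -sumrB; apply: (le_trans (ler_norm_sum _ _ _)).
apply: ler_sum => w _; rewrite (bigD1 w)//= addrAC.
rewrite (_ : _ - _ = 0) ?add0r; last by ring.
apply: (le_trans (ler_norm_sum _ _ _)); apply: ler_sum => w' _.
rewrite mulrACA !normrM ler_piMr ?mulr_ge0//.
by rewrite -[leRHS]mulr1; apply: ler_pM => //; exact: xi_norm.
Qed.

Variables (Sab Ba Bb A t1 t2 : R) (a b : 'I_3).
Hypotheses (ST : `|Sab - T a b| <= t1) (ET : `|1 - E ^+ 2| * `|T a b| <= t2) (BA : `|Ba| <= A) (BbA : `|Bb| <= A).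

Lemma new_stress_le :
  `|Sab + (Ba * U b + U a * Bb) + U a * U b -
    (\sum_w ((D w a * eta w b + eta w a * D w b) +
       cross (fun k => cross (fun l => Q w l k) (eta w) b) (eta w) a) + (a == b)%:R * (p * E ^+ 2))| <=
  t1 + t2 + 2 * A * (M + 12 * e1) + \sum_w \sum_(w' | w' != w) `|m w| * `|m w'| +
  24 * e1 * M + 144 * e1 ^+ 2 + (2 * M + 12 * e1) + 24 * e2.
Proof.
have e10 : 0 <= e1 := le_trans (normr_ge0 _) (Dm (0, true) 0).
have M0 : 0 <= M by exact: sumr_ge0.
have A0 : 0 <= A := le_trans (normr_ge0 _) BA.
set X := \sum_w \sum_(w' | _) _.
have UM d : `|U d| <= M + 12 * e1.
  rewrite -(subrK (V d) (U d)) addrC; apply: (le_trans (ler_normD _ _)).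
  by apply: lerD; [exact: main_velocity_le|exact: velocity_near].
have h1 : `|Ba * U b| <= A * (M + 12 * e1) by rewrite normrM ler_pM.
have h2 : `|U a * Bb| <= A * (M + 12 * e1) by rewrite normrM mulrC ler_pM.
have h3 : `|(U a - V a) * V b| <= 12 * e1 * M.
  by rewrite normrM ler_pM//; [exact: velocity_near|exact: main_velocity_le].
have h4 : `|V a * (U b - V b)| <= 12 * e1 * M.
  by rewrite normrM mulrC ler_pM//; [exact: velocity_near|exact: main_velocity_le].
have h5 : `|(U a - V a) * (U b - V b)| <= 12 * e1 * (12 * e1).
  by rewrite normrM ler_pM//; exact: velocity_near.
have h6 : `|\sum_w (D w a * eta w b + eta w a * D w b)| <= 2 * M + 12 * e1.
  have De w d : `|D w d| <= `|m w| + e1.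
    rewrite -(subrK ((d == w.1)%:R * m w) (D w d)) addrC; apply: (le_trans (ler_normD _ _)); apply: lerD => //.
    by case: (d == w.1); rewrite ?mul1r// mul0r normr0.
  apply: (le_trans (ler_norm_sum _ _ _)).
  apply: (@le_trans _ _ (\sum_w (2 * `|m w| + 2 * e1))).
    apply: ler_sum => w _; apply: (le_trans (ler_normD _ _)); rewrite !normrM.
    have := De w a; have := De w b => db da.
    have i1 : `|D w a| * `|eta w b| <= `|D w a| by rewrite ler_piMr// eta_norm.
    have i2 : `|eta w a| * `|D w b| <= `|D w b| by rewrite ler_piMl// eta_norm.
    lra.
  rewrite big_split /= -mulr_sumr sum_wave_cst lerD2l.
  lra.
have h7 := stress_near a b; have h8 := off_diagonal a b; rewrite -/X in h8.
have h9 : `|(1 - E ^+ 2) * T a b| <= t2 by rewrite normrM.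
have mm : \sum_w m w ^+ 2 * (xi w a * xi w b) = \sum_w q w * (xi w a * xi w b) + E ^+ 2 * (- T a b + (a == b)%:R * p).
  rewrite -cT mulr_sumr -big_split /=; apply: eq_bigr => w _; rewrite mq; ring.
rewrite big_split /=.
move: h7 h8 h6 mm; move: (\sum_w (D w a * _ + _)) (\sum_w cross _ _ _) (\sum_w q w * _) (\sum_w m w ^+ 2 * _) => y1 y2 y3 y4 h7 h8 h6 mm.
have -> : Sab + (Ba * U b + U a * Bb) + U a * U b - (y1 + y2 + (a == b)%:R * (p * E ^+ 2)) =
  (Sab - T a b) + (1 - E ^+ 2) * T a b + Ba * U b + U a * Bb + (V a * V b - y4) + (U a - V a) * V b + V a * (U b - V b)
  + (U a - V a) * (U b - V b) - y1 - (y2 - y3) by rewrite mm; ring.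
have e1e1 : 12 * e1 * (12 * e1) = 144 * e1 ^+ 2 by ring.
rewrite e1e1 in h5.
move: ST h9 h1 h2 h8 h3 h4 h5 h6 h7.
move: (Sab - T a b) ((1 - E ^+ 2) * T a b) (Ba * U b) (U a * Bb) (V a * V b - y4) ((U a - V a) * V b) (V a * (U b - V b)) ((U a - V a) * (U b - V b)) (y2 - y3) => ? ? ? ? ? ? ? ? ?.
rewrite !ler_norml => /andP[? ?] /andP[? ?] /andP[? ?] /andP[? ?] /andP[? ?] /andP[? ?] /andP[? ?] /andP[? ?] /andP[? ?] /andP[? ?].
apply/andP; split; lra.
Qed.

(** 12 = 2 * 6 by Cauchy-Schwarz for six waves and x^2 <= 2 v^2 + 2 (x - v)^2; likewise 288 = 2 *
    12^2. *)
Lemma velocity_sqr d : U d ^+ 2 <= 12 * (\sum_w m w ^+ 2) + 288 * e1 ^+ 2.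
Proof.
have e10 : 0 <= e1 := le_trans (normr_ge0 _) (Dm (0, true) 0).
have VV : V d ^+ 2 <= 6 * \sum_w m w ^+ 2.
  apply: (@le_trans _ _ (M ^+ 2)).
    by rewrite -(real_normK (num_real (V d))) lerXn2r// ?nnegrE ?sumr_ge0// main_velocity_le.
  rewrite expr2 big_distrlr /=.
  apply: (@le_trans _ _ (\sum_w \sum_w' ((m w ^+ 2 + m w' ^+ 2) / 2))).
    apply: ler_sum => w _; apply: ler_sum => w' _.
    rewrite -(real_normK (num_real (m w))) -(real_normK (num_real (m w'))).
    have := sqr_ge0 (`|m w| - `|m w'|); rewrite sqrrB; lra.
  have s1 w : \sum_w' ((m w ^+ 2 + m w' ^+ 2) / 2) = (6 * m w ^+ 2 + \sum_w m w ^+ 2) / 2.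
    by rewrite -sum_wave_cst -big_split mulr_suml.
  rewrite (eq_bigr _ (fun w _ => s1 w)).
  have s2 s : \sum_w ((6 * m w ^+ 2 + s) / 2) = (6 * \sum_w m w ^+ 2 + 6 * s) / 2.
    by rewrite -[in RHS](sum_wave_cst s) mulr_sumr -big_split mulr_suml.
  rewrite s2; lra.
have := velocity_near d; move: (U d) (V d) VV => x v VV.
rewrite ler_norml => /andP[h1 h2].
have h3 : (x - v) ^+ 2 <= (12 * e1) ^+ 2.
  by rewrite -(real_normK (num_real (x - v))) lerXn2r// ?nnegrE ?mulr_ge0// ler_norml h1.
have h4 : x ^+ 2 <= 2 * v ^+ 2 + 2 * (x - v) ^+ 2.
  rewrite -subr_ge0 (_ : _ - _ = (x - v - v) ^+ 2) ?sqr_ge0//; ring.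
have h5 : (12 * e1) ^+ 2 = 144 * e1 ^+ 2 by ring.
rewrite h5 in h3; lra.
Qed.

End Pointwise.

(** * The pointwise algebra applied to one stage *)

Section StepPointwise.
Context (R : realType).
Local Notation W := (wave_const R).
Local Notation Bd := (2 * spline_bound R).
Implicit Types (x : space3 R) (w : 'I_3 * bool).
Variables (K Lam : nat) (K12 : (12 <= K)%N) (Lam0 : (0 < Lam)%N).
Local Notation N := (K * Lam)%N.
Local Notation k := (K%:R : R).
Local Notation Int f := (\int[volume]_(x in cube) f x).
Variables (G_ h_ : bool -> nat -> R -> R).
Hypothesis sheets : forall b, sheet k (G_ b) (h_ b).
Variables (A dl kap : R) (B : vfield R) (S : 'I_3 -> 'I_3 -> space3 R -> R).
Hypotheses (A1 : 1 <= A) (rel : relaxed A Lam%:R dl kap B S).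
Local Notation amp := (step_amp K Lam S).
Let N0 : (0 < N)%N. Proof. by rewrite muln_gt0 Lam0 (leq_trans _ K12). Qed.
Let k12 : 12 <= k. Proof. by rewrite ler_nat. Qed.
Let k1 : 1 <= k. Proof. by apply: le_trans k12; rewrite ler1n. Qed.
Let k0 : 0 < k. Proof. exact: lt_le_trans k12. Qed.
Let A0 : 0 < A. Proof. exact: lt_le_trans A1. Qed.
Let W64 : 64 <= W. Proof. exact: wave_const_ge64. Qed.
Let W0 : 0 < W. Proof. exact: lt_le_trans W64. Qed.
Local Notation dF := (step_dF K Lam G_ S).
Local Notation ddP := (step_ddP K Lam h_ S).
Local Notation press := (step_pressure K Lam S).
Local Notation u := (step_wave K Lam G_ S).
Local Notation S' := (step_stress K Lam G_ h_ B S).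
Hypothesis disj : disjoint_profiles (G_ false) (G_ true).

Let Bd1 : 1 <= Bd. Proof. have := spline_bound_ge1 R; lra. Qed.
Let Bd0 : 0 <= Bd. Proof. exact: le_trans Bd1. Qed.
Let S_le a b x : `|S a b x| <= A ^+ 2. Proof. by have [_ _ + _] := relaxed_stress rel a b; exact. Qed.
Let c0 w n : 0 <= amp w n. Proof. exact: amplitude_ge0. Qed.
Let cA w n : amp w n <= (4 * A) ^+ 2. Proof. exact: amplitude_le_sqr. Qed.
Let s0 : 0 <= 4 * A. Proof. by rewrite mulr_ge0 ?ltW. Qed.

Definition sheet_trace (w : 'I_3 * bool) t : R := `|G_ w.2 1%N ((K ^ 2 * N)%:R * t)|.
Local Notation gam := sheet_trace.
Local Notation m w x := (wave_main K N (G_ w.2) w.1 (amp w) x).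
Local Notation E x := (envelope K N x).

(** The two arguments differ by an integer. The oscillation is thus a global function of one
    coordinate, unrelated to the cells, which makes Fubini applicable on the whole cube. *)
Lemma sheet_fpart w t : G_ w.2 1%N (k ^+ 2 * fpart (N%:R * t)) = G_ w.2 1%N ((K ^ 2 * N)%:R * t).
Proof.
have pG := sheet_perG (sheets w.2) 1; rewrite -[LHS](periodic1_int ((K ^ 2)%:Z * Num.floor (N%:R * t)) _ pG).
congr (G_ _ _ _); rewrite /fpart intrM -pmulrn !natrM ?natrX; ring.
Qed.

Let cut_le u : `|cutoff k 0 u| <= Bd.
Proof. by have := cutoff_bound (ltW k0) u (leq0n 3); rewrite expr0 mulr1. Qed.

Lemma envelope_le x : `|E x| <= Bd ^+ 3.
Proof.
rewrite /envelope prod3 !normrM !exprS expr0 mulr1 mulrA.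
by rewrite !ler_pM ?mulr_ge0// ?cut_le.
Qed.

Lemma envelope_sqr_le x : E x ^+ 2 <= Bd ^+ 6.
Proof.
rewrite -(real_normK (num_real (E x))) [leRHS](exprM Bd 3 2).
by rewrite lerXn2r// ?nnegrE ?exprn_ge0// envelope_le.
Qed.

Lemma wave_main_le w x : `|m w x| <= 4 * A * Bd ^+ 3 * gam w (co w.1 x).
Proof.
rewrite /wave_main sheet_fpart normrM /gam; apply: ler_wpM2r => //.
rewrite normrM; apply: ler_pM => //; last exact: envelope_le.
rewrite ger0_norm ?sqrtr_ge0//; apply: (le_trans (ler_wsqrtr (cA w _))).
by rewrite sqrtr_sqr ger0_norm.
Qed.

Lemma wave_main_sqr w x : m w x ^+ 2 =
  amp w (cell N x) * E x ^+ 2 * (G_ w.2 1%N (k ^+ 2 * fpart (N%:R * co w.1 x)) ^+ 2 - 1)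
  + amp w (cell N x) * E x ^+ 2.
Proof. rewrite /wave_main !exprMn sqr_sqrtr//; ring. Qed.

Lemma step_pressureE x : press x = pressure K Lam S (cell N x) * E x ^+ 2.
Proof.
rewrite /step_pressure /step_prod /envelope -prodrXl; congr (_ * _); apply: eq_bigr => j _.
by rewrite /cutoff2 /jet_mul /mi0 big_ord1 mul1r expr2.
Qed.

Lemma envelope_defect f x : (forall t, `|1 - cutoff k 0 (fpart t) ^+ 2| = f t) ->
  `|1 - E x ^+ 2| <= Bd ^+ 4 * \sum_j f (N%:R * co j x).
Proof.
move=> cf; rewrite /envelope prod3 sum3 -!cf.
have := cut_le (fpart (N%:R * co 0 x)); have := cut_le (fpart (N%:R * co 1 x)).
move: (cutoff k 0 (fpart (N%:R * co 0 x))) (cutoff k 0 (fpart (N%:R * co 1 x))) (cutoff k 0 (fpart (N%:R * co 2 x))) => a b c bB aB.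
have sq z : `|z| <= Bd -> `|z ^+ 2| <= Bd ^+ 2 by move=> zB; rewrite normrX lerXn2r// nnegrE.
have -> : 1 - (a * b * c) ^+ 2 = (1 - a ^+ 2) + a ^+ 2 * (1 - b ^+ 2) + a ^+ 2 * b ^+ 2 * (1 - c ^+ 2) by ring.
have B2 : 1 <= Bd ^+ 2 by exact: exprn_ege1.
have B4 : Bd ^+ 2 <= Bd ^+ 4 by rewrite ler_weXn2l.
have h1 : `|1 - a ^+ 2| <= Bd ^+ 4 * `|1 - a ^+ 2| by rewrite ler_peMl// (le_trans B2).
have h2 : `|a ^+ 2 * (1 - b ^+ 2)| <= Bd ^+ 4 * `|1 - b ^+ 2|.
  by rewrite normrM; apply: ler_wpM2r => //; apply: le_trans B4; exact: sq.
have h3 : `|a ^+ 2 * b ^+ 2 * (1 - c ^+ 2)| <= Bd ^+ 4 * `|1 - c ^+ 2|.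
  rewrite normrM; apply: ler_wpM2r => //; rewrite normrM -[4%N]/(2 + 2)%N exprD.
  by apply: ler_pM => //; exact: sq.
rewrite [leRHS]mulrDr [in leRHS]mulrDr; apply: (le_trans (ler_normD _ _)); apply: lerD => //.
by apply: (le_trans (ler_normD _ _)); apply: lerD.
Qed.

Lemma sheet_trace_disjoint w w' t : w != w' -> w.1 = w'.1 -> gam w t * gam w' t = 0.
Proof.
case: w w' => i [] [i' []] /= ne ii; rewrite /gam -normrM /=; move: ne; rewrite ii ?eqxx// => _.
  by rewrite mulrC disj ?normr0.
by rewrite disj ?normr0.
Qed.

Lemma sheet_trace_continuous w : continuous (gam w).
Proof.
have [_ /(_ 1%N isT) cG] := sheet_jetG (sheets w.2).
move=> t; apply: cvg_norm; apply: (@continuous_comp R R R (fun s => (K ^ 2 * N)%:R * s)); last exact: cG.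
exact: mulrl_continuous.
Qed.

Lemma sheet_trace_le w t : gam w t <= profile_C R * k.
Proof.
have := sheet_boundG (sheets w.2) ((K ^ 2 * N)%:R * t) (isT : (1 <= 2)%N).
rewrite (_ : profile_C R * k^-1 * _ = profile_C R * k)//.
by rewrite expr1; field; rewrite gt_eqF.
Qed.

Lemma int_sheet_trace w : \int[lebesgue R]_(t in `[0, 1]) gam w t <= profile_C R * k^-1.
Proof.
apply: le_trans (sheet_int (sheets w.2)).
have pG := sheet_perG (sheets w.2) 1.
rewrite (@periodic_integral_scale R (fun t => `|G_ w.2 1%N t|) (K ^ 2 * N)).
- exact: lexx.
- by rewrite muln_gt0 expn_gt0 (leq_trans _ K12).
- have [_ /(_ 1%N isT) cG] := sheet_jetG (sheets w.2).
  by move=> t; apply: cvg_norm; exact: cG.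
- by move=> t; rewrite pG.
Qed.

Let e1 := W * (4 * A * k ^- 2).
Let e2 := W * ((4 * A) ^+ 2 * k^-1).

Lemma step_stress_le f a b x : (forall t, `|1 - cutoff k 0 (fpart t) ^+ 2| = f t) ->
  `|S' a b x| <= 3 * A ^+ 2 / k + Bd ^+ 4 * (\sum_j f (N%:R * co j x)) * A ^+ 2 +
  2 * A * ((\sum_w `|m w x|) + 12 * e1) + \sum_w \sum_(w' | w' != w) `|m w x| * `|m w' x| +
  24 * e1 * (\sum_w `|m w x|) + 144 * e1 ^+ 2 + (2 * (\sum_w `|m w x|) + 12 * e1) + 24 * e2.
Proof.
move=> cf; have K0 : (0 < K)%N by exact: leq_trans K12.
have := @new_stress_le R (fun w => m w x) _ (fun w => amp w (cell N x)) (fun w k => dF w k x)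
  (fun w a b => ddP w a b x) (E x) e1 e2 (pressure K Lam S (cell N x)) (fun a b => S a b (corner R K Lam (cell N x)))
  _ _ (fun w => wave_main_sqr w x) _ (S a b x) (B a x) (B b x) A (3 * A ^+ 2 / k)
  (Bd ^+ 4 * (\sum_j f (N%:R * co j x)) * A ^+ 2) a b.
rewrite -step_pressureE; apply.
- by move=> w c; exact: (wave_dpot_main N K12 (sheets w.2) w.1 s0 (cA w)).
- by move=> w c d; exact: (stress_ddpot_main N K12 (sheets w.2) w.1 (c0 w) (cA w)).
- by move=> c d; apply: amplitude_sum; exact: relaxed_sym rel.
- exact: corner_lipschitz (relaxed_stress rel a b).
- by apply: ler_pM => //; exact: envelope_defect.
- by have [_ _ + _] := relaxed_field rel a; exact.
- by have [_ _ + _] := relaxed_field rel b; exact.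
Qed.

(** The oscillating part of the squared waves is traded for diagonal entries of [ddP], exact second
    derivatives that will integrate to 0. What is left is amplitude times squared envelope, bounded
    by |S| up to the freezing error 3 A^2/K in each of nine entries. *)
Lemma step_wave_sqr a x : u a x ^+ 2 <= 12 * (\sum_w ddP w w.1 w.1 x) + 72 * e2 +
  144 * Bd ^+ 6 * (\sum_c \sum_d `|S c d x| + 27 * A ^+ 2 / k) + 288 * e1 ^+ 2.
Proof.
have := @velocity_sqr R (fun w => m w x) (fun w k => dF w k x) e1
  (fun w a => wave_dpot_main N K12 (sheets w.2) w.1 s0 (cA w) a x) a.
move=> /le_trans; apply; rewrite lerD2r.
have K0 : (0 < K)%N by exact: leq_trans K12.
have size_le : stress_size K Lam S (cell N x) <= \sum_c \sum_d `|S c d x| + 27 * A ^+ 2 / k.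
  rewrite (_ : 27 * A ^+ 2 / k = \sum_(c < 3) \sum_(d < 3) 3 * A ^+ 2 / k); last by rewrite !sum3; ring.
  rewrite -big_split /stress_size; apply: ler_sum => c _; rewrite -big_split; apply: ler_sum => d _ /=.
  have := corner_lipschitz x K0 Lam0 (relaxed_stress rel c d); rewrite distrC => h.
  rewrite -[in leLHS](subrK (S c d x) (S c d _)); apply: (le_trans (ler_normD _ _)).
  by rewrite [leLHS]addrC lerD2l.
have mle w : m w x ^+ 2 <= ddP w w.1 w.1 x + (e2 + 2 * Bd ^+ 6 * (\sum_c \sum_d `|S c d x| + 27 * A ^+ 2 / k)).
  rewrite wave_main_sqr addrA; apply: lerD.
    have := stress_ddpot_main N K12 (sheets w.2) w.1 (c0 w) (cA w) w.1 w.1 x.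
    rewrite eqxx !mul1r distrC => /(le_trans (ler_norm _)); rewrite lerBlDl; exact.
  rewrite mulrC [2 * Bd ^+ 6]mulrC -[leRHS]mulrA; apply: ler_pM => //; first exact: sqr_ge0.
    exact: envelope_sqr_le.
  apply: (le_trans (amplitude_le _ _ _ _ _)); exact: ler_wpM2l.
apply: (@le_trans _ _ (12 * \sum_w (ddP w w.1 w.1 x + (e2 + 2 * Bd ^+ 6 * (\sum_c \sum_d `|S c d x| + 27 * A ^+ 2 / k))))).
  by apply: ler_wpM2l => //; apply: ler_sum.
rewrite big_split /= sum_wave_cst; move: (Bd ^+ 6) e2 => b6 z; lra.
Qed.

End StepPointwise.

(** * Numerical inequalities for one stage *)

Section StageNumeric.
Context (R : realType).

(** [r] is 1/K, [M] the sum of the waves, [X] the sum over pairs of waves; [G], [G2], [F] stand for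
    the bare sheets, their products and the cutoff defect. The right side is affine in these three,
    so it can be integrated term by term. *)
Lemma stage_numeric (A W b B4 Cp r M G X G2 F : R) : 1 <= A -> 64 <= W -> 0 <= r -> r <= 1 ->
  M <= 4 * A * b * G -> X <= 16 * A ^+ 2 * b ^+ 2 * G2 -> M * r <= 24 * A * (b * Cp) ->
  b <= W -> b ^+ 2 <= W -> b * Cp <= W -> B4 <= W -> 0 <= G -> 0 <= G2 -> 0 <= F ->
  3 * A ^+ 2 * r + B4 * F * A ^+ 2 + 2 * A * (M + 12 * (W * (4 * A * r ^+ 2))) + X
   + 24 * (W * (4 * A * r ^+ 2)) * M + 144 * (W * (4 * A * r ^+ 2)) ^+ 2
   + (2 * M + 12 * (W * (4 * A * r ^+ 2))) + 24 * (W * ((4 * A) ^+ 2 * r)) <=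
  A ^+ 2 * ((3 + 528 * W + 4608 * W ^+ 2) * r + W * F + 16 * W * G + 16 * W * G2).
Proof.
move=> A1 W64 r0 r1 MG XG Mr bW b2W bCW BW G0 G20 F0.
have A0 : 0 <= A by lra. have W0 : 0 <= W by lra.
have a0 : 0 <= A ^+ 2 by exact: sqr_ge0.
have Aa : A <= A ^+ 2 by rewrite expr2 ler_peMl.
have rr : r ^+ 2 <= r by rewrite expr2 ler_piMl.
have r20 : 0 <= r ^+ 2 by exact: sqr_ge0.
have r4 : r ^+ 4 <= r.
  by apply: le_trans rr; rewrite (exprM r 2 2) [leLHS]expr2 ler_piMl// (le_trans _ r1)// expr2 ler_piMl.
have t1 : B4 * F * A ^+ 2 <= A ^+ 2 * (W * F) by rewrite mulrC ler_wpM2l// ler_wpM2r.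
have bG : b * G <= W * G by rewrite ler_wpM2r.
have MW : M <= 4 * (A * (W * G)).
  by apply: (le_trans MG); rewrite -!mulrA ler_wpM2l// ler_wpM2l.
have MWa : M <= 4 * (A ^+ 2 * (W * G)).
  by apply: (le_trans MW); rewrite ler_wpM2l// ler_wpM2r// mulr_ge0.
have t2 : A * M <= 4 * (A ^+ 2 * (W * G)).
  apply: (le_trans (ler_wpM2l A0 MW)).
  by rewrite (_ : A * (4 * (A * (W * G))) = 4 * (A ^+ 2 * (W * G)))//; ring.
have t3 : X <= 16 * (A ^+ 2 * (W * G2)).
  apply: (le_trans XG); rewrite (_ : _ * G2 = 16 * A ^+ 2 * (b ^+ 2 * G2)); last by ring.
  rewrite (_ : 16 * (A ^+ 2 * _) = 16 * A ^+ 2 * (W * G2)); last by ring.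
  by apply: ler_wpM2l; [rewrite mulr_ge0|exact: ler_wpM2r].
have WA0 : 0 <= W * A by rewrite mulr_ge0. have Wa0 : 0 <= W * A ^+ 2 by rewrite mulr_ge0.
have t4 : W * A ^+ 2 * r ^+ 2 <= W * A ^+ 2 * r by rewrite ler_wpM2l.
have t5 : W * A * r ^+ 2 <= W * A ^+ 2 * r by rewrite ler_pM// ler_wpM2l.
have t6 : W * A * r ^+ 2 * M <= 24 * (W ^+ 2 * A ^+ 2 * r).
  rewrite (_ : W * A * r ^+ 2 * M = W * A * r * (M * r)); last by ring.
  rewrite (_ : 24 * (W ^+ 2 * A ^+ 2 * r) = W * A * r * (24 * A * W)); last by ring.
  apply: ler_wpM2l; first by rewrite mulr_ge0.
  by apply: (le_trans Mr); rewrite ler_wpM2l// mulr_ge0.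
have t7 : W ^+ 2 * A ^+ 2 * r ^+ 4 <= W ^+ 2 * A ^+ 2 * r by rewrite ler_wpM2l// mulr_ge0 ?sqr_ge0.
set e1 := W * (4 * A * r ^+ 2).
have E1 : 3 * A ^+ 2 * r + B4 * F * A ^+ 2 + 2 * A * (M + 12 * e1) + X + 24 * e1 * M + 144 * e1 ^+ 2
   + (2 * M + 12 * e1) + 24 * (W * ((4 * A) ^+ 2 * r)) =
   3 * (A ^+ 2 * r) + B4 * F * A ^+ 2 + 2 * (A * M) + 96 * (W * A ^+ 2 * r ^+ 2) + X
   + 96 * (W * A * r ^+ 2 * M) + 2304 * (W ^+ 2 * A ^+ 2 * r ^+ 4)
   + 2 * M + 48 * (W * A * r ^+ 2) + 384 * (W * A ^+ 2 * r) by rewrite /e1; ring.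
have E2 : A ^+ 2 * ((3 + 528 * W + 4608 * W ^+ 2) * r + W * F + 16 * W * G + 16 * W * G2) =
  3 * (A ^+ 2 * r) + 528 * (W * A ^+ 2 * r) + 4608 * (W ^+ 2 * A ^+ 2 * r) +
  A ^+ 2 * (W * F) + 16 * (A ^+ 2 * (W * G)) + 16 * (A ^+ 2 * (W * G2)) by ring.
rewrite E1 E2; lra.
Qed.

(** As W >= 64, each further power of W absorbs a numerical factor 64. *)
Lemma stage_const_le (W s C : R) : 64 <= W -> 0 <= s -> s <= W -> 0 <= C -> C <= W ->
  3 + 528 * W + 4608 * W ^+ 2 + W * (150 * s) + 16 * W * (6 * C) + 16 * W * (36 * C ^+ 2) <= W ^+ 5.
Proof.
move=> W64 s0 sW C0 CW; have W0 : 0 <= W by lra.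
have h1 : W * s <= W ^+ 2 by rewrite expr2 ler_wpM2l.
have h2 : W * C <= W ^+ 2 by rewrite expr2 ler_wpM2l.
have h3 : W * C ^+ 2 <= W ^+ 3 by rewrite [leRHS]exprS ler_wpM2l// lerXn2r// nnegrE.
have h4 : 64 * W <= W ^+ 2 by rewrite expr2 ler_wpM2r.
have h5 : 64 * W ^+ 2 <= W ^+ 3 by rewrite [leRHS]exprS ler_wpM2r// sqr_ge0.
have h6 : 64 * W ^+ 3 <= W ^+ 4 by rewrite [leRHS]exprS ler_wpM2r// exprn_ge0.
have h7 : 64 * W ^+ 4 <= W ^+ 5 by rewrite [leRHS]exprS ler_wpM2r// exprn_ge0.
lra.
Qed.

Lemma stage_const2_le (W b a r dl : R) : 64 <= W -> 0 <= a -> 0 <= r -> r <= 1 -> 0 <= dl ->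
  64 * b <= W ->
  72 * (W * (16 * a * r)) + 144 * b * (9 * dl + 27 * a * r) + 288 * (16 * W ^+ 2 * a * r ^+ 4) <=
  W ^+ 5 * (dl + a * r).
Proof.
move=> W64 a0 r0 r1 dl0 bW; have W0 : 0 <= W by lra.
have ar0 : 0 <= a * r by rewrite mulr_ge0.
have h4 : 64 * W <= W ^+ 2 by rewrite expr2 ler_wpM2r.
have h5 : 64 * W ^+ 2 <= W ^+ 3 by rewrite [leRHS]exprS ler_wpM2r// sqr_ge0.
have h6 : 64 * W ^+ 3 <= W ^+ 4 by rewrite [leRHS]exprS ler_wpM2r// exprn_ge0.
have h7 : 64 * W ^+ 4 <= W ^+ 5 by rewrite [leRHS]exprS ler_wpM2r// exprn_ge0.
have r4 : r ^+ 4 <= r.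
  by rewrite exprS ler_piMr// exprn_ile1.
have h8 : W ^+ 2 * a * r ^+ 4 <= W ^+ 2 * a * r by rewrite ler_wpM2l// mulr_ge0// sqr_ge0.
have h9 : 0 <= (W - 64 * b) * dl by rewrite mulr_ge0// subr_ge0.
have h10 : 0 <= (W - 64 * b) * (a * r) by rewrite mulr_ge0// subr_ge0.
have h15 : 5040 * W + 4608 * W ^+ 2 <= W ^+ 5.
  move: W0 h4 h5 h6 h7; move: (W ^+ 5) (W ^+ 4) (W ^+ 3) (W ^+ 2); clear => *; lra.
have h16 : 1300 * W <= W ^+ 5.
  move: W0 h4 h5 h6 h7; move: (W ^+ 5) (W ^+ 4) (W ^+ 3) (W ^+ 2); clear => *; lra.
have h11 : 1300 * W * dl <= W ^+ 5 * dl by apply: ler_wpM2r; [exact: dl0|exact: h16].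
have h12 : (5040 * W + 4608 * W ^+ 2) * (a * r) <= W ^+ 5 * (a * r) by apply: ler_wpM2r; [exact: ar0|exact: h15].
have h13 : 0 <= W * dl by rewrite mulr_ge0.
have h14 : 0 <= W * (a * r) by rewrite mulr_ge0.
move: h8 h9 h10 h11 h12 h13 h14; clear; lra.
Qed.

End StageNumeric.

(** * The new stress in L^1 *)

Section StageIntegrals.
Context (R : realType).
Local Notation W := (wave_const R).
Local Notation Bd := (2 * spline_bound R).
Implicit Types (x : space3 R) (w : 'I_3 * bool).
Variables (K Lam : nat) (K12 : (12 <= K)%N) (Lam0 : (0 < Lam)%N).
Local Notation N := (K * Lam)%N.
Local Notation k := (K%:R : R).
Local Notation Int f := (\int[volume]_(x in cube) f x).
Variables (G_ h_ : bool -> nat -> R -> R).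
Hypothesis sheets : forall b, sheet k (G_ b) (h_ b).
Variables (A dl kap : R) (B : vfield R) (S : 'I_3 -> 'I_3 -> space3 R -> R).
Hypotheses (A1 : 1 <= A) (rel : relaxed A Lam%:R dl kap B S).
Local Notation amp := (step_amp K Lam S).
Local Notation dF := (step_dF K Lam G_ S).
Local Notation ddP := (step_ddP K Lam h_ S).
Local Notation press := (step_pressure K Lam S).
Local Notation u := (step_wave K Lam G_ S).
Local Notation S' := (step_stress K Lam G_ h_ B S).
Let N0 : (0 < N)%N. Proof. by rewrite muln_gt0 Lam0 (leq_trans _ K12). Qed.
Let k12 : 12 <= k. Proof. by rewrite ler_nat. Qed.
Let k1 : 1 <= k. Proof. by apply: le_trans k12; rewrite ler1n. Qed.
Let k0 : 0 < k. Proof. exact: lt_le_trans k12. Qed.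
Let A0 : 0 < A. Proof. exact: lt_le_trans A1. Qed.
Let W64 : 64 <= W. Proof. exact: wave_const_ge64. Qed.
Let W0 : 0 < W. Proof. exact: lt_le_trans W64. Qed.
Hypothesis disj : disjoint_profiles (G_ false) (G_ true).
Local Notation gam := (sheet_trace K Lam G_).
Local Notation Cp := (profile_C R).
Local Notation sb := (spline_bound R).
Local Notation r := (k^-1).
Local Notation m w x := (wave_main K N (G_ w.2) w.1 (amp w) x).

Let r0 : 0 <= r. Proof. by rewrite invr_ge0 ltW. Qed.
Let r1 : r <= 1. Proof. by rewrite invf_le1. Qed.
Let sb1 : 1 <= sb. Proof. exact: spline_bound_ge1. Qed.
Let Bd1 : 1 <= Bd. Proof. by move: sb1; lra. Qed.
Let Bd0 : 0 <= Bd. Proof. exact: le_trans Bd1. Qed.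
Let Cp1 : 1 <= Cp. Proof. exact: profile_C_ge1. Qed.
Let Cp0 : 0 <= Cp. Proof. exact: le_trans Cp1. Qed.
Let B6W : 64 * Bd ^+ 6 <= W. Proof. exact: wave_const_ge. Qed.
Let B61 : 1 <= Bd ^+ 6. Proof. exact: exprn_ege1. Qed.
Let B6W1 : Bd ^+ 6 <= W. Proof. by move: B6W B61; move: (Bd ^+ 6) => z; lra. Qed.
Let B3_6 : Bd ^+ 3 <= Bd ^+ 6. Proof. exact: ler_weXn2l. Qed.
Let sb2W : sb ^+ 2 <= W.
Proof.
apply: le_trans B6W1; apply: (@le_trans _ _ (Bd ^+ 2)); last exact: ler_weXn2l.
by rewrite lerXn2r// ?nnegrE ?(le_trans _ sb1)//; move: sb1; lra.
Qed.
Let bCW : Bd ^+ 3 * Cp <= W.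
Proof.
rewrite /wave_const; apply: ler_wpM2r => //; apply: (le_trans B3_6).
by move: B61; move: (Bd ^+ 6) => z; lra.
Qed.
Let CpW : Cp <= W.
Proof. by apply: le_trans bCW; rewrite ler_peMl// exprn_ege1. Qed.

Let pamp w : cell_periodic N (amp w).
Proof. by apply: amplitude_periodic => // b e; have [_ + _ _] := relaxed_stress rel b e. Qed.

Let bgam w j : cube_bounded (fun x => gam w (co j x)).
Proof.
apply: continuous_cube_bounded => x; apply: (@continuous_comp _ R R (co j) (gam w)).
  exact: continuous_co.
exact: (sheet_trace_continuous sheets).
Qed.

Let int_gam w : Int (fun x => gam w (co w.1 x)) <= Cp * r.
Proof.
rewrite cube_int_co; last exact: (sheet_trace_continuous sheets).
exact: (int_sheet_trace K12 Lam0 sheets).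
Qed.

Let gg w w' x : R := if w' != w then gam w (co w.1 x) * gam w' (co w'.1 x) else 0.

Let bgg w w' : cube_bounded (gg w w').
Proof. by rewrite /gg; case: (w' != w); [exact: cube_boundedM|exact: cube_bounded_cst]. Qed.

Let Cr0 : 0 <= Cp * r. Proof. exact: mulr_ge0. Qed.

Let int_gg w w' : Int (gg w w') <= (Cp * r) ^+ 2.
Proof.
rewrite /gg; case ne : (w' != w); last by rewrite cube_int_cst sqr_ge0.
(* Equal directions: disjoint supports. Different directions: independent coordinates. *)
have [ii|ii] := eqVneq w.1 w'.1.
  apply: (@le_trans _ _ 0); last exact: sqr_ge0.
  rewrite le_eqVlt; apply/orP; left; apply/eqP; apply: etrans (cube_int_cst 0).
  apply: eq_Rintegral => x _; rewrite -ii; apply: (sheet_trace_disjoint K Lam disj) => //.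
  by rewrite eq_sym ne.
rewrite (cube_int_co2 ii (sheet_trace_continuous sheets (w := w)) (sheet_trace_continuous sheets (w := w'))).
have h w0 := int_sheet_trace K12 Lam0 sheets w0.
by rewrite expr2 ler_pM// Rintegral_ge0// => t _; rewrite /sheet_trace.
Qed.

Lemma step_stress_int a b : Int (fun x => `|S' a b x|) <= W ^+ 5 * (A ^+ 2 / k).
Proof.
have [f [cf pf f0 fE] intf] := cutoff_defect k12.
pose G x := \sum_w gam w (co w.1 x); pose G2 x := \sum_w \sum_w' gg w w' x.
pose F x := \sum_j f (N%:R * co j x).
pose P x := A ^+ 2 * ((3 + 528 * W + 4608 * W ^+ 2) * r + W * F x + 16 * W * G x + 16 * W * G2 x).
have gam0 w t : 0 <= gam w t by exact: normr_ge0.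
have cfN : continuous (fun t : R => f (N%:R * t)).
  move=> t; apply: (@continuous_comp R R R (fun s => N%:R * s)); last exact: cf.
  exact: mulrl_continuous.
have bF j : cube_bounded (fun x => f (N%:R * co j x)).
  apply: continuous_cube_bounded => x; apply: (@continuous_comp _ R R (co j) (fun t : R => f (N%:R * t))).
    exact: continuous_co.
  exact: cfN.
have bFs : cube_bounded F by exact: cube_bounded_sum.
have bG : cube_bounded G by exact: cube_bounded_sum.
have bG2 : cube_bounded G2 by apply: cube_bounded_sum => w; exact: cube_bounded_sum.
have bc (c : R) := cube_bounded_cst (c : R).
have bZ (c : R) g : cube_bounded g -> cube_bounded (fun x => c * g x).
  by move=> bg; exact: (cube_boundedM (bc c) bg).
have bP : cube_bounded P.
  apply: (bZ); apply: cube_boundedD; last exact: bZ.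
  by apply: cube_boundedD; [apply: cube_boundedD => //; exact: bZ|exact: bZ].
have bS' : cube_bounded (S' a b) by exact: bC1_cube_bounded (step_stress_bC1 K12 Lam0 sheets A1 rel a b).
have SP x : `|S' a b x| <= P x.
  apply: (le_trans (step_stress_le K12 Lam0 sheets A1 rel a b x fE)).
  rewrite -exprVn.
  have MG : \sum_w `|m w x| <= 4 * A * Bd ^+ 3 * G x.
    rewrite /G mulr_sumr; apply: ler_sum => w _; exact: (wave_main_le K12 sheets A1 rel).
  apply: (@stage_numeric R A W (Bd ^+ 3) (Bd ^+ 4) Cp r _ (G x) _ (G2 x) (F x)) => //.
  - rewrite /G2 mulr_sumr; apply: ler_sum => w _; rewrite mulr_sumr [leLHS]big_mkcond.
    apply: ler_sum => w' _; rewrite /gg; case: ifP => _; last by rewrite mulr0.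
    rewrite (_ : 16 * A ^+ 2 * (Bd ^+ 3) ^+ 2 * _ = (4 * A * Bd ^+ 3 * gam w (co w.1 x)) * (4 * A * Bd ^+ 3 * gam w' (co w'.1 x))).
      by apply: ler_pM => //; exact: (wave_main_le K12 sheets A1 rel).
    by move: (Bd ^+ 3) => z; ring.
  - apply: (le_trans (ler_wpM2r r0 MG)).
    (* In the products with the error [e1] a factor 1/K is to spare, so the uniform bound of the
       sheets by K is enough. *)
    have Gk : G x <= 6 * (Cp * k).
      have := @sum_wave_le R (fun w => gam w (co w.1 x)) (Cp * k) (fun w => _).
      move=> h; apply: (le_trans (ler_norm _)); apply: h => w.
      by rewrite ger0_norm//; exact: (sheet_trace_le Lam K12 sheets).
    rewrite (_ : 24 * A * (Bd ^+ 3 * Cp) = 4 * A * Bd ^+ 3 * (6 * (Cp * k)) * r).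
      by apply: ler_wpM2r => //; apply: ler_wpM2l => //; rewrite !mulr_ge0// ?exprn_ge0// ltW.
    by move: (Bd ^+ 3) => z; field; rewrite gt_eqF.
  - exact: le_trans B6W1.
  - by rewrite -exprM.
  - by apply: le_trans B6W1; exact: ler_weXn2l.
  - exact: sumr_ge0.
  - apply: sumr_ge0 => w _; apply: sumr_ge0 => w' _; rewrite /gg; case: ifP => // _; exact: mulr_ge0.
  - exact: sumr_ge0.
apply: (@le_trans _ _ (Int P)); first by apply: cube_int_le => //; exact: cube_bounded_norm.
have iF : Int F <= 150 * sb ^+ 2 * r.
  have iFj j : Int (fun x => f (N%:R * co j x)) <= 50 * sb ^+ 2 * r.
    rewrite (cube_int_co (v := fun t : R => f (N%:R * t)) j cfN).
    by rewrite (periodic_integral_scale N0 cf pf).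
  rewrite /F cube_int_sum// sum3; apply: (le_trans (lerD (lerD (iFj 0) (iFj 1)) (iFj 2))).
  by move: (sb ^+ 2) => y; lra.
have iG : Int G <= 6 * (Cp * r).
  by rewrite /G cube_int_sum// -sum_wave_cst; apply: ler_sum => w _.
have iG2 : Int G2 <= 36 * (Cp * r) ^+ 2.
  rewrite /G2 cube_int_sum; last by move=> w; exact: cube_bounded_sum.
  rewrite (_ : 36 * _ = \sum_(w : 'I_3 * bool) 6 * (Cp * r) ^+ 2); last by rewrite sum_wave_cst; ring.
  apply: ler_sum => w _; rewrite cube_int_sum// -sum_wave_cst; exact: ler_sum.
rewrite /P cube_intZ; last first.
  apply: cube_boundedD; last exact: bZ.
  by apply: cube_boundedD; [apply: cube_boundedD => //; exact: bZ|exact: bZ].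
rewrite cube_intD; [|by apply: cube_boundedD; [apply: cube_boundedD => //; exact: bZ|exact: bZ]|exact: bZ].
rewrite cube_intD; [|by apply: cube_boundedD => //; exact: bZ|exact: bZ].
rewrite cube_intD; [|exact: bc|exact: bZ].
rewrite cube_int_cst !cube_intZ//.
rewrite [leRHS]mulrCA; apply: ler_wpM2l; first exact: sqr_ge0.
apply: (@le_trans _ _ ((3 + 528 * W + 4608 * W ^+ 2 + W * (150 * sb ^+ 2) + 16 * W * (6 * Cp) + 16 * W * (36 * Cp ^+ 2)) * r)).
  have W16 : 0 <= 16 * W by rewrite mulr_ge0// ltW.
  have j1 : W * Int F <= W * (150 * sb ^+ 2 * r) by apply: ler_wpM2l => //; exact: ltW.
  have j2 : 16 * W * Int G <= 16 * W * (6 * (Cp * r)) by exact: ler_wpM2l.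
  have j3 : 16 * W * Int G2 <= 16 * W * (36 * Cp ^+ 2 * r).
    apply: ler_wpM2l => //; apply: (le_trans iG2); rewrite exprMn -mulrA ler_wpM2l// ler_wpM2l ?sqr_ge0//.
    by rewrite expr2 ler_piMl.
  move: j1 j2 j3; move: (Int F) (Int G) (Int G2) (sb ^+ 2) (Cp ^+ 2) => *; lra.
apply: ler_wpM2r => //; apply: stage_const_le => //; exact: sqr_ge0.
Qed.

End StageIntegrals.

(** * The increment in L^2 *)

Section StageLemma.
Context (R : realType).
Local Notation W := (wave_const R).

Implicit Types (x : space3 R) (w : 'I_3 * bool).
Variables (K Lam : nat) (K12 : (12 <= K)%N) (Lam0 : (0 < Lam)%N).
Local Notation N := (K * Lam)%N.
Local Notation k := (K%:R : R).
Local Notation Int f := (\int[volume]_(x in cube) f x).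
Variables (G_ h_ : bool -> nat -> R -> R).
Hypothesis sheets : forall b, sheet k (G_ b) (h_ b).
Variables (A dl kap : R) (B : vfield R) (S : 'I_3 -> 'I_3 -> space3 R -> R).
Hypotheses (A1 : 1 <= A) (rel : relaxed A Lam%:R dl kap B S).
Local Notation amp := (step_amp K Lam S).
Local Notation dF := (step_dF K Lam G_ S).
Local Notation ddP := (step_ddP K Lam h_ S).
Local Notation press := (step_pressure K Lam S).
Local Notation u := (step_wave K Lam G_ S).
Local Notation B' := (step_field K Lam G_ B S).
Local Notation Bd := (2 * spline_bound R).
Local Notation S' := (step_stress K Lam G_ h_ B S).
Let N0 : (0 < N)%N. Proof. by rewrite muln_gt0 Lam0 (leq_trans _ K12). Qed.
Let k12 : 12 <= k. Proof. by rewrite ler_nat. Qed.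
Let k1 : 1 <= k. Proof. by apply: le_trans k12; rewrite ler1n. Qed.
Let k0 : 0 < k. Proof. exact: lt_le_trans k12. Qed.
Let A0 : 0 < A. Proof. exact: lt_le_trans A1. Qed.
Let W64 : 64 <= W. Proof. exact: wave_const_ge64. Qed.
Let W0 : 0 < W. Proof. exact: lt_le_trans W64. Qed.
Hypothesis disj : disjoint_profiles (G_ false) (G_ true).

Let pamp w : cell_periodic N (amp w).
Proof. by apply: amplitude_periodic => // b e; have [_ + _ _] := relaxed_stress rel b e. Qed.

Let int_ddP w a b : Int (ddP w a b) = 0.
Proof.
have [_ /(_ b)[c d]] := stress_dpot_C1 K12 N0 (sheets w.2) w.1 (amp w) a.
apply: (cube_int_partial (i := b) c d); exact: stress_dpot_periodic.
Qed.

Lemma step_wave_int a : Int (fun x => u a x ^+ 2) <= W ^+ 5 * (dl + A ^+ 2 / k).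
Proof.
have r0 : 0 <= k^-1 by rewrite invr_ge0 ltW.
have r1 : k^-1 <= 1 by rewrite invf_le1.
pose e1 := W * (4 * A * k ^- 2); pose e2 := W * ((4 * A) ^+ 2 * k^-1).
pose D x := \sum_w ddP w w.1 w.1 x; pose T x := \sum_c \sum_d `|S c d x|.
pose P x := 12 * D x + (72 * e2 + 288 * e1 ^+ 2 + 144 * Bd ^+ 6 * (27 * A ^+ 2 / k)) + 144 * Bd ^+ 6 * T x.
have bu : cube_bounded (u a) by exact: bC1_cube_bounded (step_wave_bC1 K12 Lam0 sheets A1 rel a).
have bdd w : cube_bounded (ddP w w.1 w.1) by exact: bC1_cube_bounded (step_ddP_bC1 K12 Lam0 sheets rel w _ _).
have bS c d : cube_bounded (fun x => `|S c d x|).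
  by apply: cube_bounded_norm; exact: bC1_cube_bounded (relaxed_stress rel c d).
have bD : cube_bounded D by exact: cube_bounded_sum.
have bSc c : cube_bounded (fun x => \sum_d `|S c d x|) by exact: cube_bounded_sum.
have bT : cube_bounded T by exact: cube_bounded_sum.
have bZ (c : R) g : cube_bounded g -> cube_bounded (fun x => c * g x).
  by move=> bg; apply: cube_boundedM => //; exact: cube_bounded_cst.
have bP : cube_bounded P.
  apply: cube_boundedD; last exact: (bZ).
  by apply: cube_boundedD; [exact: (bZ)|exact: cube_bounded_cst].
have uP x : u a x ^+ 2 <= P x.
  apply: (le_trans (step_wave_sqr K12 Lam0 sheets A1 rel a x)); rewrite /P -/e1 -/e2 -/(D x) -/(T x).
  by move: (Bd ^+ 6) => z; lra.
apply: (@le_trans _ _ (Int P)).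
  by apply: cube_int_le => //; exact: cube_boundedM.
rewrite cube_intD; [|by apply: cube_boundedD; [exact: (bZ)|exact: cube_bounded_cst]|exact: (bZ)].
rewrite cube_intD; [|exact: (bZ)|exact: cube_bounded_cst].
rewrite cube_int_cst !cube_intZ//.
(* This is where the mean square 1 of the profile enters: the oscillation of its square is a
   derivative. *)
have -> : Int D = 0 by rewrite cube_int_sum// big1.
have iT : Int T <= 9 * dl.
  rewrite cube_int_sum//; apply: (@le_trans _ _ (\sum_(c < 3) \sum_(d < 3) dl)); last by rewrite !sum3; lra.
  apply: ler_sum => c _; rewrite cube_int_sum//; apply: ler_sum => d _; exact: relaxed_small rel c d.
have dl0 : 0 <= dl.
  by apply: le_trans (relaxed_small rel 0 0); apply: Rintegral_ge0.
have B6W := wave_const_ge R.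
have B60 : 0 <= Bd ^+ 6 by rewrite exprn_ge0// mulr_ge0// ltW// spline_bound_gt0.
have := stage_const2_le W64 (sqr_ge0 A) r0 r1 dl0 B6W.
apply: le_trans.
have j : 144 * Bd ^+ 6 * Int T <= 144 * Bd ^+ 6 * (9 * dl).
  by apply: ler_wpM2l => //; rewrite mulr_ge0.
have -> : e1 ^+ 2 = 16 * W ^+ 2 * A ^+ 2 * k^-1 ^+ 4 by rewrite /e1 -exprVn; ring.
have -> : e2 = W * (16 * A ^+ 2 * k^-1) by rewrite /e2; ring.
move: j; move: (Bd ^+ 6) (Int T) (k^-1 ^+ 4) => z y t; lra.
Qed.

End StageLemma.

Section Stage.
Context (R : realType).
Local Notation W := (wave_const R).
Local Notation Int f := (\int[volume]_(x in cube) f x).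

(** The old stress bound [dl] enters the L^2 size of the increment only; the new stress bound is
    governed by [A] and [K], and can be made small by the choice of [K]. *)
Lemma stage (K Lam : nat) (A dl kap : R) B S : (12 <= K)%N -> (0 < Lam)%N -> 1 <= A ->
  relaxed A Lam%:R dl kap B S -> exists B' S',
  [/\ relaxed (W ^+ 2 * (A * K%:R)) (2 * (K * Lam * K ^ 4))%:R (W ^+ 5 * (A ^+ 2 / K%:R)) kap B' S',
      forall a, bC1 (48 * W * (A * K%:R)) (K * Lam * K ^ 4)%:R (fun x => B' a x - B a x) &
      forall a, Int (fun x => (B' a x - B a x) ^+ 2) <= W ^+ 5 * (dl + A ^+ 2 / K%:R)].
Proof.
move=> K12 Lam0 A1 rel.
have k12 : 12 <= (K%:R : R) by rewrite ler_nat.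
have [Gp [hp [Gm [hm [sp sm disj]]]]] := exists_sheet_pair k12.
pose G_ b := if b then Gm else Gp; pose h_ b := if b then hm else hp.
have sheets b : sheet K%:R (G_ b) (h_ b) by case: b.
have N0 : (0 < K * Lam)%N by rewrite muln_gt0 Lam0 (leq_trans _ K12).
have pS b e : torus_periodic (S b e) by have [_ + _ _] := relaxed_stress rel b e.
have pamp w : cell_periodic (K * Lam) (step_amp K Lam S w) by exact: amplitude_periodic.
exists (step_field K Lam G_ B S), (step_stress K Lam G_ h_ B S).
have E : (K * Lam * K ^ 4)%:R = (K * Lam)%:R * K%:R ^+ 4 :> R by rewrite natrM natrX.
have E2 : (2 * (K * Lam * K ^ 4))%:R = 2 * ((K * Lam)%:R * K%:R ^+ 4) :> R by rewrite natrM E.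
have D a : (fun x => step_field K Lam G_ B S a x - B a x) = step_wave K Lam G_ S a.
  by apply/funext => x; rewrite /step_field /new_field addrC addKr.
have bB a : cube_bounded (B a) by exact: bC1_cube_bounded (relaxed_field rel a).
have bS a b : cube_bounded (S a b) by exact: bC1_cube_bounded (relaxed_stress rel a b).
have CF w := wave_pot_C1 K12 N0 (sheets w.2) w.1 (step_amp K Lam S w).
have CdF w a := wave_dpot_C1 (K * Lam) K12 (sheets w.2) w.1 (step_amp K Lam S w) a.
have CP w := stress_pot_C1 K12 N0 (sheets w.2) w.1 (step_amp K Lam S w).
have CdP w a := stress_dpot_C1 K12 N0 (sheets w.2) w.1 (step_amp K Lam S w) a.
have pF w := wave_pot_periodic K (G_ w.2) w.1 (pamp w).
have pP w := stress_pot_periodic K (h_ w.2) w.1 (pamp w).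
have pdP w a := stress_dpot_periodic K (h_ w.2) w.1 (pamp w) a.
split; first split.
- by move=> a; rewrite E2; exact: (step_field_bC1 K12 Lam0 sheets A1 rel).
- by move=> a b; rewrite E2; exact: (step_stress_bC1 K12 Lam0 sheets A1 rel).
- apply: new_stress_sym; first exact: (relaxed_sym rel).
  move=> w a b x; rewrite /step_ddP /stress_ddpot; congr (_ * step_prod _ _ _ _ _).
  by apply/funext => j; rewrite /mi2 addnC.
- by move=> a b; exact: (step_stress_int K12 Lam0 sheets A1 rel disj).
- move=> phi sphi pphi.
  by apply: (etrans (new_relaxed_weak (eta_ R) (step_pressure K Lam S) CF CdF CP CdP pF pP pdP bB bS sphi pphi)); exact: (relaxed_weak rel sphi pphi).
- move=> psi spsi ppsi.
  by apply: (etrans (new_relaxed_div (eta_ R) CF CdF pF bB spsi ppsi)); exact: (relaxed_div rel spsi ppsi).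
- by move=> a; apply: (etrans (new_relaxed_mean (eta_ R) CF CdF pF bB a)); exact: (relaxed_mean rel a).
- by apply: (etrans (new_relaxed_moment (eta_ R) (step_pressure K Lam S) CF CdF CdP pF pdP bB bS)); exact: (relaxed_moment rel).
- by move=> a; rewrite D E; exact: (step_wave_bC1 K12 Lam0 sheets A1 rel).
- move=> a; have := step_wave_int K12 Lam0 sheets A1 rel a; rewrite -D; exact.
Qed.

End Stage.

(** * Iteration *)

Section Iteration.
Context (R : realType).
Local Notation W := (wave_const R).
Local Notation Int f := (\int[volume]_(x in cube) f x).

Lemma relaxed_weaken (A A' Lam Lam' dl dl' kap : R) B S : A <= A' -> Lam <= Lam' -> 0 <= Lam' ->
  dl <= dl' -> relaxed A Lam dl kap B S -> relaxed A' Lam' dl' kap B S.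
Proof.
move=> AA LL L0 dd [r1 r2 r3 r4 r5 r6 r7 r8]; have A0 := bC1_ge0 (r1 0).
split=> //.
- by move=> a; exact: (bC1_weaken AA LL L0 (r1 a)).
- move=> a b; apply: (bC1_weaken _ LL L0 (r2 a b)).
  by rewrite lerXn2r// nnegrE// (le_trans A0).
- by move=> a b; exact: le_trans (r4 a b) dd.
Qed.

Lemma bC1_cst (c K L : R) : `|c| <= K -> 0 <= L -> bC1 K L (fun=> c).
Proof.
move=> cK L0; apply: (bC1_intro (C1_cst c)) => //.
by move=> i x; rewrite normr0 mulr_ge0// (le_trans _ cK).
Qed.

(** A constant tensor is paired with derivatives of periodic functions, hence solves the weak
    equation; the entry -c in position (0, 1) provides the positive moment. *)
Lemma relaxed_start (A Lam c : R) : 1 <= A -> 0 <= Lam -> 0 <= c -> c <= 1 ->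
  exists S, relaxed A Lam c c (fun _ _ => 0) S.
Proof.
move=> A1 L0 c0 c1.
pose s (a b : 'I_3) : R := if ((a == 0) && (b == 1)) || ((a == 1) && (b == 0)) then - c else 0.
have sc a b : `|s a b| <= c by rewrite /s; case: ifP => _; rewrite ?normrN ?normr0// ger0_norm.
exists (fun a b _ => s a b); split.
- by move=> a; apply: bC1_cst => //; rewrite normr0 (le_trans _ A1).
- move=> a b; apply: bC1_cst => //; apply: (le_trans (sc a b)); apply: (le_trans c1); exact: exprn_ege1.
- by move=> a b _; rewrite /s orbC andbC; congr (if _ || _ then _ else _); rewrite andbC.
- by move=> a b; rewrite cube_int_cst.
- move=> phi sphi pphi.
  have st a b : smooth (curl phi a) by exact: smooth_curl.
  have bt a b : cube_bounded (partial b (curl phi a)).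
    by apply/continuous_cube_bounded/smooth_continuous/smooth_partial/smooth_curl.
  have it a b : Int (partial b (curl phi a)) = 0.
    have [_ /(_ b)[cc dd]] := smooth_C1 (smooth_curl a sphi).
    by apply: (cube_int_partial (i := b) cc dd); exact: periodic_curl.
  transitivity (Int (fun x => \sum_a \sum_b (- s a b) * partial b (curl phi a) x)).
    apply: eq_Rintegral => x _; rewrite /weak_form big1 ?add0r => [|a _]; last by rewrite mul0r.
    by apply: eq_bigr => a _; apply: eq_bigr => b _; rewrite mul0r sub0r.
  have bst a b : cube_bounded (fun x => (- s a b) * partial b (curl phi a) x).
    by apply: cube_boundedM => //; exact: cube_bounded_cst.
  rewrite cube_int_sum; last by move=> a; exact: cube_bounded_sum.
  apply: big1 => a _; rewrite cube_int_sum//; apply: big1 => b _.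
  by rewrite cube_intZ// it mulr0.
- move=> psi _ _; transitivity (Int (fun=> 0 : R)); last exact: cube_int_cst.
  by apply: eq_Rintegral => x _; apply: big1 => a _; rewrite mul0r.
- by move=> a; exact: cube_int_cst.
- transitivity (Int (fun=> c : R)); last exact: cube_int_cst.
  by apply: eq_Rintegral => x _; rewrite mul0r sub0r /s eqxx /= opprK.
Qed.

(* The exponents: with K = L^64 intervals the increment has frequency at most
   L^385 and the next error is O(L^26 / K) = O((L^6)^-6). *)
Definition stage_ok (L : nat) (kap : R) (s : vfield R * ('I_3 -> 'I_3 -> space3 R -> R)) :=
  relaxed (L%:R ^+ 13) (L%:R ^+ 65) (L%:R ^- 6) kap s.1 s.2.
Definition stage_gap (L : nat) (s s' : vfield R * ('I_3 -> 'I_3 -> space3 R -> R)) :=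
  (forall a, bC1 (L%:R ^+ 78) (L%:R ^+ 385) (fun x => s'.1 a x - s.1 a x)) /\
  (forall a, Int (fun x => (s'.1 a x - s.1 a x) ^+ 2) <= L%:R ^- 5).

Lemma stage_next (L : nat) (kap : R) s : 2 * W ^+ 5 <= L%:R -> stage_ok L kap s ->
  exists s', stage_ok (L ^ 6) kap s' /\ stage_gap L s s'.
Proof.
case: s => B S; rewrite /stage_ok /stage_gap /= => LW rel.
have W64 : 64 <= W by exact: wave_const_ge64.
have W1 : 1 <= W by lra.
have W0 : 0 <= W by exact: le_trans W1.
set l : R := L%:R in LW rel *.
have W5 : W ^+ 1 <= W ^+ 5 /\ W ^+ 2 <= W ^+ 5 by split; exact: ler_weXn2l.
have Wl : W <= l.
  case: W5; rewrite expr1; move: (W ^+ 5) (W ^+ 2) LW => y z; lra.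
have l0 : 0 < l by lra.
have l1 : 1 <= l by lra.
have L0 : (0 < L)%N by rewrite -(ltr0n R).
have Lbig : (12 <= L ^ 64)%N.
  rewrite -(ler_nat R) natrX; apply: (@le_trans _ _ (l ^+ 1)); last exact: ler_weXn2l.
  by rewrite expr1; lra.
have A1 : 1 <= l ^+ 13 by exact: exprn_ege1.
have rel' : relaxed (l ^+ 13) (L ^ 65)%:R (l ^- 6) kap B S by rewrite natrX.
have := stage Lbig _ A1 rel'; rewrite expn_gt0 L0 => /(_ isT) [B' [S' [h1 h2 h3]]].
have E1 : (L ^ 64 * L ^ 65 * (L ^ 64) ^ 4)%:R = l ^+ 385 by rewrite -expnM -!expnD natrX.
have E2 : (2 * (L ^ 64 * L ^ 65 * (L ^ 64) ^ 4))%:R = 2 * l ^+ 385 by rewrite natrM E1.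
have EK : (L ^ 64)%:R = l ^+ 64 by rewrite natrX.
have lX n : 0 < l ^+ n by rewrite exprn_gt0.
have dec : (l ^+ 13) ^+ 2 / l ^+ 64 = l ^- 38.
  have -> : l ^+ 64 = l ^+ 26 * l ^+ 38 by rewrite -exprD.
  by rewrite -exprM invfM mulrA divff ?mul1r// gt_eqF.
have D1 : l ^+ 13 * l ^+ 64 = l ^+ 77 by rewrite -exprD.
rewrite E2 EK D1 dec in h1; rewrite E1 EK D1 in h2; rewrite EK dec in h3.
exists (B', S'); rewrite natrX -/l.
(* The bounds prescribed for the next stage exceed those obtained by factors L, L^5 and L^2; the
   constants W^2, 2 and W^5 fit into them because [2 * W ^+ 5 <= L]. *)
have F13 : (l ^+ 6) ^+ 13 = l * l ^+ 77 by rewrite -exprM -exprS.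
have F65 : (l ^+ 6) ^+ 65 = l ^+ 5 * l ^+ 385 by rewrite -exprM -exprD.
have F6 : (l ^+ 6) ^- 6 = l ^- 36 by rewrite -exprM.
rewrite F13 F65 F6.
have W5l : W ^+ 5 * 2 <= l by rewrite mulrC.
have W2l : W ^+ 2 <= l by case: W5; have := W5l; move: (W ^+ 5) (W ^+ 2) => y z ? ? ?; lra.
have W50 : 0 <= W ^+ 5 by exact: exprn_ge0.
split; [|split].
- apply: relaxed_weaken h1.
  + by apply: ler_wpM2r; [exact: ltW|].
  + apply: ler_wpM2r; first exact: ltW.
    by apply: (@le_trans _ _ (l ^+ 1)); [rewrite expr1; lra|exact: ler_weXn2l].
  + by rewrite mulr_ge0 ?ltW.
  + have -> : l ^- 36 = l ^+ 2 * l ^- 38.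
      have -> : l ^+ 38 = l ^+ 2 * l ^+ 36 by rewrite -exprD.
      by rewrite [X in _ = _ * X]invfM mulrA divff ?mul1r// gt_eqF.
    apply: ler_wpM2r; first by rewrite invr_ge0 ltW.
    by apply: (@le_trans _ _ (l ^+ 1)); [rewrite expr1; lra|exact: ler_weXn2l].
- move=> a; have := h2 a; apply: bC1_weaken; [|exact: lexx|exact: ltW].
  rewrite (exprS l 77); apply: ler_wpM2r; first exact: ltW.
  have : 64 * W <= W ^+ 2 by rewrite expr2; apply: ler_wpM2r.
  move: W2l; lra.
- move=> a; apply: (le_trans (h3 a)).
  apply: (@le_trans _ _ (W ^+ 5 * (l ^- 6 + l ^- 6))).
    apply: ler_wpM2l => //; apply: lerD => //; rewrite lef_pV2 ?posrE//; exact: ler_weXn2l.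
  have -> : W ^+ 5 * (l ^- 6 + l ^- 6) = W ^+ 5 * 2 * l ^- 6 by ring.
  rewrite (_ : l ^- 5 = l * l ^- 6); last by rewrite [l ^+ 6]exprS; field; rewrite !gt_eqF.
  by apply: ler_wpM2r => //; rewrite invr_ge0 ltW.
Qed.

Lemma stage_sequence : exists (L : nat -> nat) (s : nat -> vfield R * ('I_3 -> 'I_3 -> space3 R -> R)) (kap : R),
  [/\ (64 <= L 0%N)%N, (forall q, L q.+1 = (L q ^ 6)%N), 0 < kap, s 0%N = (fun _ _ => 0, (s 0%N).2) &
    forall q, stage_ok (L q) kap (s q) /\ stage_gap (L q) (s q) (s q.+1)].
Proof.
have W64 : 64 <= W by exact: wave_const_ge64.
have W0 : 0 <= W by lra.
pose L0 := `|Num.ceil (2 * W ^+ 5)|%N.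
have LW : 2 * W ^+ 5 <= L0%:R.
  rewrite /L0 natr_absz gtr0_norm ?ceil_ge// ceil_gt0.
  by rewrite mulr_gt0// exprn_gt0//; lra.
have W5 : W <= W ^+ 5 by rewrite -[leLHS]expr1; apply: ler_weXn2l => //; lra.
have L64 : (64 <= L0)%N.
  by rewrite -(ler_nat R); apply: le_trans LW; move: W5; move: (W ^+ 5) => z; lra.
have L1 : 1 <= (L0%:R : R) by rewrite ler1n; exact: leq_trans L64.
pose L q := iter q (fun n => n ^ 6)%N L0.
have LL q : L q.+1 = (L q ^ 6)%N by [].
have Lge q : (L0 <= L q)%N.
  elim: q => // q IH; rewrite LL; apply: (leq_trans IH); rewrite -[X in (X <= _)%N]expn1 leq_pexp2l//.
  by apply: leq_trans IH; exact: leq_trans L64.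
have LWq q : 2 * W ^+ 5 <= (L q)%:R by apply: (le_trans LW); rewrite ler_nat.
have [S0 rel0] := @relaxed_start (L0%:R ^+ 13) (L0%:R ^+ 65) (L0%:R ^- 6) (exprn_ege1 _ L1)
  (exprn_ge0 _ (le_trans ler01 L1)) (ltac:(by rewrite invr_ge0 exprn_ge0// (le_trans _ L1)))
  (ltac:(by rewrite invf_le1 ?exprn_gt0 ?(lt_le_trans _ L1)// exprn_ege1)).
set kap := L0%:R ^- 6 in rel0.
(* [stage_next] provides a successor under [stage_ok] only; the choice function is made total by
   returning the pair itself otherwise. *)
have [F FP] := choice (fun z : nat * (vfield R * ('I_3 -> 'I_3 -> space3 R -> R)) =>
  match pselect (stage_ok (L z.1) kap z.2) with
  | left ok => let: ex_intro s' h := stage_next (LWq z.1) ok in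
      ex_intro (fun s' => stage_ok (L z.1) kap z.2 -> stage_ok (L z.1 ^ 6) kap s' /\ stage_gap (L z.1) z.2 s') s' (fun _ => h)
  | right nok => ex_intro _ z.2 (fun ok => False_ind _ (nok ok)) end).
pose s := fix s q := if q is q'.+1 then F (q', s q') else ((fun _ _ => 0) : vfield R, S0).
have ok q : stage_ok (L q) kap (s q).
  by elim: q => // q IH; have [] := FP (q, s q) IH.
exists L, s, kap; split=> //.
  by rewrite invr_gt0 exprn_gt0// (lt_le_trans _ L1).
by move=> q; split=> //; have [] := FP (q, s q) (ok q).
Qed.

End Iteration.

(** * The limit field *)

Section FieldLimit.
Context (R : realType).
Local Notation Int f := (\int[volume]_(x in cube) f x).
Implicit Types (x : space3 R).

(** Iteration of (u + T)^2 <= 2 u^2 + 2 T^2; the weights do not depend on the number of terms. *)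
Lemma sqr_sum_le (u : nat -> R) n :
  (\sum_(q < n) u q) ^+ 2 <= \sum_(q < n) 2 ^+ q.+1 * u q ^+ 2.
Proof.
elim: n u => [|n IH] u; first by rewrite !big_ord0 expr0n.
rewrite !big_ord_recl /=; set T := \sum_(i < n) _.
have h : T ^+ 2 <= \sum_(q < n) 2 ^+ q.+1 * u q.+1 ^+ 2 by exact: (IH (fun q => u q.+1)).
apply: (@le_trans _ _ (2 * u 0%N ^+ 2 + 2 * T ^+ 2)).
  rewrite -subr_ge0 (_ : _ - _ = (u 0%N - T) ^+ 2) ?sqr_ge0//; ring.
rewrite expr1 lerD2l; apply: (@le_trans _ _ (2 * \sum_(q < n) 2 ^+ q.+1 * u q.+1 ^+ 2)); first exact: ler_wpM2l.
by rewrite mulr_sumr; apply: ler_sum => q _; rewrite [in leRHS]exprS mulrA.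
Qed.

Lemma half_sum_le n : \sum_(q < n) (2 ^+ q.+1)^-1 <= 1 :> R.
Proof.
suff -> : \sum_(q < n) (2 ^+ q.+1)^-1 = 1 - (2 ^+ n)^-1 :> R.
  by rewrite gerDl oppr_le0 invr_ge0 exprn_ge0.
elim: n => [|n IH]; first by rewrite big_ord0 expr0 invr1 subrr.
rewrite big_ord_recr /= IH exprS invfM.
by move: (2 ^+ n)^-1 => z; field.
Qed.

Variable B : nat -> vfield R.
Hypotheses (cB : forall q a, continuous (B q a)) (pB : forall q a, torus_periodic (B q a))
  (B0 : forall a x, B 0%N a x = 0)
  (hI : forall q a, Int (fun x => (B q.+1 a x - B q a x) ^+ 2) <= (4 ^+ q.+1)^-1).

(** The weight 2^(q+1) loses against the decay 4^-(q+1) of the increments, so the total is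
    integrable; by [sqr_sum_le] it dominates all squared fields. One majorant thus serves linear and
    quadratic limits. *)
Definition increment_energy q x := 2 ^+ q.+1 * \sum_a (B q.+1 a x - B q a x) ^+ 2.
Local Notation h := increment_energy.
Definition total_energy x := (\sum_(0 <= q <oo) (h q x)%:E)%E.
Local Notation H := total_energy.

Let h0 q x : 0 <= h q x.
Proof. by rewrite mulr_ge0 ?exprn_ge0// sumr_ge0// => a _; exact: sqr_ge0. Qed.

Let bB q a : cube_bounded (B q a). Proof. exact: continuous_cube_bounded. Qed.
Let bd q a : cube_bounded (fun x => (B q.+1 a x - B q a x) ^+ 2).
Proof. by apply: cube_boundedM; exact: cube_boundedB. Qed.
Let bh q : cube_bounded (h q).
Proof.
by apply: cube_boundedM; [exact: cube_bounded_cst|exact: cube_bounded_sum].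
Qed.
Let mh q : measurable_fun setT (h q). Proof. by have [] := bh q. Qed.

Let energy_ge n x : ((\sum_(q < n) h q x)%:E <= H x)%E.
Proof.
rewrite -sumEFin -(big_mkord xpredT (fun q => (h q x)%:E)).
by apply: nneseries_lim_ge => q _ _; rewrite lee_fin.
Qed.

Let energy_ge0 x : (0 <= H x)%E.
Proof. by have := energy_ge 0 x; rewrite big_ord0. Qed.

Let mH : measurable_fun setT H.
Proof.
apply: (@ge0_emeasurable_sum _ _ _ _ (fun q x => (h q x)%:E) xpredT) => [q x _ _|q _].
  by rewrite lee_fin.
exact/measurable_EFinP.
Qed.

Let int_h q : (\int[volume]_(x in cube) (h q x)%:E = (Int (h q))%:E)%E.
Proof.
rewrite fineK//; apply: integrable_fin_num; first exact: measurable_cube.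
exact: (cube_bounded_integrable (bh q)).
Qed.

Let energy_integrable : volume.-integrable cube H.
Proof.
apply/integrableP; split; first exact: measurable_funTS.
under eq_integral => x _ do rewrite gee0_abs//.
have mf q : measurable_fun cube (fun x => (h q x)%:E) by apply/measurable_EFinP; exact: measurable_funTS.
have f0 q x : cube x -> (0 <= (h q x)%:E)%E by rewrite lee_fin.
rewrite (integral_nneseries volume (@measurable_cube R) mf f0).
apply: (@le_lt_trans _ _ (\sum_(0 <= q <oo) (3 / (2 ^ (q + 1))%:R)%:E)%E); last first.
  have := @cvg_geometric_eseries_half R 3 0 => /cvg_lim => e.
  rewrite (_ : (\sum_(0 <= q <oo) _)%E = (3 / 2 ^+ 0)%:E) ?ltry//; exact: e.
apply: lee_nneseries => q _; first by move=> _; rewrite int_h lee_fin; apply: Rintegral_ge0 => x _; exact: h0.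
rewrite int_h lee_fin cube_intZ; last by exact: cube_bounded_sum.
rewrite cube_int_sum//; apply: (@le_trans _ _ (2 ^+ q.+1 * \sum_(a < 3) (4 ^+ q.+1)^-1)).
  by apply: ler_wpM2l; [exact: exprn_ge0|exact: ler_sum].
rewrite sum3 addn1 natrX (_ : 4 = 2 * 2) ?exprMn; last by ring.
have : (2 ^+ q.+1 : R) != 0 by rewrite expf_neq0.
by move: (2 ^+ q.+1) => z z0; rewrite le_eqVlt; apply/orP; left; apply/eqP; field.
Qed.

Lemma field_sqr_le n a x : B n a x ^+ 2 <= \sum_(q < n) h q x.
Proof.
have -> : B n a x = \sum_(q < n) (B q.+1 a x - B q a x).
  by elim: n => [|n IH]; [rewrite big_ord0 B0|rewrite big_ord_recr /= -IH addrC subrK].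
apply: (le_trans (sqr_sum_le (fun q => B q.+1 a x - B q a x) n)).
apply: ler_sum => q _; apply: ler_wpM2l; first exact: exprn_ge0.
by rewrite (bigD1 a)//= lerDl sumr_ge0// => b _; exact: sqr_ge0.
Qed.

(** By Young's inequality an increment u satisfies |u| <= 2^(q+1) u^2 + 2^-(q+1), so finite energy
    at a point makes the series of increments converge absolutely there. *)
Let field_cvg a x : (H x < +oo)%E -> cvgn (fun n => B n a x).
Proof.
move=> Hx; have Hf : H x \is a fin_num by rewrite ge0_fin_numE.
pose u q := B q.+1 a x - B q a x.
have E : (fun n => B n a x) = series u.
  apply/funext => n; rewrite seriesEord /=.
  by elim: n => [|n IH]; [rewrite big_ord0 B0|rewrite big_ord_recr /= -IH addrC subrK].
rewrite E; apply: normed_cvg; apply: nondecreasing_is_cvgn.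
  by apply: nondecreasing_series => n _ _; exact: normr_ge0.
exists (fine (H x) + 1) => _ [n _ <-].
change (series (fun q => `|u q|) n <= fine (H x) + 1); rewrite seriesEord /=.
have e1 : \sum_(q < n) h q x <= fine (H x) by rewrite -lee_fin fineK.
apply: le_trans (lerD e1 (half_sum_le n)); rewrite -big_split /=; apply: ler_sum => q _.
have z0 : 0 < (2 ^+ q.+1 : R) by rewrite exprn_gt0.
apply: (@le_trans _ _ (2 ^+ q.+1 * u q ^+ 2 + (2 ^+ q.+1)^-1)).
  rewrite -(real_normK (num_real (u q))); move: z0 `|u q|; move: (2 ^+ q.+1) => z z0 y.
  have -> : z * y ^+ 2 + z^-1 = z * (y - z^-1 / 2) ^+ 2 + (y + 3 / 4 * z^-1) by field; rewrite gt_eqF.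
  have := mulr_ge0 (ltW z0) (sqr_ge0 (y - z^-1 / 2)); have : 0 < z^-1 by rewrite invr_gt0.
  by move: (z * (y - z^-1 / 2) ^+ 2) => p; lra.
rewrite lerD2r; apply: ler_wpM2l; first exact: ltW.
by rewrite (bigD1 a)//= lerDl sumr_ge0// => b _; exact: sqr_ge0.
Qed.

(* where the energy of the increments is infinite, a null set, the value 0 is arbitrary *)
Definition limit_field : vfield R := fun a x => if (H x < +oo)%E then limn (fun n => B n a x) else 0.
Local Notation Bl := limit_field.

Let Bl_cvg a x : (H x < +oo)%E -> (fun n => B n a x) @ \oo --> Bl a x.
Proof. by move=> Hx; rewrite /Bl Hx; exact: field_cvg. Qed.

Lemma limit_field_measurable a : measurable_fun setT (Bl a).
Proof.
apply: (@measurable_fun_cvg _ _ _ _ (fun n x => if (H x < +oo)%E then B n a x else 0)) => [n|x _].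
  apply: measurable_fun_ifT; last exact: measurable_cst.
    by apply: measurable_fun_lte => //; exact: measurable_cst.
  by have [] := bB n a.
have [Hx|Hx] := boolP (H x < +oo)%E; first exact: Bl_cvg.
by rewrite /Bl (negbTE Hx); exact: cvg_cst.
Qed.

Lemma limit_field_periodic a : torus_periodic (Bl a).
Proof.
move=> i x; rewrite /Bl.
have -> : H (x + unit_vector i) = H x.
  by rewrite /H /h; apply: congr_lim; apply/funext => n; apply: eq_bigr => q _; under eq_bigr do rewrite !pB.
by congr (if _ then limn _ else _); apply/funext => n; rewrite pB.
Qed.

(** Dominated convergence with majorant C (1 + H), which is integrable and therefore finite almost
    everywhere. *)
Lemma limit_dominated (f : nat -> space3 R -> R) (F : space3 R -> R) (C : R) : 0 < C ->
  (forall n, measurable_fun setT (f n)) -> measurable_fun setT F ->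
  (forall x, (H x < +oo)%E -> (fun n => f n x) @ \oo --> F x) ->
  (forall n x, cube x -> `|f n x| <= C * (1 + \sum_(q < n) h q x)) ->
  volume.-integrable cube (EFin \o F) /\ (fun n => Int (f n)) @ \oo --> Int F.
Proof.
move=> C0 mf mF fF fC.
pose g x := (C%:E * (1 + H x))%E.
have ig : volume.-integrable cube g.
  apply: integrableZl; first exact: measurable_cube.
  apply: integrableD => //; first exact: measurable_cube.
  exact: (cube_bounded_integrable (cube_bounded_cst 1)).
have [] := @dominated_convergence _ _ R volume cube (@measurable_cube R) (fun n x => (f n x)%:E) (EFin \o F) g.
- by move=> n; apply/measurable_EFinP; apply: measurable_funTS; exact: mf.
- by apply/measurable_EFinP; apply: measurable_funTS; exact: mF.
- have := @integrable_ae _ _ R volume cube (@measurable_cube R) H energy_integrable; apply: filterS => x Hx cx.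
  apply: cvg_EFin; first by apply: nearW.
  by apply: fF; rewrite ltey_eq Hx.
- exact: ig.
- apply: aeW => x n cx; rewrite /g.
  apply: (@le_trans _ _ (C * (1 + \sum_(q < n) h q x))%:E); first by rewrite lee_fin; exact: fC.
  by rewrite EFinM EFinD; apply: lee_wpmul2l; [rewrite lee_fin ltW|exact: leeD].
move=> iF _ cv; split=> //.
apply: fine_cvg; rewrite fineK; first exact: cv.
by apply: integrable_fin_num => //; exact: measurable_cube.
Qed.

Lemma limit_field_linear a (g : space3 R -> R) : continuous g ->
  volume.-integrable cube (EFin \o (fun x => Bl a x * g x)) /\
  (fun n => Int (fun x => B n a x * g x)) @ \oo --> Int (fun x => Bl a x * g x).
Proof.
move=> cg; have [mg [M gM]] := continuous_cube_bounded cg.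
apply: (@limit_dominated _ _ (Num.max M 1)).
- by rewrite lt_max ltr01 orbT.
- by move=> n; apply: measurable_funM => //; have [] := bB n a.
- by apply: measurable_funM => //; exact: limit_field_measurable.
- by move=> x Hx; apply: cvgM; [exact: Bl_cvg|exact: cvg_cst].
- move=> n x cx; rewrite normrM mulrC; apply: ler_pM => //.
    by rewrite le_max gM.
  have := field_sqr_le n a x; rewrite -(real_normK (num_real (B n a x))).
  have := sqr_ge0 (`|B n a x| - 1); move: `|B n a x| (\sum_(q < n) h q x) => y z; nra.
Qed.

Lemma limit_field_quadratic a b (g : space3 R -> R) : continuous g ->
  volume.-integrable cube (EFin \o (fun x => Bl a x * Bl b x * g x)) /\
  (fun n => Int (fun x => B n a x * B n b x * g x)) @ \oo --> Int (fun x => Bl a x * Bl b x * g x).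
Proof.
move=> cg; have [mg [M gM]] := continuous_cube_bounded cg.
apply: (@limit_dominated _ _ (Num.max M 1)).
- by rewrite lt_max ltr01 orbT.
- by move=> n; do 2!apply: measurable_funM => //; [have [] := bB n a|have [] := bB n b].
- by do 2!apply: measurable_funM => //; exact: limit_field_measurable.
- by move=> x Hx; apply: cvgM; [apply: cvgM; exact: Bl_cvg|exact: cvg_cst].
- move=> n x cx; rewrite normrM mulrC; apply: ler_pM => //.
    by rewrite le_max gM.
  have := field_sqr_le n a x; have := field_sqr_le n b x; rewrite normrM.
  rewrite -(real_normK (num_real (B n a x))) -(real_normK (num_real (B n b x))).
  have := sqr_ge0 (`|B n a x| - `|B n b x|).
  move: `|B n a x| `|B n b x| (\sum_(q < n) h q x) => y y' z; nra.
Qed.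

End FieldLimit.

(** * Fourier series and Sobolev norms *)

Section Fourier.
Context (R : realType).
Local Notation Int f := (\int[volume]_(x in cube) f x).
Local Notation freq := (int * int * int)%type.
Implicit Types (x : space3 R) (k l : freq) (f : space3 R -> R).

Definition fcoord (j : 'I_3) k : int := if j == 0 then k.1.1 else if j == 1 then k.1.2 else k.2.

Lemma phaseE k x : phase k x =
  2 * pi * ((fcoord 0 k)%:~R * co 0 x + (fcoord 1 k)%:~R * co 1 x + (fcoord 2 k)%:~R * co 2 x).
Proof. by []. Qed.

Lemma phase_line k i (h : R) x : phase k (h *: unit_vector i + x) = 2 * pi * (fcoord i k)%:~R * h + phase k x.
Proof.
by rewrite !phaseE !co_line; elim/ord3_ind: i; rewrite ?eqxx ?ord3_eq /=; ring.
Qed.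

Lemma phase_shift k i x : phase k (x + unit_vector i) = 2 * pi *
  ((fcoord 0 k)%:~R * co 0 x + (fcoord 1 k)%:~R * co 1 x + (fcoord 2 k)%:~R * co 2 x + (fcoord i k)%:~R).
Proof.
by rewrite !phaseE !coD !co_unit; elim/ord3_ind: i; rewrite ?eqxx ?ord3_eq /=; ring.
Qed.

Lemma phase_continuous k : continuous (@phase R k).
Proof.
move=> x; apply: cvgM; first exact: cvg_cst.
by apply: cvgD; [apply: cvgD|]; (apply: cvgM; [exact: cvg_cst|]);
  [exact: (@continuous_co R 0 x)|exact: (@continuous_co R 1 x)|exact: (@continuous_co R 2 x)].
Qed.

Let cos_phase k x : R := cos (phase k x).
Let sin_phase k x : R := sin (phase k x).

Let cos_phase_continuous k : continuous (cos_phase k).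
Proof.
move=> x; apply: (@continuous_comp _ R R (@phase R k) cos); first exact: phase_continuous.
exact: continuous_cos.
Qed.

Let sin_phase_continuous k : continuous (sin_phase k).
Proof.
move=> x; apply: (@continuous_comp _ R R (@phase R k) sin); first exact: phase_continuous.
exact: continuous_sin.
Qed.

Let cos_phase_periodic k : torus_periodic (cos_phase k).
Proof.
have p1 : periodic1 (fun t : R => cos (2 * pi * t)).
  by move=> t; rewrite mulrDr mulr1 [X in _ + X]mulr_natl cosD2pi.
by move=> i x; rewrite /cos_phase phase_shift (periodic1_int _ _ p1).
Qed.

Let sin_phase_periodic k : torus_periodic (sin_phase k).
Proof.
have p1 : periodic1 (fun t : R => sin (2 * pi * t)).
  by move=> t; rewrite mulrDr mulr1 [X in _ + X]mulr_natl sinD2pi.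
by move=> i x; rewrite /sin_phase phase_shift (periodic1_int _ _ p1).
Qed.

Let cos_phase_C1 k : C1 (cos_phase k) (fun i x => - (2 * pi * (fcoord i k)%:~R) * sin_phase k x).
Proof.
split=> // i; split=> [x|x]; first by apply: cvgM; [exact: cvg_cst|exact: sin_phase_continuous].
apply/is_derive_line0.
rewrite (_ : (fun h : R => _) = (fun h : R => cos (2 * pi * (fcoord i k)%:~R * h + phase k x))); last first.
  by apply/funext => h; rewrite /cos_phase phase_line.
rewrite mulNr -mulrN; apply: is_derive_affine; rewrite mulr0 add0r; exact: is_derive_cos.
Qed.

Let sin_phase_C1 k : C1 (sin_phase k) (fun i x => 2 * pi * (fcoord i k)%:~R * cos_phase k x).
Proof.
split=> // i; split=> [x|x]; first by apply: cvgM; [exact: cvg_cst|exact: cos_phase_continuous].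
apply/is_derive_line0.
rewrite (_ : (fun h : R => _) = (fun h : R => sin (2 * pi * (fcoord i k)%:~R * h + phase k x))); last first.
  by apply/funext => h; rewrite /sin_phase phase_line.
apply: is_derive_affine; rewrite mulr0 add0r; exact: is_derive_sin.
Qed.

Let bcos k : cube_bounded (cos_phase k). Proof. exact: continuous_cube_bounded. Qed.
Let bsin k : cube_bounded (sin_phase k). Proof. exact: continuous_cube_bounded. Qed.

Let fcoord_neq0 k : k != (0, 0, 0) -> exists j, fcoord j k != 0.
Proof.
case: k => [[a b] c] ne.
have [a0|a0] := eqVneq a 0; last by exists 0.
have [b0|b0] := eqVneq b 0; last by exists 1.
have [c0|c0] := eqVneq c 0; last by exists 2.
by move: ne; rewrite a0 b0 c0 eqxx.
Qed.

Let int_trig k : Int (cos_phase k) = (k == (0, 0, 0))%:R /\ Int (sin_phase k) = 0.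
Proof.
have [->|ne] := eqVneq k (0, 0, 0).
  have p0 x : phase (0, 0, 0) x = 0 :> R by rewrite /phase /=; ring.
  split.
    transitivity (Int (fun=> 1 : R)); last exact: cube_int_cst.
    by apply: eq_Rintegral => x _; rewrite /cos_phase p0 cos0.
  transitivity (Int (fun=> 0 : R)); last exact: cube_int_cst.
  by apply: eq_Rintegral => x _; rewrite /sin_phase p0 sin0.
have [j kj] := fcoord_neq0 ne.
have c0 : 2 * pi * (fcoord j k)%:~R != 0 :> R by rewrite !mulf_neq0// ?intr_eq0// gt_eqF// pi_gt0.
split.
  have [_ /(_ j)[cc dd]] := sin_phase_C1 k; have := cube_int_partial cc dd (@sin_phase_periodic k).
  by rewrite cube_intZ// => /eqP; rewrite mulf_eq0 (negbTE c0) /= => /eqP.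
have [_ /(_ j)[cc dd]] := cos_phase_C1 k; have := cube_int_partial cc dd (@cos_phase_periodic k).
by rewrite cube_intZ// => /eqP; rewrite mulf_eq0 oppr_eq0 (negbTE c0) /= => /eqP.
Qed.

Let fsub k l : freq := (k.1.1 - l.1.1, k.1.2 - l.1.2, k.2 - l.2).

Let phase_sub k l x : phase (fsub k l) x = phase k x - phase l x.
Proof. by rewrite /phase /= !intrB; ring. Qed.

Let fsub_eq0 k l : (fsub k l == (0, 0, 0)) = (k == l).
Proof. by case: k l => [[a b] c] [[a' b'] c']; rewrite /fsub !xpair_eqE !subr_eq0. Qed.

Let bZ (c : R) f : cube_bounded f -> cube_bounded (fun x => c * f x).
Proof. by move=> bf; apply: cube_boundedM => //; exact: cube_bounded_cst. Qed.

(** P + iQ is the partial Fourier sum over [J], split into real and imaginary parts; Q can be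
    nonzero since [J] may be asymmetric. Expanding the nonnegative integral of |f - P - iQ|^2 gives
    the inequality. *)
Lemma bessel f (J : seq freq) : uniq J -> cube_bounded f ->
  \sum_(k <- J) fourier_sqr f k <= Int (fun x => f x ^+ 2).
Proof.
move=> uJ bf.
pose a k := Int (fun x => f x * cos_phase k x); pose b k := Int (fun x => f x * sin_phase k x).
pose p k x := a k * cos_phase k x + b k * sin_phase k x.
pose q k x := a k * sin_phase k x - b k * cos_phase k x.
pose P x := \sum_(k <- J) p k x; pose Q x := \sum_(k <- J) q k x.
pose Sm := \sum_(k <- J) (a k ^+ 2 + b k ^+ 2).
have -> : \sum_(k <- J) fourier_sqr f k = Sm by [].
have bp k : cube_bounded (p k) by apply: cube_boundedD; exact: bZ.
have bq k : cube_bounded (q k) by apply: cube_boundedB; exact: bZ.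
have bP : cube_bounded P by exact: cube_bounded_sum.
have bQ : cube_bounded Q by exact: cube_bounded_sum.
have iP : Int (fun x => f x * P x) = Sm.
  transitivity (Int (fun x => \sum_(k <- J) (a k * (f x * cos_phase k x) + b k * (f x * sin_phase k x)))).
    by apply: eq_Rintegral => x _; rewrite /P mulr_sumr; apply: eq_bigr => k _; rewrite /p; ring.
  have bfc k : cube_bounded (fun x => f x * cos_phase k x) by exact: cube_boundedM.
  have bfs k : cube_bounded (fun x => f x * sin_phase k x) by exact: cube_boundedM.
  rewrite cube_int_sum; last by move=> k; apply: cube_boundedD; exact: (bZ).
  apply: eq_bigr => k _; rewrite cube_intD; [|exact: (bZ)|exact: (bZ)].
  by rewrite !cube_intZ// !expr2.
have iPQ : Int (fun x => P x ^+ 2 + Q x ^+ 2) = Sm.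
  pose g k l x := (a k * a l + b k * b l) * cos_phase (fsub k l) x + (b k * a l - a k * b l) * sin_phase (fsub k l) x.
  have bg k l : cube_bounded (g k l) by apply: cube_boundedD; exact: (bZ).
  transitivity (Int (fun x => \sum_(k <- J) \sum_(l <- J) g k l x)).
    apply: eq_Rintegral => x _; rewrite !expr2 /P /Q !big_distrlr /= -big_split; apply: eq_bigr => k _ /=.
    rewrite -big_split; apply: eq_bigr => l _ /=.
    by rewrite /g /p /q /cos_phase /sin_phase phase_sub cosB sinB; ring.
  rewrite cube_int_sum; last by move=> k; exact: cube_bounded_sum.
  rewrite /Sm !big_seq; apply: eq_bigr => k kJ; rewrite cube_int_sum//.
  have ig l : Int (g k l) = (a k * a l + b k * b l) * (k == l)%:R.
    have [i1 i2] := int_trig (fsub k l).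
    rewrite cube_intD; [|exact: (bZ)|exact: (bZ)].
    by rewrite !cube_intZ// i1 i2 fsub_eq0 mulr0 addr0.
  rewrite (bigD1_seq k)//= ig eqxx mulr1 big1 => [|l lk]; first by rewrite addr0 !expr2.
  by rewrite ig eq_sym (negbTE lk) mulr0.
have : 0 <= Int (fun x => (f x - P x) ^+ 2 + Q x ^+ 2).
  by apply: Rintegral_ge0 => x _; rewrite addr_ge0 ?sqr_ge0.
have -> : Int (fun x => (f x - P x) ^+ 2 + Q x ^+ 2) =
  Int (fun x => f x ^+ 2 + ((-2) * (f x * P x) + (P x ^+ 2 + Q x ^+ 2))).
  by apply: eq_Rintegral => x _; ring.
have bfP : cube_bounded (fun x => f x * P x) by exact: cube_boundedM.
have bPQ : cube_bounded (fun x => P x ^+ 2 + Q x ^+ 2) by apply: cube_boundedD; exact: cube_boundedM.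
rewrite cube_intD; [|exact: cube_boundedM|by apply: cube_boundedD => //; exact: (bZ)].
by rewrite cube_intD// ?cube_intZ// ?iP ?iPQ; [lra|exact: (bZ)].
Qed.

(** Integration by parts multiplies the coefficient by 2 pi k_j up to a rotation by i, and 2 pi >=
    1. *)
Lemma fourier_sqr_partial f df j k : C1 f df -> torus_periodic f ->
  (fcoord j k)%:~R ^+ 2 * fourier_sqr f k <= fourier_sqr (df j) k.
Proof.
move=> Cf pf.
have bf := C1_cube_bounded Cf.
have e1 := cube_int_by_parts j Cf (cos_phase_C1 k) pf (@cos_phase_periodic k).
have e2 := cube_int_by_parts j Cf (sin_phase_C1 k) pf (@sin_phase_periodic k).
pose c := 2 * pi * (fcoord j k)%:~R : R.
have i1 : Int (fun x => df j x * cos_phase k x) = c * Int (fun x => f x * sin_phase k x).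
  rewrite e1 -cube_intZ; last exact: cube_boundedM.
  rewrite -cube_intN; last by apply: cube_boundedM => //; exact: bZ.
  by apply: eq_Rintegral => x _; rewrite /c; ring.
have i2 : Int (fun x => df j x * sin_phase k x) = - (c * Int (fun x => f x * cos_phase k x)).
  rewrite e2 -cube_intZ; last exact: cube_boundedM.
  by congr (- _); apply: eq_Rintegral => x _; rewrite /c; ring.
have -> : fourier_sqr (df j) k = c ^+ 2 * fourier_sqr f k.
  apply: (etrans (congr2 (fun u v => u ^+ 2 + v ^+ 2) i1 i2)).
  rewrite (_ : fourier_sqr f k = Int (fun x => f x * cos_phase k x) ^+ 2 + Int (fun x => f x * sin_phase k x) ^+ 2)//.
  by rewrite sqrrN !(exprMn 2 c) addrC -mulrDr.
have fs0 : 0 <= fourier_sqr f k by rewrite addr_ge0 ?sqr_ge0.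
apply: ler_wpM2r => //; rewrite (exprMn _ (2 * pi)); apply: ler_peMl; first exact: sqr_ge0.
by apply: exprn_ege1; have := pi_ge2 R; lra.
Qed.

(** Interpolation with a free parameter: for z = y^(1/250) one has z <= t + t (z/t)^250, the two
    terms being dominant for z <= t and z >= t. The first summand calls for the L^2 norm, the second
    for the norm of the gradient. *)
Lemma sobolev_weight_le (s t : R) k : s <= 1 / 250 -> 0 < t ->
  sobolev_weight s k <= t * (1 + (1 + k.1.1%:~R ^+ 2 + k.1.2%:~R ^+ 2 + k.2%:~R ^+ 2) / t ^+ 250).
Proof.
move=> s250 t0; rewrite /sobolev_weight; set y := 1 + _ + _ + _.
have y1 : 1 <= y by rewrite /y -!addrA lerDl !addr_ge0 ?sqr_ge0.
apply: (le_trans (ler_powR y1 s250)).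
have yz : y = (y `^ (1 / 250)) ^+ 250.
  have n250 : 250 != 0 :> R by rewrite pnatr_eq0.
  by rewrite -(powR_mulrn 250 (powR_ge0 y (1 / 250))) -powRrM mul1r mulVf// powRr1// (le_trans _ y1).
rewrite {2}yz; move: (powR_ge0 y (1 / 250)); move: (y `^ _) => z z0.
have -> : t * (1 + z ^+ 250 / t ^+ 250) = t * (1 + (z / t) ^+ 250) by rewrite expr_div_n.
rewrite -ler_pdivrMl// mulrC; set r := z / t.
have r0 : 0 <= r by rewrite divr_ge0// ltW.
have [r1|/ltW r1] := lerP r 1; first by rewrite (le_trans r1)// lerDl exprn_ge0.
apply: (@le_trans _ _ (r ^+ 250)); last by rewrite lerDr.
by rewrite -[leLHS]expr1; apply: ler_weXn2l.
Qed.

End Fourier.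

Section SobolevLimit.
Context (R : realType).
Local Notation Int f := (\int[volume]_(x in cube) f x).
Local Notation freq := (int * int * int)%type.
Implicit Types (x : space3 R) (k : freq) (f : space3 R -> R).

Lemma fourier_sqr_ge0 f k : 0 <= fourier_sqr f k.
Proof. by rewrite addr_ge0 ?sqr_ge0. Qed.

Lemma sobolev_weight_ge0 (s : R) k : 0 <= sobolev_weight s k.
Proof. exact: powR_ge0. Qed.

Lemma sobolev_piece (s l : R) f (J : seq freq) : s <= 1 / 250 -> 1 <= l -> uniq J ->
  bC1 (l ^+ 78) (l ^+ 385) f -> Int (fun x => f x ^+ 2) <= l ^- 5 ->
  \sum_(k <- J) sobolev_weight s k * fourier_sqr f k <= 5 / l.
Proof.
move=> s250 l1 uJ bf f2; have [Cf pf _ df] := bf.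
have l0 : 0 < l by exact: lt_le_trans l1.
have b0 : cube_bounded f := C1_cube_bounded Cf.
have bd j : cube_bounded (partial j f) := C1_cube_bounded_partial j Cf.
have D j : Int (fun x => partial j f x ^+ 2) <= l ^+ 926.
  rewrite -[leRHS](@cube_int_cst R); apply: cube_int_le.
  - exact: cube_boundedM.
  - exact: cube_bounded_cst.
  - move=> x _; rewrite -(real_normK (num_real (partial j f x))).
    have -> : l ^+ 926 = (l ^+ 78 * l ^+ 385) ^+ 2 by rewrite -exprD -exprM.
    have m0 : 0 <= l ^+ 78 * l ^+ 385 by apply: mulr_ge0; apply: exprn_ge0; exact: ltW.
    by apply: lerXn2r; [rewrite nnegrE|rewrite nnegrE|exact: df].
pose y k : R := 1 + k.1.1%:~R ^+ 2 + k.1.2%:~R ^+ 2 + k.2%:~R ^+ 2.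
have S0 : \sum_(k <- J) fourier_sqr f k <= l ^- 5 by exact: le_trans (bessel uJ b0) f2.
have Sj j : \sum_(k <- J) (fcoord j k)%:~R ^+ 2 * fourier_sqr f k <= l ^+ 926.
  apply: le_trans (D j); apply: le_trans (bessel uJ (bd j)); apply: ler_sum => k _.
  exact: (fourier_sqr_partial j k Cf pf).
have Sy : \sum_(k <- J) y k * fourier_sqr f k <= l ^- 5 + 3 * l ^+ 926.
  have -> : \sum_(k <- J) y k * fourier_sqr f k = \sum_(k <- J) fourier_sqr f k +
    (\sum_(k <- J) (fcoord 0 k)%:~R ^+ 2 * fourier_sqr f k + \sum_(k <- J) (fcoord 1 k)%:~R ^+ 2 * fourier_sqr f k +
     \sum_(k <- J) (fcoord 2 k)%:~R ^+ 2 * fourier_sqr f k).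
    by rewrite -!big_split; apply: eq_bigr => k _; rewrite /= /y /fcoord ?eqxx ?ord3_eq /=; ring.
  apply: lerD => //; apply: (le_trans (lerD (lerD (Sj 0) (Sj 1)) (Sj 2))).
  by move: (l ^+ 926) => z; lra.
(* With this parameter the L^2 part is l^4 l^-5 = 1/l, and the gradient part is of order l^(4 -
   1000) l^926 = l^-70, where 926 = 2 (78 + 385). *)
pose t := l ^+ 4.
have t0 : 0 < t by exact: exprn_gt0.
have tW k : sobolev_weight s k * fourier_sqr f k <= t * fourier_sqr f k + (t / t ^+ 250) * (y k * fourier_sqr f k).
  apply: (le_trans (ler_wpM2r (fourier_sqr_ge0 f k) (sobolev_weight_le k s250 t0))).
  rewrite -/(y k) le_eqVlt; apply/orP; left; apply/eqP.
  by move: (fourier_sqr f k) (t ^+ 250) => z z'; ring.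
apply: (le_trans (ler_sum _ (fun k _ => tW k))).
rewrite big_split /= -!mulr_sumr.
have E1 : t * l ^- 5 = l^-1.
  have -> : l ^+ 5 = t * l by rewrite /t -exprSr.
  by rewrite invfM mulrA divff ?mul1r// gt_eqF.
have G (a b c : R) : a != 0 -> b != 0 -> c != 0 -> a / (a * (b * c)) * b = c^-1.
  by move=> a0 b0' c0; field; rewrite a0 b0' c0.
have E2 : t / t ^+ 250 * l ^+ 926 = l ^- 70.
  have -> : t ^+ 250 = t * (l ^+ 926 * l ^+ 70).
    by rewrite -exprD -exprM -exprD.
  have n1 : t != 0 by rewrite gt_eqF.
  have n2 : l ^+ 926 != 0 by rewrite expf_neq0// gt_eqF.
  have n3 : l ^+ 70 != 0 by rewrite expf_neq0// gt_eqF.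
  exact: G.
have q0 : 0 <= t / t ^+ 250 by rewrite divr_ge0 ?exprn_ge0 ?ltW.
have h1 := ler_wpM2l (ltW t0) S0; have h2 := ler_wpM2l q0 Sy.
have h3 : l ^- 5 <= l ^+ 926.
  apply: (@le_trans _ _ 1); first by rewrite invf_le1 ?exprn_gt0// exprn_ege1.
  exact: exprn_ege1.
have h4 : l ^- 70 <= l^-1.
  by rewrite lef_pV2 ?posrE ?exprn_gt0// -[leLHS]expr1; apply: ler_weXn2l.
have h5 : t / t ^+ 250 * (l ^- 5 + 3 * l ^+ 926) <= 4 * l^-1.
  apply: (@le_trans _ _ (t / t ^+ 250 * (4 * l ^+ 926))).
    by apply: ler_wpM2l => //; move: h3; move: (l ^- 5) (l ^+ 926) => u v; lra.
  by rewrite mulrCA E2; apply: ler_wpM2l.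
rewrite E1 in h1; apply: (le_trans (lerD h1 (le_trans h2 h5))).
by move: l^-1 => z; lra.
Qed.

Variables (B : nat -> vfield R) (l : nat -> R) (s : R).
Hypotheses (cB : forall q a, continuous (B q a)) (B0 : forall a x, B 0%N a x = 0)
  (hI : forall q a, Int (fun x => (B q.+1 a x - B q a x) ^+ 2) <= (4 ^+ q.+1)^-1)
  (l64 : forall q, 64 ^+ q.+1 <= l q)
  (bw : forall q a, bC1 (l q ^+ 78) (l q ^+ 385) (fun x => B q.+1 a x - B q a x))
  (w2 : forall q a, Int (fun x => (B q.+1 a x - B q a x) ^+ 2) <= l q ^- 5)
  (s250 : s <= 1 / 250).
Local Notation w q a := (fun x => B q.+1 a x - B q a x).

Let l1 q : 1 <= l q.
Proof. by apply: le_trans (l64 q); apply: exprn_ege1; rewrite ler1n. Qed.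

Lemma fourier_sqr_series n a k :
  fourier_sqr (B n a) k <= \sum_(q < n) 2 ^+ q.+1 * fourier_sqr (w q a) k.
Proof.
have T x : B n a x = \sum_(q < n) w q a x.
  by elim: n => [|n IH]; [rewrite big_ord0 B0|rewrite big_ord_recr /= -IH addrC subrK].
have I (g : space3 R -> R) : cube_bounded g ->
    Int (fun x => B n a x * g x) = \sum_(q < n) Int (fun x => w q a x * g x).
  move=> bg; rewrite -cube_int_sum; last first.
    by move=> q; apply: cube_boundedM => //; exact: bC1_cube_bounded (bw q a).
  by apply: eq_Rintegral => x _; rewrite T mulr_suml.
have bc : cube_bounded (fun x : space3 R => cos (phase k x)).
  by apply: continuous_cube_bounded => x; apply: (@continuous_comp _ R R (@phase R k) cos);
    [exact: phase_continuous|exact: continuous_cos].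
have bs : cube_bounded (fun x : space3 R => sin (phase k x)).
  by apply: continuous_cube_bounded => x; apply: (@continuous_comp _ R R (@phase R k) sin);
    [exact: phase_continuous|exact: continuous_sin].
rewrite /fourier_sqr (I _ bc) (I _ bs).
apply: le_trans (lerD (sqr_sum_le (fun q => Int (fun x => w q a x * cos (phase k x))) n)
  (sqr_sum_le (fun q => Int (fun x => w q a x * sin (phase k x))) n)) _.
by rewrite -big_split le_eqVlt; apply/orP; left; apply/eqP; apply: eq_bigr => q _; rewrite mulrDr.
Qed.

(** The weight 2^(q+1) needed to sum the stages is absorbed because 1/l_q <= 4^-(q+1), uniformly in
    the number of stages. *)
Lemma partial_sobolev_le n a (J : seq freq) : uniq J ->
  \sum_(k <- J) sobolev_weight s k * fourier_sqr (B n a) k <= 5.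
Proof.
move=> uJ.
apply: (@le_trans _ _ (\sum_(k <- J) \sum_(q < n) 2 ^+ q.+1 * (sobolev_weight s k * fourier_sqr (w q a) k))).
  apply: ler_sum => k _; apply: (le_trans (ler_wpM2l (sobolev_weight_ge0 s k) (fourier_sqr_series n a k))).
  rewrite mulr_sumr le_eqVlt; apply/orP; left; apply/eqP; apply: eq_bigr => q _; exact: mulrCA.
rewrite exchange_big /=; apply: (@le_trans _ _ (\sum_(q < n) 5 * (2 ^+ q.+1)^-1)).
  apply: ler_sum => q _; rewrite -mulr_sumr.
  apply: (le_trans (ler_wpM2l (exprn_ge0 _ (ler0n R 2)) (sobolev_piece s250 (l1 q) uJ (bw q a) (w2 q a)))).
  rewrite mulrCA; apply: ler_wpM2l => //.
  have z0 : 0 < (2 ^+ q.+1 : R) by rewrite exprn_gt0.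
  have z1 : 1 <= (2 ^+ q.+1 : R) by apply: exprn_ege1; rewrite ler1n.
  have lq : (2 ^+ q.+1) * (2 ^+ q.+1) <= l q.
    apply: le_trans (l64 q); rewrite -exprMn; apply: lerXn2r; rewrite ?nnegrE//.
    lra.
  rewrite ler_pdivrMr ?(lt_le_trans _ (l1 q))//.
  by rewrite -(ler_pM2l z0) mulrA divff ?gt_eqF// mul1r mulrC.
by rewrite -mulr_sumr ler_piMr// half_sum_le.
Qed.

(** Each Fourier coefficient passes to the limit, so the uniform bound on sums over finite sets of
    frequencies persists, and the full sum is their supremum. *)
Lemma limit_sobolev a : sobolev s (limit_field B a).
Proof.
have cc k : continuous (fun x : space3 R => cos (phase k x)).
  by move=> x; apply: (@continuous_comp _ R R (@phase R k) cos);
    [exact: phase_continuous|exact: continuous_cos].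
have cs k : continuous (fun x : space3 R => sin (phase k x)).
  by move=> x; apply: (@continuous_comp _ R R (@phase R k) sin);
    [exact: phase_continuous|exact: continuous_sin].
have fin (J : seq freq) : uniq J -> \sum_(k <- J) sobolev_weight s k * fourier_sqr (limit_field B a) k <= 5.
  move=> uJ.
  have cv : (fun n => \sum_(k <- J) sobolev_weight s k * fourier_sqr (B n a) k) @ \oo -->
      \sum_(k <- J) sobolev_weight s k * fourier_sqr (limit_field B a) k.
    elim: J {uJ} => [|k J' IH].
      rewrite big_nil (_ : (fun n => _) = (fun=> 0)); first exact: cvg_cst.
      by apply/funext => n; rewrite big_nil.
    rewrite big_cons (_ : (fun n => _) = (fun n => sobolev_weight s k * fourier_sqr (B n a) k + \sum_(k <- J') sobolev_weight s k * fourier_sqr (B n a) k)); last first.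
      by apply/funext => n; rewrite big_cons.
    apply: cvgD => //; apply: cvgM; first exact: cvg_cst.
    have [_ h1] := limit_field_linear cB B0 hI a (cc k).
    have [_ h2] := limit_field_linear cB B0 hI a (cs k).
    by rewrite /fourier_sqr; apply: cvgD; rewrite expr2; apply: cvgM.
  rewrite -(cvg_lim (@Rhausdorff R) cv); apply: limr_le; first by apply/cvg_ex; eexists; exact: cv.
  by apply: nearW => n; exact: partial_sobolev_le.
rewrite /sobolev; apply: (@le_lt_trans _ _ 5%:E); last exact: ltry.
apply: ge_ereal_sup => _ [X [fX _] <-]; rewrite fsbig_finite//= sumEFin lee_fin.
apply: fin; exact: finmap.fset_uniq.
Qed.

End SobolevLimit.

(** * The limit is a stationary weak solution *)

Section LimitPairing.
Context (R : realType).
Local Notation Int f := (\int[volume]_(x in cube) f x).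
Implicit Types (x : space3 R) (g : space3 R -> R).

Lemma cvg_sum3 (u : 'I_3 -> nat -> R) (v : 'I_3 -> R) : (forall a, u a @ \oo --> v a) ->
  (fun n => \sum_a u a n) @ \oo --> \sum_a v a.
Proof.
move=> uv; rewrite sum3 (_ : (fun n => _) = (fun n => u 0 n + u 1 n + u 2 n)).
  by apply: cvgD; [apply: cvgD|]; exact: uv.
by apply/funext => n; rewrite sum3.
Qed.

Lemma mvt_near (F f : R -> R) (t h : R) : (forall t : R, is_derive t 1 F (f t)) ->
  exists c, `|c - t| <= `|h| /\ F (h + t) - F t = f c * h.
Proof.
move=> Ff; have [h0|/ltW h0] := lerP 0 h.
  have [|c /andP[c1 c2] e] := derivative_segment (a := t) (b := h + t) Ff; first by rewrite lerDr.
  exists c; split; last by rewrite e addrK.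
  by rewrite !ger0_norm ?subr_ge0// lerBlDr.
have [|c /andP[c1 c2] e] := derivative_segment (a := h + t) (b := t) Ff; first by rewrite gerDr.
exists c; split; last by rewrite -opprB e; ring.
by rewrite !ler0_norm ?subr_le0//; lra.
Qed.

Variable B : nat -> vfield R.
Hypotheses (cB : forall q a, continuous (B q a)) (B0 : forall a x, B 0%N a x = 0)
  (hI : forall q a, Int (fun x => (B q.+1 a x - B q a x) ^+ 2) <= (4 ^+ q.+1)^-1).
Local Notation Bl := (limit_field B).
Local Notation pair a g := (Int (fun x => Bl a x * g x)).

Let bB q a : cube_bounded (B q a). Proof. exact: continuous_cube_bounded. Qed.

Let pair_cvg a g : continuous g -> (fun n => Int (fun x => B n a x * g x)) @ \oo --> pair a g.
Proof. by move=> cg; have [] := limit_field_linear cB B0 hI a cg. Qed.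

Lemma pairing_linear a g g' (c : R) : continuous g -> continuous g' ->
  pair a (fun x => g x + c * g' x) = pair a g + c * pair a g'.
Proof.
move=> cg cg'.
have cgg : continuous (fun x => g x + c * g' x).
  by move=> x; apply: cvgD; [exact: cg|apply: cvgM; [exact: cvg_cst|exact: cg']].
have l1 := @pair_cvg a _ cgg.
have l2 : (fun n => Int (fun x => B n a x * (g x + c * g' x))) @ \oo --> pair a g + c * pair a g'.
  rewrite (_ : (fun n => _) = (fun n => Int (fun x => B n a x * g x) + c * Int (fun x => B n a x * g' x))).
    by apply: cvgD; [exact: pair_cvg|apply: cvgM; [exact: cvg_cst|exact: pair_cvg]].
  apply/funext => n.
  have b1 : cube_bounded (fun x => B n a x * g x) by apply: cube_boundedM => //; exact: continuous_cube_bounded.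
  have b2 : cube_bounded (fun x => B n a x * g' x) by apply: cube_boundedM => //; exact: continuous_cube_bounded.
  rewrite -cube_intZ// -cube_intD//; last by apply: cube_boundedM => //; exact: cube_bounded_cst.
  by apply: eq_Rintegral => x _; ring.
by have := cvg_lim (@Rhausdorff R) l1; rewrite (cvg_lim (@Rhausdorff R) l2) => ->.
Qed.

(** The fields are dominated by 1 plus the accumulated energy, whose integral is at most 3; hence
    the factor 4. *)
Lemma pairing_le a g (M : R) : continuous g -> (forall x, cube x -> `|g x| <= M) -> `|pair a g| <= 4 * M.
Proof.
move=> cg gM; have M0 : 0 <= M.
  by apply: le_trans (gM (0, 0, 0) _); [exact: normr_ge0|split; [split|]; rewrite /= in_itv/= lexx ler01].
have bd q b : cube_bounded (fun x => (B q.+1 b x - B q b x) ^+ 2) by apply: cube_boundedM; exact: cube_boundedB.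
have bh q : cube_bounded (increment_energy B q).
  by apply: cube_boundedM; [exact: cube_bounded_cst|exact: cube_bounded_sum].
have ih q : Int (increment_energy B q) <= 3 * (2 ^+ q.+1)^-1.
  rewrite cube_intZ; last by exact: cube_bounded_sum.
  rewrite cube_int_sum//; apply: (@le_trans _ _ (2 ^+ q.+1 * \sum_(b < 3) (4 ^+ q.+1)^-1)).
    by apply: ler_wpM2l; [exact: exprn_ge0|exact: ler_sum].
  rewrite sum3 (_ : 4 = 2 * 2) ?exprMn; last by ring.
  have : (2 ^+ q.+1 : R) != 0 by rewrite expf_neq0.
  by move: (2 ^+ q.+1) => z z0; rewrite le_eqVlt; apply/orP; left; apply/eqP; field.
have bs n : cube_bounded (fun x => \sum_(q < n) increment_energy B q x) by exact: cube_bounded_sum.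
have nle n : `|Int (fun x => B n a x * g x)| <= 4 * M.
  have bBg : cube_bounded (fun x => B n a x * g x) by apply: cube_boundedM => //; exact: continuous_cube_bounded.
  apply: (le_trans (cube_int_norm bBg)).
  have b1 : cube_bounded (fun x => 1 + \sum_(q < n) increment_energy B q x).
    by apply: cube_boundedD => //; exact: cube_bounded_cst.
  apply: (@le_trans _ _ (Int (fun x => M * (1 + \sum_(q < n) increment_energy B q x)))).
    apply: cube_int_le.
    - exact: cube_bounded_norm.
    - by apply: cube_boundedM => //; exact: cube_bounded_cst.
    move=> x cx; rewrite normrM mulrC; apply: ler_pM => //; first exact: gM.
    have := field_sqr_le B0 n a x; rewrite -(real_normK (num_real (B n a x))).
    have := sqr_ge0 (`|B n a x| - 1); move: `|B n a x| (\sum_(q < n) _) => y z; nra.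
  rewrite cube_intZ// mulrC; apply: ler_wpM2r => //.
  rewrite cube_intD//; last exact: cube_bounded_cst.
  rewrite cube_int_cst cube_int_sum//.
  have : \sum_(q < n) Int (increment_energy B q) <= 3.
    apply: (@le_trans _ _ (\sum_(q < n) 3 * (2 ^+ q.+1)^-1)); first by apply: ler_sum => q _.
    by rewrite -mulr_sumr ler_piMr// half_sum_le.
  by move: (\sum_(q < n) _) => z; lra.
have cn : (fun n => `|Int (fun x => B n a x * g x)|) @ \oo --> `|pair a g| by apply: cvg_norm; exact: pair_cvg.
rewrite -(cvg_lim (@Rhausdorff R) cn); apply: limr_le; first by apply/cvg_ex; eexists; exact: cn.
by apply: nearW => n; exact: nle.
Qed.

Lemma smooth_is_derive_time (F : R * space3 R -> R) x : smooth F ->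
  forall t : R, is_derive t 1 (fun t => F (t, x)) ('D_(1, 0) F (t, x)).
Proof.
move=> sF t.
have E (s : R) : s *: (1, 0) + (0, x) = (s, x) :> R * space3 R.
  by congr (_, _); rewrite /= ?scaler0 ?add0r// addr0 [_ *: _]mulr1.
have := (is_derive_line F (0, x) (1, 0) t ('D_(1, 0) F (t, x))).1; rewrite E.
have -> : (fun h : R => F (h *: (1, 0) + (0, x))) = (fun h => F (h, x)) by apply/funext => s; rewrite E.
apply; apply: derivableP; exact: smooth_derivable.
Qed.

(** Differentiation under the integral. By [pairing_le] uniform convergence of the difference
    quotients is enough; it follows from two uses of the mean value theorem and a bound of the
    second time derivative on a compact set. For |h| < 1 the intermediate times stay within distance
    2 of [t]. *)
Lemma pairing_derive a (F : R * space3 R -> R) : smooth F -> forall t : R,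
  is_derive t 1 (fun t => pair a (fun x => F (t, x))) (pair a (fun x => 'D_(1, 0) F (t, x))).
Proof.
move=> sF t.
pose D1 := 'D_(1, 0) F; pose D2 := 'D_(1, 0) D1.
have s1 : smooth D1 by exact: smooth_derive.
have c0 := smooth_continuous sF; have c1 := smooth_continuous s1.
have c2 : continuous D2 by exact/smooth_continuous/smooth_derive.
have [|||m _ H] := @compact_EVT_max _ R (fun z => `|D2 z|) (`[t - 2, t + 2] `*` @cube R).
- by exists (t, (0, 0, 0)); split; [rewrite /= in_itv/=; apply/andP; split; lra|split; [split|]; rewrite /= in_itv/= lexx ler01].
- by apply: compact_setX; [exact: segment_compact|exact: compact_cube].
- by apply: continuous_subspaceT => x; apply: cvg_norm; exact: c2.
have [M [M0 HM]] : exists M, 0 <= M /\ forall z, (`[t - 2, t + 2] `*` @cube R) z -> `|D2 z| <= M.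
  by exists `|D2 m|; split; [exact: normr_ge0|move=> z /mem_set /H].
clear H.
apply: is_derive_epsilon => e e0.
exists (Num.min 1 (e / (4 * M + 1))); first by rewrite lt_min ltr01 divr_gt0//; lra.
move=> h hn0; rewrite lt_min => /andP[h1 he].
have cs (G : R * space3 R -> R) s : continuous G -> continuous (fun x => G (s, x)) by exact: continuous_pairr.
have cd : continuous (fun x => F (h + t, x) + (-1) * F (t, x)).
  by move=> x; apply: cvgD; [exact: cs|apply: cvgM; [exact: cvg_cst|exact: cs]].
have cdd : continuous (fun x => D1 (t, x) + (- h^-1) * (F (h + t, x) + (-1) * F (t, x))).
  by move=> x; apply: cvgD; [exact: cs|apply: cvgM; [exact: cvg_cst|exact: cd]].
rewrite (_ : _ - _ = pair a (fun x => D1 (t, x) + (- h^-1) * (F (h + t, x) + (-1) * F (t, x)))); last first.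
  rewrite pairing_linear//; last exact: cs.
  rewrite pairing_linear//; try exact: cs.
  by rewrite mulN1r mulNr.
apply: (@le_trans _ _ (4 * (M * `|h|))).
  apply: pairing_le => // x cx.
  have [c [ct ec]] := mvt_near t h (smooth_is_derive_time x sF).
  have [d [dt ed]] := mvt_near c (t - c) (smooth_is_derive_time x s1).
  rewrite mulN1r ec -/(D1 (c, x)).
  have -> : D1 (t, x) + - h^-1 * (D1 (c, x) * h) = D1 (t, x) - D1 (c, x) by field.
  have ed' : D1 (t, x) - D1 (c, x) = D2 (d, x) * (t - c).
    by have := ed; rewrite subrK.
  rewrite ed' normrM; apply: ler_pM; [exact: normr_ge0|exact: normr_ge0| |by rewrite distrC].
  apply: HM; split; last exact: cx.
  rewrite /= in_itv /=.
  have : `|d - t| <= 2.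
    have -> : d - t = (d - c) + (c - t) by ring.
    apply: (le_trans (ler_normD _ _)); rewrite (distrC t c) in dt.
    by move: dt ct (ltW h1); lra.
  by rewrite ler_norml => /andP[d1 d2]; apply/andP; split; lra.
have p1 : 0 < 4 * M + 1 by lra.
rewrite mulrA; apply: (@le_trans _ _ ((4 * M + 1) * `|h|)).
  by apply: ler_wpM2r => //; lra.
by rewrite mulrC -ler_pdivlMr// ltW.
Qed.

End LimitPairing.

Section WeakLimit.
Context (R : realType).
Local Notation Int f := (\int[volume]_(x in cube) f x).
Implicit Types (x : space3 R).

Lemma cube_integrableD (f g : space3 R -> R) : volume.-integrable cube (EFin \o f) ->
  volume.-integrable cube (EFin \o g) -> volume.-integrable cube (EFin \o (fun x => f x + g x)).
Proof.
move=> hf hg; rewrite (_ : EFin \o _ = ((EFin \o f) \+ (EFin \o g))%E); last first.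
  by apply/funext => x; rewrite /= EFinD.
by apply: integrableD => //; exact: measurable_cube.
Qed.

Lemma cube_RintegralD (f g : space3 R -> R) : volume.-integrable cube (EFin \o f) ->
  volume.-integrable cube (EFin \o g) -> Int (fun x => f x + g x) = Int f + Int g.
Proof. by move=> hf hg; rewrite RintegralD//; exact: measurable_cube. Qed.

Lemma cube_integrable_sum3 (F : 'I_3 -> space3 R -> R) :
  (forall i, volume.-integrable cube (EFin \o F i)) ->
  volume.-integrable cube (EFin \o (fun x => \sum_i F i x)) /\
  Int (fun x => \sum_i F i x) = \sum_i Int (F i).
Proof.
move=> iF; have E : (fun x => \sum_i F i x) = (fun x => F 0 x + F 1 x + F 2 x).
  by apply/funext => x; rewrite sum3.
rewrite E sum3; split; first by apply: cube_integrableD => //; exact: cube_integrableD.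
by rewrite cube_RintegralD ?cube_RintegralD//; exact: cube_integrableD.
Qed.

Variables (B : nat -> vfield R) (S : nat -> 'I_3 -> 'I_3 -> space3 R -> R) (kap : R).
Hypotheses (cB : forall q a, continuous (B q a)) (B0 : forall a x, B 0%N a x = 0)
  (hI : forall q a, Int (fun x => (B q.+1 a x - B q a x) ^+ 2) <= (4 ^+ q.+1)^-1)
  (bS : forall n a b, cube_bounded (S n a b))
  (Ssmall : forall n a b, Int (fun x => `|S n a b x|) <= (2 ^+ n.+1)^-1)
  (Bweak : forall n (phi : vfield R), (forall i, smooth (phi i)) -> (forall i, torus_periodic (phi i)) ->
    Int (weak_form (B n) (fun a b x => B n a x * B n b x - S n a b x) phi) = 0)
  (Bdiv : forall n psi, smooth psi -> torus_periodic psi -> Int (fun x => \sum_a B n a x * partial a psi x) = 0)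
  (Bmean : forall n a, Int (B n a) = 0)
  (Bmoment : forall n, Int (fun x => B n 0 x * B n 1 x - S n 0 1 x) = kap).
Local Notation Bl := (limit_field B).

Let bB q a : cube_bounded (B q a). Proof. exact: continuous_cube_bounded. Qed.

Let pair_cvg a (g : space3 R -> R) (cg : continuous g) := (limit_field_linear cB B0 hI a cg).2.
Let pair_int a (g : space3 R -> R) (cg : continuous g) := (limit_field_linear cB B0 hI a cg).1.
Let quad_cvg a b (g : space3 R -> R) (cg : continuous g) := (limit_field_quadratic cB B0 hI a b cg).2.
Let quad_int a b (g : space3 R -> R) (cg : continuous g) := (limit_field_quadratic cB B0 hI a b cg).1.

Let lim_eq (u : nat -> R) (l l' : R) : u @ \oo --> l -> u @ \oo --> l' -> l = l'.
Proof. by move=> h1 h2; rewrite -(cvg_lim (@Rhausdorff R) h1) (cvg_lim (@Rhausdorff R) h2). Qed.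

Lemma stress_vanishing a b (g : space3 R -> R) : continuous g ->
  (fun n => Int (fun x => S n a b x * g x)) @ \oo --> 0.
Proof.
move=> cg; have bg := continuous_cube_bounded cg; have [mg [M gM]] := bg.
have M0 : 0 <= M.
  by apply: le_trans (gM (0, 0, 0) _); [exact: normr_ge0|split; [split|]; rewrite /= in_itv/= lexx ler01].
have half1 : `|2^-1 : R| < 1 by rewrite ger0_norm ?invr_ge0// invf_lt1// ltr1n.
have c1 := cvg_geometric M half1.
have c2 : (fun n => - geometric M 2^-1 n) @ \oo --> (0 : R) by rewrite -oppr0; apply: cvgN.
have near_le : \forall n \near \oo, - geometric M 2^-1 n <= Int (fun x => S n a b x * g x) <= geometric M 2^-1 n.
  apply: nearW => n; rewrite -ler_norml /geometric /=.
  have bSg : cube_bounded (fun x => S n a b x * g x) by exact: cube_boundedM.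
  apply: (le_trans (cube_int_norm bSg)).
  have bn : cube_bounded (fun x => `|S n a b x|) by exact: cube_bounded_norm.
  apply: (@le_trans _ _ (Int (fun x => M * `|S n a b x|))).
    apply: cube_int_le; [exact: cube_bounded_norm|by apply: cube_boundedM => //; exact: cube_bounded_cst|].
    by move=> x cx; rewrite normrM mulrC; apply: ler_wpM2r => //; exact: gM.
  rewrite cube_intZ//; apply: ler_wpM2l => //; apply: (le_trans (Ssmall n a b)).
  by rewrite exprVn lef_pV2 ?posrE ?exprn_gt0//; apply: ler_weXn2l; rewrite ?ler1n.
exact: (squeeze_cvgr near_le c2 c1).
Qed.

(** At stage n the weak form of the field equals a pairing with the stress [S n]. The former
    converges by domination, the latter to 0. *)
Lemma limit_weak (phi : vfield R) : (forall i, smooth (phi i)) -> (forall i, torus_periodic (phi i)) ->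
  \sum_a Int (fun x => Bl a x * laplacian (phi a) x) +
  \sum_a \sum_b Int (fun x => Bl a x * Bl b x * partial b (curl phi a) x) = 0.
Proof.
move=> sphi pphi.
have cl a : continuous (laplacian (phi a)) by exact/smooth_continuous/smooth_laplacian.
have ct a b : continuous (partial b (curl phi a)).
  exact/smooth_continuous/smooth_partial/smooth_curl.
pose X n := \sum_a Int (fun x => B n a x * laplacian (phi a) x) +
  \sum_a \sum_b Int (fun x => B n a x * B n b x * partial b (curl phi a) x).
pose Y n := \sum_a \sum_b Int (fun x => S n a b x * partial b (curl phi a) x).
have XY : X = Y.
  apply/funext => n; apply/eqP; rewrite -subr_eq0; apply/eqP; rewrite -(Bweak n sphi pphi) /X /Y.
  have bl a : cube_bounded (fun x => B n a x * laplacian (phi a) x).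
    by apply: cube_boundedM => //; exact: continuous_cube_bounded.
  have bq a b : cube_bounded (fun x => B n a x * B n b x * partial b (curl phi a) x).
    by apply: cube_boundedM; [exact: cube_boundedM|exact: continuous_cube_bounded].
  have bs a b : cube_bounded (fun x => S n a b x * partial b (curl phi a) x).
    by apply: cube_boundedM => //; exact: continuous_cube_bounded.
  have bd a b : cube_bounded (fun x => (B n a x * B n b x - S n a b x) * partial b (curl phi a) x).
    by apply: cube_boundedM; [apply: cube_boundedB => //; exact: cube_boundedM|exact: continuous_cube_bounded].
  have bdd a : cube_bounded (fun x => \sum_b (B n a x * B n b x - S n a b x) * partial b (curl phi a) x).
    exact: cube_bounded_sum.
  rewrite (cube_intD (cube_bounded_sum _ bl) (cube_bounded_sum _ bdd)) (cube_int_sum _ bl) (cube_int_sum _ bdd).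
  rewrite -addrA; congr (_ + _); rewrite -sumrB; apply: eq_bigr => a _.
  rewrite (cube_int_sum _ (bd a)) -sumrB; apply: eq_bigr => b _.
  by rewrite -cube_intB//; apply: eq_Rintegral => x _; rewrite mulrBl.
have cX : X @ \oo --> \sum_a Int (fun x => Bl a x * laplacian (phi a) x) +
  \sum_a \sum_b Int (fun x => Bl a x * Bl b x * partial b (curl phi a) x).
  apply: cvgD; first by apply: cvg_sum3 => a; exact: pair_cvg.
  by apply: cvg_sum3 => a; apply: cvg_sum3 => b; exact: quad_cvg.
have cY : Y @ \oo --> \sum_(a < 3) \sum_(b < 3) (0 : R).
  by apply: cvg_sum3 => a; apply: cvg_sum3 => b; exact: stress_vanishing.
rewrite XY in cX; rewrite (lim_eq cX cY).
by apply: big1 => a _; apply: big1.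
Qed.

Lemma limit_div psi : smooth psi -> torus_periodic psi ->
  Int (fun x => \sum_a Bl a x * partial a psi x) = 0.
Proof.
move=> spsi ppsi.
have cp a : continuous (partial a psi) by exact/smooth_continuous/smooth_partial.
have [_ ->] := @cube_integrable_sum3 (fun a x => Bl a x * partial a psi x) (fun a => pair_int a (cp a)).
have cX : (fun n => \sum_a Int (fun x => B n a x * partial a psi x)) @ \oo -->
    \sum_a Int (fun x => Bl a x * partial a psi x) by apply: cvg_sum3 => a; exact: pair_cvg.
apply: (lim_eq cX); rewrite (_ : (fun n => _) = (fun=> 0)); first exact: cvg_cst.
apply/funext => n; apply: (etrans _ (Bdiv n spsi ppsi)); rewrite cube_int_sum// => a.
by apply: cube_boundedM => //; exact: continuous_cube_bounded.
Qed.

Lemma limit_mean a : Int (Bl a) = 0.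
Proof.
have c1 : continuous (fun _ : space3 R => 1 : R) by move=> x; exact: cvg_cst.
have e (f : space3 R -> R) : Int (fun x => f x * 1) = Int f by apply: eq_Rintegral => x _; rewrite mulr1.
apply: (etrans (esym (e (Bl a)))); have h := @pair_cvg a _ c1; apply: (lim_eq h).
rewrite (_ : (fun n => _) = (fun=> 0)); first exact: cvg_cst.
by apply/funext => n; rewrite e Bmean.
Qed.

Lemma limit_moment : Int (fun x => Bl 0 x * Bl 1 x) = kap.
Proof.
have c1 : continuous (fun _ : space3 R => 1 : R) by move=> x; exact: cvg_cst.
have e (f : space3 R -> R) : Int (fun x => f x * 1) = Int f by apply: eq_Rintegral => x _; rewrite mulr1.
apply: (etrans (esym (e (fun x => Bl 0 x * Bl 1 x)))); have h := @quad_cvg 0 1 _ c1; apply: (lim_eq h).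
rewrite (_ : (fun n => _) = (fun n => kap + Int (fun x => S n 0 1 x * 1))).
  by rewrite -[X in _ --> X]addr0; apply: cvgD; [exact: cvg_cst|exact: stress_vanishing].
apply/funext => n; rewrite -(Bmoment n) !e -cube_intD//; last by apply: cube_boundedB => //; exact: cube_boundedM.
by apply: eq_Rintegral => x _; rewrite subrK.
Qed.

(** At each fixed time the Laplacian and quadratic terms vanish together by [limit_weak]. What
    remains is the time derivative of the pairing of the field with phi(t), and this pairing is 0 at
    time T. *)
Lemma limit_time_identity (phi : R -> vfield R) (T : R) : 0 < T -> test_field T phi ->
  \int[lebesgue R]_(t in `[0, T]) Int (dot Bl (fun i y => time_derivative phi t i y
     + laplacian (phi t i) y + advect Bl (curl (phi t)) i y)) = - Int (dot Bl (phi 0)).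
Proof.
move=> T0 [sphi pphi [T' T'T phi0] _].
pose F i : R * space3 R -> R := fun z => phi z.1 i z.2.
have sF i : smooth (F i) := sphi i.
pose pr i (g : space3 R -> R) := Int (fun x => Bl i x * g x).
pose DF i : R * space3 R -> R := 'D_(1, 0) (F i).
have sDF i : smooth (DF i) by exact: smooth_derive.
have slice (G : R * space3 R -> R) t : smooth G -> continuous (fun x => G (t, x)).
  by move=> sG; apply: continuous_pairr; exact: smooth_continuous.
pose A t := pr 0 (fun x => F 0 (t, x)) + pr 1 (fun x => F 1 (t, x)) + pr 2 (fun x => F 2 (t, x)).
pose dA t := pr 0 (fun x => DF 0 (t, x)) + pr 1 (fun x => DF 1 (t, x)) + pr 2 (fun x => DF 2 (t, x)).
have dAP (t : R) : is_derive t 1 A (dA t).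
  by apply: is_deriveDl; [apply: is_deriveDl|]; exact: (pairing_derive cB B0 hI).
have cdA : continuous dA.
  move=> t; apply: is_derive_continuous.
  by apply: is_deriveDl; [apply: is_deriveDl|]; exact: (pairing_derive cB B0 hI).
have td t i y : time_derivative phi t i y = DF i (t, y).
  by rewrite /time_derivative derive1E; have [_ ->] := smooth_is_derive_time y (sF i) t.
have inner t : Int (dot Bl (fun i y => time_derivative phi t i y
     + laplacian (phi t i) y + advect Bl (curl (phi t)) i y)) = dA t.
  have st i : smooth (phi t i) by exact: (smooth_slice t (sF i)).
  have cl a : continuous (laplacian (phi t a)) by exact/smooth_continuous/smooth_laplacian.
  have ct a b : continuous (partial b (curl (phi t) a)).
    exact/smooth_continuous/smooth_partial/smooth_curl.
  have [i1 e1] := @cube_integrable_sum3 (fun i x => Bl i x * DF i (t, x)) (fun i => pair_int i (slice _ t (sDF i))).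
  have [i2 e2] := @cube_integrable_sum3 (fun i x => Bl i x * laplacian (phi t i) x) (fun i => pair_int i (cl i)).
  have iq i := @cube_integrable_sum3 (fun j x => Bl i x * Bl j x * partial j (curl (phi t) i) x) (fun j => quad_int i j (ct i j)).
  have [i3 e3] := @cube_integrable_sum3 (fun i x => \sum_j Bl i x * Bl j x * partial j (curl (phi t) i) x) (fun i => (iq i).1).
  transitivity (Int (fun x => \sum_i Bl i x * DF i (t, x) + (\sum_i Bl i x * laplacian (phi t i) x +
      \sum_i \sum_j Bl i x * Bl j x * partial j (curl (phi t) i) x))).
    apply: eq_Rintegral => x _; rewrite /dot -!big_split /=; apply: eq_bigr => i _.
    rewrite td !mulrDr -addrA; congr (_ + (_ + _)); rewrite /advect mulr_sumr.
    by apply: eq_bigr => j _; rewrite mulrA.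
  rewrite (cube_RintegralD i1 (cube_integrableD i2 i3)) (cube_RintegralD i2 i3) e1 e2 e3.
  have e4 : \sum_i Int (fun x => \sum_j Bl i x * Bl j x * partial j (curl (phi t) i) x) =
      \sum_i \sum_j Int (fun x => Bl i x * Bl j x * partial j (curl (phi t) i) x).
    by apply: eq_bigr => i _; exact: (iq i).2.
  rewrite e4; have lw := limit_weak st (fun i => pphi t i).
  by apply: (etrans (congr1 (+%R _) lw)); rewrite addr0 /dA sum3.
transitivity (\int[lebesgue R]_(t in `[0, T]) dA t); first by apply: eq_Rintegral => t _; exact: inner.
rewrite (Rintegral_derivative (ltW T0) dAP cdA).
have AT : A T = 0.
  have z i : pr i (fun x => F i (T, x)) = 0.
    transitivity (Int (fun=> 0 : R)); last exact: cube_int_cst.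
    by apply: eq_Rintegral => x _; rewrite /F /= phi0 ?mulr0// ltW.
  by rewrite /A !z !addr0.
rewrite AT sub0r; congr (- _).
have [_ e] := @cube_integrable_sum3 (fun i x => Bl i x * F i (0, x)) (fun i => pair_int i (slice _ 0 (sF i))).
exact: (etrans (esym (sum3 (fun i => pr i (fun x => F i (0, x))))) (esym e)).
Qed.

End WeakLimit.

(** * Square integrability on the cube and on the space-time cylinder *)

Section SquareIntegrable.
Context (R : realType).

Lemma Lfun2_intro d (T : measurableType d) (mu : {measure set T -> \bar R}) (f : T -> R) :
  measurable_fun setT f -> (\int[mu]_x (f x ^+ 2)%:E < +oo)%E -> f \in Lfun mu 2%:E.
Proof.
move=> mf lf; rewrite inE; apply/andP; split; rewrite inE/=; first exact: mf.
rewrite /finite_norm unlock /=; apply: poweR_lty; apply: le_lt_trans lf.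
rewrite le_eqVlt; apply/orP; left; apply/eqP; apply: eq_integral => x _.
by rewrite /= ?poweR_EFin powR_mulrn// real_normK// num_real.
Qed.

Lemma restrict_sqr (T : Type) (A : set T) (f : T -> R) :
  (fun x => ((f \_ A) x ^+ 2)%:E) = (EFin \o (fun x => f x ^+ 2)) \_ A.
Proof. by apply/funext => x; rewrite /patch; case: ifP => //= _; rewrite expr0n. Qed.

Variable f : space3 R -> R.
Hypotheses (mf : measurable_fun setT f)
  (sf : volume.-integrable cube (EFin \o (fun x => f x ^+ 2))).

Let int_sqr : (\int[volume]_(x in cube) (f x ^+ 2)%:E < +oo)%E.
Proof.
have /integrableP[_] := sf; apply: le_lt_trans; rewrite le_eqVlt; apply/orP; left; apply/eqP.
by apply: eq_integral => x _; rewrite /= ger0_norm ?sqr_ge0.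
Qed.

Lemma restrict_cube_Lfun : (f \_ cube) \in Lfun volume 2%:E.
Proof.
apply: Lfun2_intro.
  by apply: (measurable_restrictT _ (@measurable_cube R)).1; exact: measurable_funTS.
by rewrite restrict_sqr -integral_mkcond.
Qed.

Lemma restrict_cylinder_Lfun (T : R) :
  ((fun z : R * space3 R => f z.2) \_ (`[0, T] `*` cube)) \in Lfun (lebesgue R \x volume)%E 2%:E.
Proof.
have mI : measurable (`[0, T] : set R) by exact: measurable_itv.
have mA : measurable (`[0, T] `*` @cube R) by apply: measurableX => //; exact: measurable_cube.
have mg : measurable_fun setT (fun z : R * space3 R => f z.2).
  by apply: (measurableT_comp mf); exact: measurable_snd.
apply: Lfun2_intro.
  by apply: (measurable_restrictT _ mA).1; exact: measurable_funTS.
rewrite restrict_sqr.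
have mh : measurable_fun setT ((EFin \o (fun z : R * space3 R => f z.2 ^+ 2)) \_ (`[0, T] `*` @cube R)).
  apply: (measurable_restrictT _ mA).1; apply: measurable_funTS; apply/measurable_EFinP.
  exact: measurable_funX.
rewrite fubini_tonelli1//; last first.
  by move=> z; rewrite /patch; case: ifP => // _; rewrite /= lee_fin sqr_ge0.
rewrite /fubini_F.
set C := (\int[volume]_(x in cube) (f x ^+ 2)%:E)%E.
rewrite (_ : (fun t : R => _) = (cst C) \_ `[0, T]); last first.
  apply/funext => t; rewrite [RHS]/patch; case: ifPn => tT.
    rewrite /cst /C [RHS]integral_mkcond; apply: eq_integral => x _; rewrite /patch.
    suff -> : ((t, x) \in `[0, T] `*` @cube R) = (x \in @cube R) by [].
    by rewrite in_setX /= tT.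
  rewrite integral0_eq// => x _; rewrite /patch.
  suff -> : ((t, x) \in `[0, T] `*` @cube R) = false by [].
  by rewrite in_setX /= (negbTE tT).
rewrite -integral_mkcond integral_cst// [X in (_ * X)%E](lebesgue_measure_itv `[0, T]) /=.
have C0 : (0 <= C)%E by apply: integral_ge0 => x _; rewrite lee_fin sqr_ge0.
case: ifP => _; last by rewrite mule0.
rewrite -EFinB; have -> : C = (fine C)%:E by rewrite fineK// ge0_fin_numE.
by rewrite -EFinM ltry.
Qed.

End SquareIntegrable.

Section Nontrivial.
Context (R : realType).
Local Notation Int f := (\int[volume]_(x in cube) f x).

Let aeS (P Q : space3 R -> Prop) : (forall x, P x -> Q x) ->
  {ae volume, forall x, P x} -> {ae volume, forall x, Q x}.
Proof.
by move=> PQ [N [mN N0 PN]]; exists N; split=> // x nQ; apply: PN => Px; apply: nQ; exact: PQ.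
Qed.

Lemma ae_constant_integral (f : space3 R -> R) (c : R) : measurable_fun setT f ->
  {ae volume, forall x, f x = c} -> Int f = c.
Proof.
move=> mf fc; rewrite -[RHS](@cube_int_cst R); congr fine.
apply: ae_eq_integral.
- exact: measurable_cube.
- by apply/measurable_EFinP; exact: measurable_funTS.
- by apply/measurable_EFinP; apply: measurable_funTS; exact: measurable_cst.
- by apply: (aeS _ fc) => x ->.
Qed.

(** A constant field of mean zero is zero, which would make the moment vanish. *)
Lemma moment_nontrivial (B : vfield R) (kap : R) : (forall i, measurable_fun setT (B i)) ->
  (forall i, Int (B i) = 0) -> Int (fun x => B 0 x * B 1 x) = kap -> 0 < kap -> nontrivial B.
Proof.
move=> mB B0 B01 k0 [c cE].
have c0 : c 0 = 0.
  by rewrite -(B0 0); apply/esym/ae_constant_integral => //; apply: (aeS _ cE) => x; exact.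
have : Int (fun x => B 0 x * B 1 x) = c 0 * c 1.
  apply: ae_constant_integral; first exact: measurable_funM.
  by apply: (aeS _ cE) => x e; rewrite !e.
by rewrite B01 c0 mul0r => e; rewrite e ltxx in k0.
Qed.

End Nontrivial.

Theorem theorem1p2 (R : realType) (s : R) (hs : s < 1 / 250) :
  exists B : vfield R,
    [/\ forall i, torus_L2 (B i),
        stationary_weak_solution B,
        nontrivial B
      & forall i, sobolev s (B i)].
Proof.
have [L [z [kap [L0 Lnext kap0 z0 zP]]]] := @stage_sequence R.
pose B q := (z q).1; pose S q := (z q).2; pose l q : R := (L q)%:R.
have relB q : relaxed (l q ^+ 13) (l q ^+ 65) (l q ^- 6) kap (B q) (S q) by case: (zP q).
have bw q a : bC1 (l q ^+ 78) (l q ^+ 385) (fun x => B q.+1 a x - B q a x) by have [_ [h _]] := zP q; exact: h.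
have w2 q a : \int[volume]_(x in cube) (B q.+1 a x - B q a x) ^+ 2 <= l q ^- 5 by have [_ [_ h]] := zP q; exact: h.
have Lge q : (64 ^ q.+1 <= L q)%N.
  elim: q => [|q IH]; first by rewrite expn1.
  rewrite Lnext (expnS (L q) 5) expnS; apply: leq_mul; first by apply: leq_trans IH; rewrite expnS leq_pmulr// expn_gt0.
  by apply: (leq_trans IH); rewrite -[leqLHS]expn1 leq_pexp2l// (leq_trans _ IH)// expn_gt0.
have l64 q : 64 ^+ q.+1 <= l q by rewrite /l -natrX ler_nat.
have l1 q : 1 <= l q by apply: le_trans (l64 q); apply: exprn_ege1; rewrite ler1n.
have l0 q : 0 < l q by exact: lt_le_trans (l1 q).
(* l_p >= 64^(p+1) beats the geometric rates 4 and 2 required of the increments and of the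
   stress. *)
have inv_le p n (c : R) : 1 <= c -> c <= 64 -> l p ^- n.+1 <= (c ^+ p.+1)^-1.
  move=> c1 c64; have cq : 0 < c ^+ p.+1 by rewrite exprn_gt0// (lt_le_trans _ c1).
  have lp : 0 < l p ^+ n.+1 by rewrite exprn_gt0// l0.
  rewrite lef_pV2 ?posrE//.
  apply: (@le_trans _ _ (64 ^+ p.+1)).
    by apply: lerXn2r; rewrite ?nnegrE//; exact: le_trans c1.
  by apply: (le_trans (l64 p)); rewrite -[leLHS]expr1; apply: ler_weXn2l.
have cB q a : continuous (B q a) by exact: bC1_continuous (relaxed_field (relB q) a).
have pB q a : torus_periodic (B q a) by have [] := relaxed_field (relB q) a.
have B0 a x : B 0%N a x = 0 by rewrite /B z0.
have hI q a : \int[volume]_(x in cube) (B q.+1 a x - B q a x) ^+ 2 <= (4 ^+ q.+1)^-1.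
  have h1 : 1 <= (4 : R) by rewrite ler1n.
  have h2 : 4 <= (64 : R) by rewrite ler_nat.
  exact: le_trans (w2 q a) (inv_le q 4%N 4 h1 h2).
have bS n a b : cube_bounded (S n a b) by exact: bC1_cube_bounded (relaxed_stress (relB n) a b).
have Ssmall n a b : \int[volume]_(x in cube) `|S n a b x| <= (2 ^+ n.+1)^-1.
  have h1 : 1 <= (2 : R) by rewrite ler1n.
  have h2 : 2 <= (64 : R) by rewrite ler_nat.
  exact: le_trans (relaxed_small (relB n) a b) (inv_le n 5%N 2 h1 h2).
have Bweak n := relaxed_weak (relB n); have Bdiv n := relaxed_div (relB n).
have Bmean n a := relaxed_mean (relB n) a; have Bmoment n := relaxed_moment (relB n).
have mB := limit_field_measurable cB B0.
have sB a : volume.-integrable cube (EFin \o (fun x => limit_field B a x ^+ 2)).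
  have c1 : continuous (fun _ : space3 R => 1 : R) by move=> x; exact: cvg_cst.
  have [+ _] := limit_field_quadratic cB B0 hI a a c1.
  congr (integrable _ _ _); apply/funext => x /=; by rewrite mulr1 expr2.
have div psi := limit_div cB B0 hI Bdiv (psi := psi).
exists (limit_field B); split.
- move=> i; split; first exact: limit_field_periodic.
  exact: restrict_cube_Lfun.
- move=> T T0; split.
  + split; last by move=> psi; exact: div.
    by move=> i; split; [exact: limit_field_periodic|exact: restrict_cube_Lfun].
  + split; first by move=> t i; exact: limit_field_periodic.
    by move=> i; exact: restrict_cylinder_Lfun.
  + by apply: aeW => t _ psi; exact: div.
  + by move=> phi; exact: (limit_time_identity cB B0 hI bS Ssmall Bweak T0).
- apply: (@moment_nontrivial R _ kap) => //.
  + exact: (limit_mean cB B0 hI Bmean).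
  + exact: (limit_moment cB B0 hI bS Ssmall Bmoment).
- by move=> i; exact: (limit_sobolev cB B0 hI l64 bw w2 (ltW hs)).
Qed.
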